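(* Let $K_1\ge 1$ and let $L>0$ with $L\notin\mathcal N$. There exists an effectively computable $\gamma=\gamma(L,K_1)>0$ such that the set $$\mathcal B_\gamma(K_1)=\Big\{u\in H^3(0,L;\mathbb C):\ \|u\|_{L^2}=1,\ \|u\|_{H^3}\le K_1,\ u(0)=u(L)=u_x(L)=0,\ |u_x(0)|<\gamma,\ \inf_{\lambda\in\mathbb C}\|\lambda u-u_x-u_{xxx}\|_{L^2}<\gamma\Big\}$$ is empty.
   Context: The set of critical lengths is $\mathcal N=\left\{2\pi\sqrt{\frac{k^2+kl+l^2}{3}}:\ k,l\in\mathbb N^*\right\}$, with $\mathbb N^*=\{1,2,3,\dots\}$. All norms are over $(0,L)$, and the $H^3$ norm is $\|u\|_{H^3}^2=\int_0^L\big(|u'''(x)|^2+|u(x)|^2\big)\,dx$. ''Effectively computable'' means that the constant can be explicitly determined from $L$ and $K_1$ by a constructive procedure (not merely shown to exist by a contradiction/compactness argument). *)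

(* Defs.v *)
From HB Require Import structures.
From mathcomp Require Import all_boot all_order all_algebra.
From mathcomp Require Import all_classical all_reals all_analysis.
From mathcomp Require Import complex.

Set Implicit Arguments.
Unset Strict Implicit.
Unset Printing Implicit Defensive.

Import Order.TTheory GRing.Theory Num.Theory numFieldNormedType.Exports.
Export complex.

Local Open Scope classical_set_scope.
Local Open Scope ring_scope.
Local Open Scope complex_scope.

(** Kleene's partial recursive functionals of two oracles [a b : nat -> nat].
    Conventions: a missing argument is read as 0 and a surplus one is ignored;
    [MuPrec f g] recurses on the first argument; [MuMin f] searches for the
    least value of the first argument of [f] at which [f] vanishes. *)
Inductive mu_rec : Type :=
| MuZero
| MuSucc
| MuProj of nat
| MuOracle1
| MuOracle2
| MuComp of mu_rec & seq mu_rec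
| MuPrec of mu_rec & mu_rec
| MuMin of mu_rec.

(** [mu_eval a b p xs y]: with oracles [a] and [b], the program [p] halts on the
    arguments [xs] with value [y].  In the case of [MuPrec], [t] is the sequence
    of the intermediate values of the recursion. *)
Fixpoint mu_eval (a b : nat -> nat) (p : mu_rec) (xs : seq nat) (y : nat) :
    Prop :=
  match p with
  | MuZero => y = 0%N
  | MuSucc => y = (nth 0%N xs 0).+1
  | MuProj i => y = nth 0%N xs i
  | MuOracle1 => y = a (nth 0%N xs 0)
  | MuOracle2 => y = b (nth 0%N xs 0)
  | MuComp f gs =>
      exists ys : seq nat,
        (fix eval_all (gs : seq mu_rec) (ys : seq nat) : Prop :=
           match gs, ys with
           | [::], [::] => True
           | g :: gs', z :: ys' => mu_eval a b g xs z /\ eval_all gs' ys'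
           | _, _ => False
           end) gs ys
        /\ mu_eval a b f ys y
  | MuPrec f g =>
      exists t : nat -> nat,
        [/\ mu_eval a b f (behead xs) (t 0%N),
            (forall i, (i < nth 0 xs 0)%N ->
               mu_eval a b g (i :: t i :: behead xs) (t i.+1)) &
            y = t (nth 0%N xs 0)]
  | MuMin f =>
      (forall i, (i < y)%N -> exists v, mu_eval a b f (i :: xs) v.+1)
      /\ mu_eval a b f (y :: xs) 0%N
  end.

(** Only nonnegative reals have such a name, which suffices here: both arguments
    and the values of the function at hand are positive. *)
Definition names (R : realType) (a : nat -> nat) (x : R) : Prop :=
  forall n, `|x - (a n)%:R / n.+1%:R| <= n.+1%:R^-1.

(** Computability in the sense of Grzegorczyk and Lacombe: one program turns any
    names of [x] and [y] with [(x, y)] in [D] into a name of [f x y]. *)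
Definition computable_on (R : realType) (D : set (R * R)) (f : R -> R -> R) :
    Prop :=
  exists p : mu_rec, forall (x y : R) (a b : nat -> nat),
    D (x, y) -> names a x -> names b y ->
    exists c : nat -> nat,
      (forall n, mu_eval a b p [:: n] (c n)) /\ names c (f x y).

Section FunctionSpaces.
Variables (R : realType) (L : R).
Local Notation mu := (@lebesgue_measure R).
Local Notation I := (`]0, L[%classic : set R).
Implicit Types (u v w : R -> R[i]).

Definition is_L2 u : Prop :=
  [/\ measurable_fun I (fun x => complex.Re (u x)),
      measurable_fun I (fun x => complex.Im (u x)) &
      (\int[mu]_(x in I) (ComplexField.Normc.normc (u x) ^+ 2)%:E < +oo)%E].

Definition norm_L2 u : R :=
  Num.sqrt (\int[mu]_(x in I) (ComplexField.Normc.normc (u x) ^+ 2)).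

(** C^1 functions with compact support in (0, L), the test functions of
    H. Brezis, "Functional Analysis, Sobolev Spaces and PDE", Chapter 8. *)
Definition is_test (phi : R -> R) : Prop :=
  [/\ (forall x, derivable phi x 1), continuous (derive1 phi) &
      exists c d, [/\ 0 < c, d < L &
        forall x, x \notin `[c, d] -> phi x = 0]].

Definition weak_derivative_real (f g : R -> R) : Prop :=
  forall phi, is_test phi ->
    \int[mu]_(x in I) (f x * derive1 phi x) = - \int[mu]_(x in I) (g x * phi x).

(** The test functions being real valued, the complex integration by parts
    formula is the conjunction of its real and imaginary parts. *)
Definition weak_derivative u v : Prop :=
  weak_derivative_real (fun x => complex.Re (u x)) (fun x => complex.Re (v x))
  /\ weak_derivative_real (fun x => complex.Im (u x)) (fun x => complex.Im (v x)).

(** [u] belongs to H^3(0, L; C), with successive weak derivatives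
    [u1], [u2], [u3]. *)
Definition is_H3 u u1 u2 u3 : Prop :=
  [/\ is_L2 u, is_L2 u1, is_L2 u2 & is_L2 u3] /\
  [/\ weak_derivative u u1, weak_derivative u1 u2 & weak_derivative u2 u3].

Definition norm_H3 u u3 : R :=
  Num.sqrt (\int[mu]_(x in I)
    (ComplexField.Normc.normc (u3 x) ^+ 2 + ComplexField.Normc.normc (u x) ^+ 2)).

(** The value at a point of [0, L] of an element of a Sobolev space is the value
    of its continuous representative. *)
Definition has_trace u (x : R) (z : R[i]) : Prop :=
  exists w,
    [/\ {within `[0, L], continuous (fun t => complex.Re (w t))},
        {within `[0, L], continuous (fun t => complex.Im (w t))},
        {ae mu, forall t, I t -> w t = u t} &
        w x = z].

End FunctionSpaces.

Definition critical_lengths (R : realType) : set R :=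
  [set L | exists k l : nat, [/\ (0 < k)%N, (0 < l)%N &
     L = 2 * pi * Num.sqrt ((k ^ 2 + k * l + l ^ 2)%N%:R / 3)]].
Arguments critical_lengths : clear implicits.

Definition Bset (R : realType) (L K1 gamma : R) : set (R -> R[i]) :=
  [set u | exists u1 u2 u3 : R -> R[i],
    [/\ is_H3 L u u1 u2 u3, norm_L2 L u = 1 & norm_H3 L u u3 <= K1] /\
    [/\ has_trace L u 0 0, has_trace L u L 0 & has_trace L u1 L 0] /\
    (exists z, has_trace L u1 0 z /\ ComplexField.Normc.normc z < gamma) /\
    inf [set norm_L2 L (fun x => lambda * u x - u1 x - u3 x)
        | lambda in [set: R[i]]] < gamma].

(* Main.v *)
Require Import Defs.
From mathcomp Require Import all_boot all_order all_algebra.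
From mathcomp Require Import all_classical all_reals all_analysis.
From mathcomp Require Import measurable_realfun.
From mathcomp Require Import ring lra zify.

(** Let [N] be an integer with [K1, L < N], [1/N < L] and
    [1/N < |3 L^2 - 4 pi^2 (k^2 + k l + l^2)|] for all [1 <= k, l <= N].
    If [u] lies in the set and [lambda u - u' - u'''] is small, test this residual
    against the solution [g] of the adjoint problem
    [g''' + g' + lambda g = conj u], [g 0 = g L = 0]: integration by parts gives
    [1 = |u|^2 = int (lambda u - u' - u''') g + u'(0) g'(0)], which is impossible
    when the residual and [u'(0)] are small with respect to [g] and [g'(0)].
    The function [g] is explicit in the roots [nu_i] of [nu^3 + nu + lambda], and
    is under control as soon as [exp (nu_i L)] and [exp (nu_j L)] are apart for
    some pair. Otherwise all the [(nu_i - nu_j) L] are close to nonzero multiples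
    of [2 i pi], and [3 L^2] is close to some [4 pi^2 (k^2 + k l + l^2)].
    Testing the residual against [conj u] bounds [lambda], hence the [nu_i].

    All this yields a bound [1 / G N] with [G] primitive recursive. The conditions
    on [N] being open, [gamma] is the supremum over [N] of [1 / G N] truncated by
    the slack in these conditions: the [N]-th term is computable and at most
    [1 / (N + 1)], so that finitely many terms give [gamma] to any precision. *)

Set Implicit Arguments.
Unset Strict Implicit.
Unset Printing Implicit Defensive.

Import Order.TTheory GRing.Theory Num.Theory numFieldNormedType.Exports.

Local Open Scope classical_set_scope.
Local Open Scope ring_scope.

(** One program has to compute gamma from names of L and K, and it cannot decide comparisons between
    these reals. Selecting one admissible N is thus out of reach: every N has to contribute a value
    that is continuous in L and K and vanishes when N is not admissible. The final constant must be
    free of lambda, which ranges over all complex numbers, and of the distances between the roots,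
    which may coincide. For the first, lambda is bounded although the norm at hand contains neither
    u' nor u'': an auxiliary problem k'' = conj u trades u' for u'''. For the second, exponentials
    enter through (exp (delta L) - 1) / delta, read as L at delta = 0, and the cubic equation is
    solved as three successive first-order equations. The quadratic form comes from the relations of
    Vieta: the differences of the roots have sum 0 and squares of sum -6, and three nonzero integers
    of sum 0 have squares of sum 2 (k^2 + k l + l^2). As g has no compact support, boundary terms
    are recovered as limits along cutoff functions. *)

(** * Primitive recursive functionals of two oracles *)

Definition functional := (nat -> nat) -> (nat -> nat) -> seq nat -> nat.

(** The length of the argument list is fixed because composition and recursion have to copy the
    arguments one by one, which a program can only do for a known number of them. *)
Definition primrec (k : nat) (F : functional) : Prop :=
  exists p, forall a b xs, size xs = k -> mu_eval a b p xs (F a b xs).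

Lemma primrec_ext k (F G : functional) :
  (forall a b xs, size xs = k -> F a b xs = G a b xs) ->
  primrec k F -> primrec k G.
Proof. by move=> FG [p pF]; exists p => a b xs xsk; rewrite -FG//; exact: pF. Qed.

Lemma primrec_proj k i : primrec k (fun _ _ xs => nth 0%N xs i).
Proof. by exists (MuProj i). Qed.

Fixpoint all_primrec k (Gs : seq functional) : Prop :=
  if Gs is G :: Gs' then primrec k G /\ all_primrec k Gs' else True.

Lemma primrec_comp j k (F : functional) (Gs : seq functional) :
  size Gs = j -> primrec j F -> all_primrec k Gs ->
  primrec k (fun a b xs => F a b [seq G a b xs | G : functional <- Gs]).
Proof.
move=> <- [p pF] prGs.
(* The fixpoint nested in [mu_eval] is anonymous: it is repeated verbatim so that the induction on
   the list of functionals can speak of it. *)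
have [qs qsP] : exists qs, forall a b xs, size xs = k ->
    (fix eval_all (gs : seq mu_rec) (ys : seq nat) : Prop :=
       match gs, ys with
       | [::], [::] => True
       | g :: gs', z :: ys' => mu_eval a b g xs z /\ eval_all gs' ys'
       | _, _ => False
       end) qs [seq G a b xs | G : functional <- Gs].
  elim: Gs {pF} prGs => [|G Gs IH] /= => [_|[[q qG] /IH[qs qsP]]].
    by exists [::].
  by exists (q :: qs) => a b xs xsk; split; [exact: qG|exact: qsP].
exists (MuComp p qs) => a b xs xsk.
exists [seq G a b xs | G : functional <- Gs]; split; first exact: qsP.
by apply: pF; rewrite size_map.
Qed.

Lemma primrec_comp1 k (F G : functional) : primrec 1 F -> primrec k G ->
  primrec k (fun a b xs => F a b [:: G a b xs]).
Proof. by move=> pF pG; apply: (@primrec_comp 1 k F [:: G]). Qed.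

Lemma primrec_comp2 k (F G H : functional) :
  primrec 2 F -> primrec k G -> primrec k H ->
  primrec k (fun a b xs => F a b [:: G a b xs; H a b xs]).
Proof. by move=> pF pG pH; apply: (@primrec_comp 2 k F [:: G; H]). Qed.

Lemma primrec_succ k (G : functional) : primrec k G ->
  primrec k (fun a b xs => (G a b xs).+1).
Proof.
apply: (@primrec_comp1 k (fun _ _ xs => (nth 0%N xs 0).+1)).
by exists MuSucc.
Qed.

Lemma primrec_oracle1 k (G : functional) : primrec k G ->
  primrec k (fun a b xs => a (G a b xs)).
Proof.
apply: (@primrec_comp1 k (fun a _ xs => a (nth 0%N xs 0))).
by exists MuOracle1.
Qed.

Lemma primrec_oracle2 k (G : functional) : primrec k G ->
  primrec k (fun a b xs => b (G a b xs)).
Proof.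
apply: (@primrec_comp1 k (fun _ b xs => b (nth 0%N xs 0))).
by exists MuOracle2.
Qed.

Lemma primrec_const k c : primrec k (fun _ _ _ => c).
Proof. by elim: c => [|c /primrec_succ//]; exists MuZero. Qed.

(** A program cannot hand over its argument list as a whole; composing with these projections copies
    the [k] arguments that follow the first [m]. *)
Definition projections (m k : nat) : seq functional :=
  [seq (fun _ _ xs => nth 0%N xs (m + i)) | i <- iota 0 k].

Lemma size_projections m k : size (projections m k) = k.
Proof. by rewrite size_map size_iota. Qed.

Lemma all_primrec_projections m k j : all_primrec j (projections m k).
Proof.
rewrite /projections; elim: (iota 0 k) => //= i s IH.
by split => //; exact: primrec_proj.
Qed.

Lemma map_projections a b ys xs m k : size ys = m -> size xs = k ->
  [seq G a b (ys ++ xs) | G : functional <- projections m k] = xs.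
Proof.
move=> ysm xsk; rewrite /projections -map_comp -[RHS](mkseq_nth 0%N) /mkseq xsk.
apply: eq_map => i /=.
by rewrite nth_cat ysm ltnNge leq_addr/= addKn.
Qed.

(** [MuPrec] recurses on its own first argument, whereas the number of iterations is here any
    functional [B] of the arguments: the recursion runs on an extra argument, for which [B] is then
    substituted. *)
Lemma primrec_iter k (F H B : functional) :
  primrec k F -> primrec k.+2 H -> primrec k B ->
  primrec k (fun a b xs => nat_rect (fun=> nat) (F a b xs)
                             (fun i r => H a b (i :: r :: xs)) (B a b xs)).
Proof.
move=> [p pF] [q qH] prB.
have prR : primrec k.+1 (fun a b xs => nat_rect (fun=> nat) (F a b (behead xs))
      (fun i r => H a b (i :: r :: behead xs)) (nth 0%N xs 0)).
  exists (MuPrec p q) => a b [//|x xs] [xsk] /=.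
  exists (nat_rect (fun=> nat) (F a b xs) (fun i r => H a b (i :: r :: xs))).
  split => //=; first exact: pF.
  by move=> i _; apply: qH; rewrite /= xsk.
have := @primrec_comp k.+1 k _ (B :: projections 0 k) _ prR.
rewrite /= size_projections => /(_ erefl).
move=> /(_ (conj prB (all_primrec_projections _ _ _))).
apply: primrec_ext => a b xs xsk.
by have /= -> := @map_projections a b [::] xs 0 k erefl xsk.
Qed.

(** Skips the accumulator in second position, so that a summand that depends only on the index can
    serve in the step of an iteration. *)
Lemma primrec_drop1 k (H : functional) : primrec k.+1 H ->
  primrec k.+2 (fun a b xs => H a b (nth 0%N xs 0 :: behead (behead xs))).
Proof.
move=> pH; have := @primrec_comp k.+1 k.+2 H
  ((fun _ _ xs => nth 0%N xs 0) :: projections 2 k) _ pH.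
rewrite /= size_projections => /(_ erefl).
move=> /(_ (conj (primrec_proj _ _) (all_primrec_projections _ _ _))).
apply: primrec_ext => a b [//|x [//|y xs]] [xsk].
by have /= -> := @map_projections a b [:: x; y] xs 2 k erefl xsk.
Qed.

Lemma primrec_add k (F G : functional) : primrec k F -> primrec k G ->
  primrec k (fun a b xs => F a b xs + G a b xs)%N.
Proof.
move=> pF pG; apply: (primrec_ext _ (@primrec_iter k F
  (fun _ _ xs => (nth 0%N xs 1).+1) G pF (primrec_succ (primrec_proj _ _)) pG)).
move=> a b xs xsk; elim: (G a b xs) => [|g IH] /=; first by rewrite addn0.
by rewrite IH addnS.
Qed.

Lemma primrec_mul k (F G : functional) : primrec k F -> primrec k G ->
  primrec k (fun a b xs => F a b xs * G a b xs)%N.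
Proof.
apply: (@primrec_comp2 k (fun _ _ xs => nth 0%N xs 0 * nth 0%N xs 1)%N).
apply: (primrec_ext _ (@primrec_iter 2 (fun _ _ _ => 0%N)
  (fun _ _ xs => nth 0%N xs 1 + nth 0%N xs 2)%N (fun _ _ xs => nth 0%N xs 1)
  (primrec_const _ _) _ (primrec_proj _ _))).
  move=> a b xs xsk /=; elim: (nth 0%N xs 1) => [|g IH] /=; first by rewrite muln0.
  by rewrite IH mulnS addnC.
by apply: primrec_add; exact: primrec_proj.
Qed.

Lemma primrec_exp k (F G : functional) : primrec k F -> primrec k G ->
  primrec k (fun a b xs => F a b xs ^ G a b xs)%N.
Proof.
apply: (@primrec_comp2 k (fun _ _ xs => nth 0%N xs 0 ^ nth 0%N xs 1)%N).
apply: (primrec_ext _ (@primrec_iter 2 (fun _ _ _ => 1%N)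
  (fun _ _ xs => nth 0%N xs 1 * nth 0%N xs 2)%N (fun _ _ xs => nth 0%N xs 1)
  (primrec_const _ _) _ (primrec_proj _ _))).
  move=> a b xs xsk /=; elim: (nth 0%N xs 1) => [|g IH] /=; first by rewrite expn0.
  by rewrite IH expnS mulnC.
by apply: primrec_mul; exact: primrec_proj.
Qed.

Lemma primrec_pred k (F : functional) : primrec k F ->
  primrec k (fun a b xs => (F a b xs).-1).
Proof.
move=> pF; apply: (primrec_ext _ (@primrec_iter k (fun _ _ _ => 0%N)
  (fun _ _ xs => nth 0%N xs 0) F (primrec_const _ _) (primrec_proj _ _) pF)).
by move=> a b xs xsk; case: (F a b xs).
Qed.

Lemma primrec_sub k (F G : functional) : primrec k F -> primrec k G ->
  primrec k (fun a b xs => F a b xs - G a b xs)%N.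
Proof.
move=> pF pG; apply: (primrec_ext _ (@primrec_iter k F
  (fun _ _ xs => (nth 0%N xs 1).-1) G pF (primrec_pred (primrec_proj _ _)) pG)).
move=> a b xs xsk; elim: (G a b xs) => [|g IH] /=; first by rewrite subn0.
by rewrite IH subnS.
Qed.

Lemma primrec_min k (F G : functional) : primrec k F -> primrec k G ->
  primrec k (fun a b xs => minn (F a b xs) (G a b xs)).
Proof.
move=> pF pG; have := primrec_sub pF (primrec_sub pF pG).
by apply: primrec_ext => a b xs xsk; rewrite minnE.
Qed.

Lemma primrec_max k (F G : functional) : primrec k F -> primrec k G ->
  primrec k (fun a b xs => maxn (F a b xs) (G a b xs)).
Proof.
move=> pF pG; have := primrec_add pF (primrec_sub pG pF).
by apply: primrec_ext => a b xs xsk; rewrite maxnE.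
Qed.

Lemma primrec_sum k (H B : functional) : primrec k.+1 H -> primrec k B ->
  primrec k (fun a b xs => \sum_(i < B a b xs) H a b ((i : nat) :: xs))%N.
Proof.
move=> pH pB; apply: (primrec_ext _ (@primrec_iter k (fun _ _ _ => 0%N)
  (fun a b xs => nth 0%N xs 1 + H a b (nth 0%N xs 0 :: behead (behead xs)))%N
  B (primrec_const _ _) _ pB)).
  move=> a b xs xsk /=; elim: (B a b xs) => [|n IH] /=; first by rewrite big_ord0.
  by rewrite big_ord_recr /= -IH.
by apply: primrec_add; [exact: primrec_proj|exact: primrec_drop1].
Qed.

(** The quotient counts the [i < m] such that [(i + 1) (d + 1) <= m], and truncated subtraction
    turns this test into 0 or 1. Division is thus a bounded sum, hence primitive recursive. *)
Lemma divnS_sum m d : (m %/ d.+1 = \sum_(i < m) (1 - (i.+1 * d.+1 - m)))%N.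
Proof.
have -> : (\sum_(i < m) (1 - (i.+1 * d.+1 - m)) = \sum_(i < m) (i < m %/ d.+1))%N.
  apply: eq_bigr => i _; rewrite -[X in (X < _ : nat)%N]/(i : nat).
  rewrite leq_divRL// -subn_eq0.
  by case: (_ - m)%N.
rewrite -(big_mkord xpredT (fun i => (i < m %/ d.+1 : nat)%N)).
have count_lt k : (k <= m)%N -> (\sum_(0 <= i < m) (i < k : nat) = k)%N.
  elim: m => [|n IH] kn; first by move: kn; rewrite leqn0 => /eqP ->; rewrite big_nil.
  rewrite big_nat_recr//=; move: kn; rewrite leq_eqVlt => /orP[/eqP ->|kn].
    rewrite ltnSn (eq_big_nat _ _ (F2 := fun=> 1%N)).
      by rewrite sum_nat_const_nat subn0 muln1 addn1.
    by move=> i /andP[_ ilt]; rewrite ltnS (ltnW ilt).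
  by rewrite IH// [(n < k)%N]ltnNge -ltnS kn addn0.
by rewrite count_lt// leq_div.
Qed.

Lemma primrec_div k (F G : functional) : primrec k F -> primrec k G ->
  primrec k (fun a b xs => F a b xs %/ (G a b xs).+1)%N.
Proof.
apply: (@primrec_comp2 k (fun _ _ xs => nth 0%N xs 0 %/ (nth 0%N xs 1).+1)%N).
have := @primrec_sum 2 (fun _ _ xs =>
  (1 - ((nth 0 xs 0).+1 * (nth 0 xs 2).+1 - nth 0 xs 1))%N)
  (fun _ _ xs => nth 0%N xs 0).
move=> /(_ _ (primrec_proj _ _)) pr; apply: (primrec_ext _ (pr _)).
  by move=> a b xs xsk; rewrite divnS_sum.
by do ?[exact: primrec_proj|exact: primrec_const|apply: primrec_sub
       |apply: primrec_mul|apply: primrec_succ].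
Qed.

(* [nearest n p e / n.+1] is the multiple of [1 / n.+1] closest to
   [p / e.+1]. *)
Definition nearest (n p e : nat) : nat :=
  ((n.+1 * p + n.+1 * p + e.+1) %/ (e + e).+2)%N.

(** Rounding to the grid of step [1 / (n + 1)] costs at most half a step, which leaves the other
    half for the error of [p / (e + 1)]. *)
Lemma nearestP (R : realType) (x : R) n p e :
  `|x - p%:R / e.+1%:R| <= (n.+1%:R * 2)^-1 ->
  `|x - (nearest n p e)%:R / n.+1%:R| <= n.+1%:R^-1.
Proof.
move=> xpe; set q := nearest n p e.
have e0 : (0 : R) < e.+1%:R by rewrite ltr0n.
have n0 : (0 : R) < n.+1%:R by rewrite ltr0n.
have [r [r_ge r_lt qE]] : exists r : R, [/\ 0 <= r, r < 2 * e.+1%:R &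
    2 * n.+1%:R * p%:R + e.+1%:R = q%:R * (2 * e.+1%:R) + r].
  exists ((n.+1 * p + n.+1 * p + e.+1) %% (e + e).+2)%:R; split => //.
    have -> : 2 * e.+1%:R = (e + e).+2%:R :> R.
      by rewrite -[(e + e).+2]/((e.+1 + e).+1) -addnS natrD; ring.
    by rewrite ltr_nat ltn_mod.
  have -> : 2 * n.+1%:R * p%:R + e.+1%:R = (n.+1 * p + n.+1 * p + e.+1)%:R :> R.
    by rewrite !natrD !natrM; ring.
  rewrite {1}(divn_eq (n.+1 * p + n.+1 * p + e.+1) (e + e).+2) natrD natrM.
  have -> // : 2 * e.+1%:R = (e + e).+2%:R :> R.
  by rewrite -[(e + e).+2]/((e.+1 + e).+1) -addnS natrD; ring.
move: e0 n0 r_lt qE xpe; move: (e.+1%:R : R) (n.+1%:R : R) (p%:R : R) (q%:R : R).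
move=> E N P Q E0 N0 r_lt qE xpe.
have : `|P / E - Q / N| <= (N * 2)^-1.
  have -> : P / E - Q / N = (r - E) / (2 * E) / N.
    have -> : r = 2 * N * P + E - Q * (2 * E) by rewrite qE; ring.
    by field; rewrite !gt_eqF.
  rewrite normrM [`|N^-1|]gtr0_norm ?invr_gt0// [X in _ <= X]invfM.
  rewrite [X in X <= _]mulrC ler_pM2l ?invr_gt0//.
  rewrite normrM [`|(2 * E)^-1|]gtr0_norm ?invr_gt0 ?mulr_gt0//.
  by rewrite ler_pdivrMr ?mulr_gt0// mulKf// ler_norml; apply/andP; split; lra.
have -> : x - Q / N = (x - P / E) + (P / E - Q / N) by ring.
move=> h; apply: (le_trans (ler_normD _ _)); apply: (le_trans (lerD xpe h)).
by rewrite invfM; lra.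
Qed.

Lemma primrec_nearest k (F G H : functional) :
  primrec k F -> primrec k G -> primrec k H ->
  primrec k (fun a b xs => nearest (F a b xs) (G a b xs) (H a b xs)).
Proof.
move=> pF pG pH; rewrite /nearest.
do ![exact: pF|exact: pG|exact: pH|apply: primrec_div|apply: primrec_add
    |apply: primrec_mul|apply: primrec_succ].
Qed.

Lemma primrec_behead k (F : functional) : primrec k F ->
  primrec k.+1 (fun a b xs => F a b (behead xs)).
Proof.
move=> pF; have := primrec_comp (size_projections 1 k) pF
  (all_primrec_projections _ _ _).
move=> /(_ k.+1); apply: primrec_ext => a b [//|x xs] [xsk].
by have /= -> := @map_projections a b [:: x] xs 1 k erefl xsk.
Qed.

Lemma primrec_subst0 k (F G : functional) : primrec k.+1 F -> primrec k.+1 G ->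
  primrec k.+1 (fun a b xs => F a b (G a b xs :: behead xs)).
Proof.
move=> pF pG; have := @primrec_comp k.+1 k.+1 F (G :: projections 1 k) _ pF.
rewrite /= size_projections => /(_ erefl).
move=> /(_ (conj pG (all_primrec_projections _ _ _))).
apply: primrec_ext => a b [//|x xs] [xsk].
by have /= -> := @map_projections a b [:: x] xs 1 k erefl xsk.
Qed.

(** * Real functions of two reals with primitive recursive approximations *)

Section Approximable.
Variable R : realType.
Implicit Types (f g : seq nat -> R -> R -> R) (a b : nat -> nat).

(** The natural numbers [xs] are parameters, such as the index of a term or the length of a maximum;
    one functional serves all of them, and the precision is passed as its first argument. *)
Definition approximable k f : Prop :=
  exists F : functional, primrec k.+1 F /\
    forall x y a b, names a x -> names b y ->
    forall xs, size xs = k -> names (fun n => F a b (n :: xs)) (f xs x y).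

Lemma approximable_fst k : approximable k (fun _ x _ => x).
Proof.
by exists (fun a _ xs => a (nth 0%N xs 0)); split => //;
  by apply: primrec_oracle1; exact: primrec_proj.
Qed.

Lemma approximable_snd k : approximable k (fun _ _ y => y).
Proof.
by exists (fun _ b xs => b (nth 0%N xs 0)); split => //;
  by apply: primrec_oracle2; exact: primrec_proj.
Qed.

Lemma approximable_nat k (p : seq nat -> nat) :
  primrec k (fun _ _ xs => p xs) -> approximable k (fun xs _ _ => (p xs)%:R).
Proof.
move=> pp; exists (fun _ _ xs => p (behead xs) * (nth 0%N xs 0).+1)%N; split.
  by apply: primrec_mul; [exact: (primrec_behead pp)|apply: primrec_succ; exact: primrec_proj].
move=> x y a b _ _ xs xsk n /=.
by rewrite natrM mulfK ?pnatr_eq0// subrr normr0 invr_ge0.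
Qed.

Lemma approximable_inv k (p : seq nat -> nat) :
  primrec k (fun _ _ xs => p xs) ->
  approximable k (fun xs _ _ => ((p xs).+1)%:R^-1).
Proof.
move=> pp; exists (fun _ _ xs => nearest (nth 0%N xs 0) 1 (p (behead xs))); split.
  by apply: primrec_nearest; [exact: primrec_proj|exact: primrec_const
                             |exact: (primrec_behead pp)].
move=> x y a b _ _ xs xsk n /=; apply: nearestP.
by rewrite mul1r subrr normr0 invr_ge0.
Qed.

(* Precision [4 n.+1] for each argument absorbs the sum of their errors and the
   rounding of [nearest]. *)
Lemma approximable_lipschitz k (op : R -> R -> R) (opn : nat -> nat -> nat) f g :
  (forall p q e, op (p%:R / e.+1%:R) (q%:R / e.+1%:R) = (opn p q)%:R / e.+1%:R) ->
  (forall x y x' y', `|op x y - op x' y'| <= `|x - x'| + `|y - y'|) ->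
  primrec 2 (fun _ _ xs => opn (nth 0%N xs 0) (nth 0%N xs 1)) ->
  approximable k f -> approximable k g ->
  approximable k (fun xs x y => op (f xs x y) (g xs x y)).
Proof.
move=> opE op_lip popn [F [pF FP]] [G [pG GP]].
pose e : functional := fun _ _ xs => (4 * nth 0 xs 0 + 3)%N.
have pe : primrec k.+1 e.
  apply: primrec_add; last exact: primrec_const.
  by apply: primrec_mul; [exact: primrec_const|exact: primrec_proj].
exists (fun a b xs => nearest (nth 0%N xs 0)
  (opn (F a b (e a b xs :: behead xs)) (G a b (e a b xs :: behead xs))) (e a b xs)).
split.
  apply: primrec_nearest => //; first exact: primrec_proj.
  by apply: (primrec_comp2 popn); [exact: (primrec_subst0 pF pe)|exact: (primrec_subst0 pG pe)].
move=> x y a b ax yb xs xsk n /=; apply: nearestP; rewrite -opE.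
apply: (le_trans (op_lip _ _ _ _)).
have /= h1 := FP _ _ _ _ ax yb _ xsk (4 * n + 3)%N.
have /= h2 := GP _ _ _ _ ax yb _ xsk (4 * n + 3)%N.
apply: (le_trans (lerD h1 h2)).
have -> : (4 * n + 3).+1%:R = 4 * n.+1%:R :> R by rewrite -natrM; congr (_%:R); lia.
by rewrite !invfM; have : 0 <= (n.+1%:R : R)^-1 by []; move: (n.+1%:R^-1) => N N0; lra.
Qed.

Lemma approximable_add k f g : approximable k f -> approximable k g ->
  approximable k (fun xs x y => f xs x y + g xs x y).
Proof.
apply: (@approximable_lipschitz k _ addn) => [p q e|x y x' y'|].
- by rewrite natrD mulrDl.
- have -> : x + y - (x' + y') = (x - x') + (y - y') by ring.
  exact: ler_normD.
- by apply: primrec_add; exact: primrec_proj.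
Qed.

Lemma minr_dist (x y x' y' e : R) : `|x - x'| <= e -> `|y - y'| <= e ->
  `|Num.min x y - Num.min x' y'| <= e.
Proof.
rewrite !ler_norml => /andP[? ?] /andP[? ?].
by have [|] := leP x y; have [|] := leP x' y'; intros; apply/andP; split; lra.
Qed.

Lemma maxr_dist (x y x' y' e : R) : `|x - x'| <= e -> `|y - y'| <= e ->
  `|Num.max x y - Num.max x' y'| <= e.
Proof.
rewrite !ler_norml => /andP[? ?] /andP[? ?].
by have [|] := leP x y; have [|] := leP x' y'; intros; apply/andP; split; lra.
Qed.

(** Truncated, since names are sequences of natural numbers and only represent nonnegative reals. *)
Definition monus (x y : R) : R := Num.max 0 (x - y).

Lemma approximable_monus k f g : approximable k f -> approximable k g ->
  approximable k (fun xs x y => monus (f xs x y) (g xs x y)).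
Proof.
apply: (@approximable_lipschitz k _ subn) => [p q e|x y x' y'|].
- rewrite /monus; have [qp|pq] := leqP q p.
    rewrite natrB// mulrBl max_r// -mulrBl.
    by rewrite mulr_ge0 ?invr_ge0// subr_ge0 ler_nat.
  rewrite (eqP (ltnW pq : (p - q == 0)%N)) mul0r max_l// -mulrBl.
  by rewrite mulr_le0_ge0 ?invr_ge0// subr_le0 ler_nat ltnW.
- apply: maxr_dist; first by rewrite subrr normr0 addr_ge0.
  have -> : x - y - (x' - y') = (x - x') - (y - y') by ring.
  exact: ler_normB.
- by apply: primrec_sub; exact: primrec_proj.
Qed.

Lemma minr_frac p q e : Num.min (p%:R / e.+1%:R) (q%:R / e.+1%:R)
  = (minn p q)%:R / e.+1%:R :> R.
Proof.
rewrite /minn -(ltr_nat R) /Num.min ltr_pM2r ?invr_gt0//.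
by case: ifP.
Qed.

Lemma maxr_frac p q e : Num.max (p%:R / e.+1%:R) (q%:R / e.+1%:R)
  = (maxn p q)%:R / e.+1%:R :> R.
Proof.
rewrite /maxn -(ltr_nat R) /Num.max ltr_pM2r ?invr_gt0//.
by case: ifP.
Qed.

(** An operation that is nonexpansive for the maximum of the two errors, and acts on fractions of
    equal denominator through their numerators, can be iterated any number of times at constant
    precision, without any rounding. Minima and maxima of variable length rely on this. *)
Lemma approximable_nonexpansive k (op : R -> R -> R) (opn : nat -> nat -> nat)
    (f : nat -> seq nat -> R -> R -> R) z (B : seq nat -> nat) :
  (forall p q e, op (p%:R / e.+1%:R) (q%:R / e.+1%:R) = (opn p q)%:R / e.+1%:R) ->
  (forall x y x' y' e, `|x - x'| <= e -> `|y - y'| <= e ->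
     `|op x y - op x' y'| <= e) ->
  primrec 2 (fun _ _ xs => opn (nth 0%N xs 0) (nth 0%N xs 1)) ->
  approximable k z ->
  approximable k.+1 (fun xs => f (nth 0%N xs 0) (behead xs)) ->
  primrec k (fun _ _ xs => B xs) ->
  approximable k (fun xs x y =>
    nat_rect (fun=> R) (z xs x y) (fun i r => op r (f i xs x y)) (B xs)).
Proof.
move=> opE op_ne popn [Z [pZ ZP]] [F [pF FP]] pB.
exists (fun a b xs => nat_rect (fun=> nat) (Z a b xs)
  (fun i r => opn r (F a b (nth 0%N xs 0 :: i :: behead xs))) (B (behead xs))).
split.
  apply: (@primrec_iter k.+1 Z (fun a b xs => opn (nth 0%N xs 1)
    (F a b (nth 0%N xs 2 :: nth 0%N xs 0 :: behead (behead (behead xs)))))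
    _ pZ _ (primrec_behead pB)).
  apply: (primrec_comp2 popn); first exact: primrec_proj.
  have := @primrec_comp k.+2 k.+3 F ((fun _ _ xs => nth 0%N xs 2)
    :: (fun _ _ xs => nth 0%N xs 0) :: projections 3 k) _ pF.
  rewrite /= size_projections => /(_ erefl).
  move=> /(_ (conj (primrec_proj _ _) (conj (primrec_proj _ _)
    (all_primrec_projections _ _ _)))).
  apply: primrec_ext => a b [//|x [//|y [//|w xs]]] [xsk].
  by have /= -> := @map_projections a b [:: x; y; w] xs 3 k erefl xsk.
move=> x y a b ax yb xs xsk n /=; elim: (B xs) => [|i IH] /=.
  exact: ZP.
rewrite -opE; apply: op_ne => //.
by have := FP _ _ _ _ ax yb (i :: xs); rewrite /= xsk => /(_ erefl n).
Qed.

Definition maxover (n : nat) (z : R) (f : nat -> R) : R :=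
  nat_rect (fun=> R) z (fun i r => Num.max r (f i)) n.

Definition minover (n : nat) (z : R) (f : nat -> R) : R :=
  nat_rect (fun=> R) z (fun i r => Num.min r (f i)) n.

Lemma approximable_maxover k (f : nat -> seq nat -> R -> R -> R) z B :
  approximable k z ->
  approximable k.+1 (fun xs => f (nth 0%N xs 0) (behead xs)) ->
  primrec k (fun _ _ xs => B xs) ->
  approximable k (fun xs x y => maxover (B xs) (z xs x y) (fun i => f i xs x y)).
Proof.
apply: (approximable_nonexpansive maxr_frac maxr_dist).
by apply: primrec_max; exact: primrec_proj.
Qed.

Lemma approximable_minover k (f : nat -> seq nat -> R -> R -> R) z B :
  approximable k z ->
  approximable k.+1 (fun xs => f (nth 0%N xs 0) (behead xs)) ->
  primrec k (fun _ _ xs => B xs) ->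
  approximable k (fun xs x y => minover (B xs) (z xs x y) (fun i => f i xs x y)).
Proof.
apply: (approximable_nonexpansive minr_frac minr_dist).
by apply: primrec_min; exact: primrec_proj.
Qed.

Lemma approximable_min k f g : approximable k f -> approximable k g ->
  approximable k (fun xs x y => Num.min (f xs x y) (g xs x y)).
Proof.
apply: (approximable_lipschitz minr_frac) => [x y x' y'|].
  by apply: minr_dist; rewrite ?lerDl ?lerDr.
by apply: primrec_min; exact: primrec_proj.
Qed.

Lemma names_bound a (x : R) : names a x -> `|x| <= (a 0%N)%:R + 1.
Proof.
move=> /(_ 0%N); rewrite divr1 invr1 => ax.
have -> : x = (x - (a 0%N)%:R) + (a 0%N)%:R by ring.
by rewrite (le_trans (ler_normD _ _))// normr_nat addrC lerD2l.
Qed.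

Lemma approximable_mul k f g : approximable k f -> approximable k g ->
  approximable k (fun xs x y => f xs x y * g xs x y).
Proof.
move=> [F [pF FP]] [G [pG GP]].
(* Approximations to within 1 give [|u| + |v| + 1 <= c] for the two factors [u] and [v]. The product
   of approximations of precision [1 / (e + 1)] is off by at most [(|u| + |v| + 1) / (e + 1)], and
   [e + 1 = 2 (n + 1) c]. *)
pose c : functional := fun a b xs =>
  (F a b (0 :: behead xs) + G a b (0 :: behead xs) + 3)%N.
pose e : functional := fun a b xs => (2 * (nth 0%N xs 0).+1 * c a b xs).-1%N.
have pc : primrec k.+1 c.
  apply: primrec_add; last exact: primrec_const.
  by apply: primrec_add; [exact: (primrec_subst0 pF (primrec_const _ _))
                         |exact: (primrec_subst0 pG (primrec_const _ _))].
have pe : primrec k.+1 e.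
  apply: primrec_pred; apply: primrec_mul => //.
  by apply: primrec_mul; [exact: primrec_const|apply: primrec_succ; exact: primrec_proj].
(* The last argument of [nearest] is the predecessor of a denominator, here [(e + 1)^2 - 1]. *)
exists (fun a b xs => nearest (nth 0%N xs 0)
  (F a b (e a b xs :: behead xs) * G a b (e a b xs :: behead xs))
  (e a b xs * e a b xs + (e a b xs + e a b xs))).
split.
  apply: primrec_nearest; first exact: primrec_proj.
    by apply: primrec_mul; [exact: (primrec_subst0 pF pe)|exact: (primrec_subst0 pG pe)].
  by do ![exact: pe|apply: primrec_add|apply: primrec_mul].
move=> x y a b ax yb xs xsk n /=; apply: nearestP.
have fF := FP _ _ _ _ ax yb _ xsk; have gG := GP _ _ _ _ ax yb _ xsk.
have f0 := names_bound fF; have g0 := names_bound gG; move: f0 g0 => /=.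
set m := e a b (n :: xs).
have mE : m.+1 = (2 * n.+1 * c a b (n :: xs))%N.
  by rewrite /m /e /= prednK// !muln_gt0 /c /= addn3.
move: (fF m) (gG m) => {fF gG} /=.
set p := F a b (m :: xs); set q := G a b (m :: xs).
set u := f xs x y; set v := g xs x y => up vq u0 v0.
have -> : (m * m + (m + m)).+1 = (m.+1 * m.+1)%N by lia.
rewrite !natrM.
have m0 : (0 : R) < m.+1%:R by rewrite ltr0n.
have -> : u * v - p%:R * q%:R / (m.+1%:R * m.+1%:R)
    = u * (v - q%:R / m.+1%:R) + (u - p%:R / m.+1%:R) * (q%:R / m.+1%:R).
  by field; exact: lt0r_neq0.
have q1 : `|q%:R / m.+1%:R| <= `|v| + 1.
  rewrite -[_ / _](subKr v) (le_trans (ler_normB _ _))// lerD2l.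
  by rewrite (le_trans vq)// invf_le1 ?ler1n.
apply: (le_trans (ler_normD _ _)).
rewrite (normrM u) (normrM (u - _)).
have h : `|u| * `|v - q%:R / m.+1%:R| + `|u - p%:R / m.+1%:R| * `|q%:R / m.+1%:R|
    <= (`|u| + `|v| + 1) / m.+1%:R.
  rewrite -addrA mulrDl lerD ?ler_wpM2l// mulrC ler_pM//.
apply: (le_trans h); rewrite mE !natrM /c /= !natrD.
have C0 : 0 < (F a b (0%N :: xs))%:R + (G a b (0%N :: xs))%:R + 3%:R :> R.
  by rewrite ltr_wpDl// addr_ge0.
have uvC : `|u| + `|v| + 1 <=
  (F a b (0%N :: xs))%:R + (G a b (0%N :: xs))%:R + 3%:R :> R by lra.
move: (_ + 3%:R : R) C0 uvC => C C0 uvC.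
have N0 : (0 : R) < n.+1%:R by rewrite ltr0n.
move: (n.+1%:R : R) N0 => N N0.
have -> : (N * 2)^-1 = C / (2%:R * N * C) by field; rewrite !gt_eqF.
by rewrite ler_wpM2r// invr_ge0 !mulr_ge0// ltW.
Qed.

End Approximable.

(** * Approximation of pi by Riemann sums *)

Section ApproximablePi.
Variable R : realType.

Lemma atan_increment (x y : R) : 0 <= x -> x < y ->
  (y - x) / (1 + y ^+ 2) <= atan y - atan x <= (y - x) / (1 + x ^+ 2).
Proof.
move=> x0 xy.
have [c|c cxy ->] := @MVT R atan (fun c => (1 + c ^+ 2)^-1) x y xy.
  by apply: continuous_subspaceT => z; exact: continuous_atan.
have /andP[xc cy] : x < c < y by move: cxy; rewrite in_itv.
have p0 (z : R) : 0 < 1 + z ^+ 2 by rewrite ltr_pwDl// sqr_ge0.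
rewrite ![_ * (y - x)]mulrC !ler_pM2l ?subr_gt0// !lef_pV2 ?posrE// !lerD2l.
by rewrite !lerXn2r ?nnegrE; lra.
Qed.

(* The integral of [4 / (1 + x^2)] over [[0, 1]] as a left Riemann sum with
   [m.+1] terms, scaled by [m.+1 ^ 2]. *)
Definition pi_sum (m : nat) : nat :=
  (\sum_(i < m.+1) (4 * m.+1 ^ 3) %/ (m * m + (m + m) + i * i).+1)%N.

(** Write [M = m + 1]. The integrand decreases, so the left sum exceeds the integral by at most the
    telescoping difference [4 / M - 2 / M] of its extreme terms. On the other side, rounding each of
    the [M] quotients down loses at most [1 / M^2], that is [1 / M] in all. Both bounds are proved
    for partial sums, against [4 atan (j / M)]. *)
Lemma pi_sum_dist m :
  `|pi - (pi_sum m)%:R / (m * m + (m + m)).+1%:R| <= 2 / m.+1%:R :> R.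
Proof.
have [M ME] : exists M : R, M = m.+1%:R by exists m.+1%:R.
have M0 : 0 < M by rewrite ME ltr0n.
rewrite -ME.
have -> : (m * m + (m + m)).+1%:R = M ^+ 2 :> R.
  by rewrite ME -natrX; congr (_%:R); lia.
pose s j : R := 4 * M / (M ^+ 2 + j%:R ^+ 2).
have inv j : (j <= m.+1)%N ->
    4 * atan (j%:R / M) - j%:R / M ^+ 2 <=
      (\sum_(i < j) (4 * m.+1 ^ 3) %/ (m * m + (m + m) + i * i).+1)%N%:R / M ^+ 2
    <= 4 * atan (j%:R / M) + s 0%N - s j.
  elim: j => [_|j IH jm]; first by rewrite big_ord0 !mul0r atan0; lra.
  have /andP[lo hi] := IH (ltnW jm); rewrite big_ord_recr/= [X in _ <= X / _ <= _]natrD [X in _ <= X <= _]mulrDl.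
  set T := (\sum_(i < j) _)%N%:R / _ in lo hi *.
  have j0 : 0 <= (j%:R : R) by [].
  have D0 : 0 < M ^+ 2 + j%:R ^+ 2 by rewrite ltr_pwDl ?exprn_gt0// sqr_ge0.
  have /andP[inc1 inc2] : s j.+1 <= 4 * atan (j.+1%:R / M) - 4 * atan (j%:R / M) <= s j.
    have /andP[h1 h2] := @atan_increment (j%:R / M) (j.+1%:R / M)
      (divr_ge0 j0 (ltW M0)) ltac:(by rewrite ltr_pM2r ?invr_gt0// ltr_nat).
    have sE k : s k = 4 * ((j.+1%:R / M - j%:R / M) / (1 + (k%:R / M) ^+ 2)).
      rewrite /s -[j.+1%:R]natr1; move: (k%:R : R) (j%:R : R) => K J.
      have P : 0 < M ^+ 2 + K ^+ 2 by rewrite ltr_pwDl ?exprn_gt0// sqr_ge0.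
      by field; rewrite !gt_eqF.
    by rewrite !sE -mulrBr !ler_pM2l ?h1 ?h2.
  have [q1 q2] : let q := ((4 * m.+1 ^ 3) %/ (m * m + (m + m) + j * j).+1)%:R in
      (q / M ^+ 2 <= s j) /\ (s j - 1 / M ^+ 2 <= q / M ^+ 2).
    set d := (_ + j * j).+1; move=> q.
    have dE : d%:R = M ^+ 2 + j%:R ^+ 2 :> R.
      by rewrite ME -!natrX -natrD; congr (_%:R); rewrite /d; lia.
    have E : 4 * M ^+ 3 = q * d%:R + ((4 * m.+1 ^ 3) %% d)%:R.
      by rewrite ME -natrX -!natrM -natrD -divn_eq.
    have r0 : 0 <= ((4 * m.+1 ^ 3) %% d)%:R :> R by [].
    have r1 : ((4 * m.+1 ^ 3) %% d)%:R < d%:R :> R by rewrite ltr_nat ltn_mod.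
    move: E r0 r1; move: (((4 * m.+1 ^ 3) %% d)%:R : R) => r; rewrite dE => E r0 r1.
    have -> : s j = 4 * M ^+ 3 / (M ^+ 2 + j%:R ^+ 2) / M ^+ 2.
      by rewrite /s; move: (j%:R : R) D0 => J D0; field; rewrite !gt_eqF.
    split.
      rewrite ler_pM2r ?invr_gt0 ?exprn_gt0// ler_pdivlMr// E; lra.
    rewrite -mulrBl ler_pM2r ?invr_gt0 ?exprn_gt0// lerBlDr ler_pdivrMr// E; lra.
  move: q1 q2 => /=; move: ((_ %/ _)%:R / M ^+ 2) => Q q1 q2.
  have -> : j.+1%:R / M ^+ 2 = j%:R / M ^+ 2 + 1 / M ^+ 2 by rewrite -[j.+1%:R]natr1 mulrDl.
  by apply/andP; split; lra.
have /andP[] := inv m.+1 (leqnn _); rewrite -ME divff ?gt_eqF// atan1.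
rewrite -[X in X%:R / M ^+ 2 <= _]/(pi_sum m) -[X in _ <= X%:R / M ^+ 2]/(pi_sum m).
move: ((pi_sum m)%:R / M ^+ 2) => Q lo hi.
have s0E : s 0%N = 4 / M by rewrite /s mulr0n expr0n/= addr0; field; rewrite gt_eqF.
have smE : s m.+1 = 2 / M.
  have P : 0 < M ^+ 2 + M ^+ 2 by rewrite addr_gt0 ?exprn_gt0.
  by rewrite /s -ME; field; rewrite !gt_eqF.
have MME : M / M ^+ 2 = 1 / M by field; rewrite gt_eqF.
have piE : 4 * (pi / 4%:R) = pi :> R by field.
rewrite s0E smE piE in hi; rewrite piE MME in lo.
have : 0 < M^-1 by rewrite invr_gt0.
move: (M^-1) lo hi => V lo hi V0.
by rewrite ler_norml; apply/andP; split; lra.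
Qed.

Lemma approximable_pi k : approximable k (fun _ _ _ => pi : R).
Proof.
pose m : functional := fun _ _ xs => (4 * nth 0 xs 0 + 3)%N.
have pm : primrec k.+1 m.
  apply: primrec_add; last exact: primrec_const.
  by apply: primrec_mul; [exact: primrec_const|exact: primrec_proj].
exists (fun a b xs => nearest (nth 0%N xs 0) (pi_sum (m a b xs))
  (m a b xs * m a b xs + (m a b xs + m a b xs)))%N; split.
  apply: primrec_nearest; first exact: primrec_proj; last first.
    by do ![exact: pm|apply: primrec_add|apply: primrec_mul].
  have psum : primrec 1 (fun _ _ xs => pi_sum (nth 0%N xs 0)).
    apply: (primrec_ext _ (@primrec_sum 1 (fun _ _ xs => (4 * (nth 0 xs 1).+1 ^ 3) %/
       (nth 0 xs 1 * nth 0 xs 1 + (nth 0 xs 1 + nth 0 xs 1)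
          + nth 0 xs 0 * nth 0 xs 0).+1)%N (fun _ _ xs => (nth 0%N xs 0).+1) _ _)).
    - by [].
    - by do ![exact: primrec_proj|exact: primrec_const|apply: primrec_div
        |apply: primrec_add|apply: primrec_mul|apply: primrec_exp
        |apply: primrec_succ].
    - by apply: primrec_succ; exact: primrec_proj.
  exact: (primrec_comp1 psum pm).
move=> x y a b _ _ xs xsk n /=; apply: nearestP.
apply: (le_trans (pi_sum_dist _)); rewrite /m /=.
have -> : (4 * n + 3).+1%:R = 4 * n.+1%:R :> R by rewrite -natrM; congr (_%:R); lia.
by rewrite !invfM; have : 0 <= (n.+1%:R : R)^-1 by []; move: (n.+1%:R^-1) => N N0; lra.
Qed.

End ApproximablePi.

(** * The function gamma: positivity and computability *)

Section Gamma.
Variable R : realType.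
Variable G : nat -> nat.
Hypothesis G_ge : forall N, (N <= G N)%N.
Hypothesis G_prim : primrec 1 (fun _ _ xs => G (nth 0%N xs 0)).

Lemma minover_gt (d z : R) n f :
  (d < minover n z f) <-> (d < z /\ forall i, (i < n)%N -> d < f i).
Proof.
rewrite /minover; elim: n => [|n IH] /=; first by split => // -[].
rewrite lt_min; split => [/andP[/IH[dz df] dn]|[dz df]].
  split => // i; rewrite ltnS leq_eqVlt => /orP[/eqP -> //|]; exact: df.
by apply/andP; split; [apply/IH; split => // i iN; apply: df; exact: ltnW|exact: df].
Qed.

Lemma maxover_ge (z : R) n f i : (i < n)%N -> f i <= maxover n z f.
Proof.
rewrite /maxover; elim: n => // n IH /=; rewrite ltnS leq_eqVlt le_max.
by move=> /orP[/eqP -> |/IH ->//]; rewrite lexx orbT.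
Qed.

Lemma maxover_le (z : R) n f d : z <= d -> (forall i, (i < n)%N -> f i <= d) ->
  maxover n z f <= d.
Proof.
rewrite /maxover; elim: n => // n IH /= zd fd; rewrite ge_max IH ?fd//.
by move=> i iN; apply: fd; exact: ltnW.
Qed.

Definition quadratic_form (k l : nat) : nat := (k ^ 2 + k * l + l ^ 2)%N.

(** An absolute value, written as a sum of two truncated differences in order to be approximable. *)
Definition gap (L : R) (k l : nat) : R :=
  monus (3 * (L * L)) (4 * (pi * pi) * (quadratic_form k l)%:R)
  + monus (4 * (pi * pi) * (quadratic_form k l)%:R) (3 * (L * L)).

Lemma gapE L k l :
  gap L k l = `|3 * L ^+ 2 - 4 * pi ^+ 2 * (quadratic_form k l)%:R|.
Proof.
rewrite /gap /monus -!expr2; move: (3 * _) (4 * _ * _) => u v.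
have [uv|vu] := leP u v.
  by rewrite max_l ?subr_le0// max_r ?subr_ge0// add0r ler0_norm ?subr_le0// opprB.
by rewrite max_r ?subr_ge0 ?ltW// max_l ?subr_le0 ?ltW// addr0 gtr0_norm ?subr_gt0.
Qed.

(** The slack in the conditions on the integer [N + 1]; the shift keeps this integer positive, and
    the constants 1 only start the minima. *)
Definition margin (N : nat) (L K : R) : R :=
  Num.min (Num.min (monus N.+1%:R K) (monus N.+1%:R L))
    (Num.min (monus L N.+1%:R^-1)
      (minover N.+1 1 (fun k => minover N.+1 1 (fun l =>
         monus (gap L k.+1 l.+1) N.+1%:R^-1)))).

Lemma monus_gt0 (x y : R) : (0 < monus x y) = (y < x).
Proof. by rewrite /monus lt_max ltxx/= subr_gt0. Qed.

Lemma margin_gt0 N L K : 0 < margin N L K <->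
  [/\ K < N.+1%:R, L < N.+1%:R, N.+1%:R^-1 < L &
   forall k l, (0 < k <= N.+1)%N -> (0 < l <= N.+1)%N -> N.+1%:R^-1 <
     `|3 * L ^+ 2 - 4 * pi ^+ 2 * (quadratic_form k l)%:R| ].
Proof.
rewrite /margin 3!lt_min !monus_gt0; split.
  move=> /andP[/andP[? ?]] /andP[? /minover_gt[_ h]]; split => // -[//|k] [//|l].
  move=> kN lN; have /minover_gt[_ {}h] := h k kN.
  by have := h l lN; rewrite monus_gt0 gapE.
move=> [-> -> -> h]; rewrite !andTb; apply/minover_gt; split => // k kN.
by apply/minover_gt; split => // l lN; rewrite monus_gt0 gapE; exact: h.
Qed.

Definition gamma_term (N : nat) (L K : R) : R :=
  Num.min (G N).+1%:R^-1 (margin N L K).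

Definition gamma (L K : R) : R := sup (range (fun N => gamma_term N L K)).

Lemma minover_ge0 n (z : R) f : 0 <= z -> (forall i, 0 <= f i) ->
  0 <= minover n z f.
Proof. by rewrite /minover => z0 f0; elim: n => //= n IH; rewrite le_min IH/=. Qed.

Lemma monus_ge0 (x y : R) : 0 <= monus x y.
Proof. by rewrite /monus le_max lexx. Qed.

Lemma gamma_term_ge0 N L K : 0 <= gamma_term N L K.
Proof.
rewrite /gamma_term /margin 4!le_min !monus_ge0 invr_ge0 ler0n !andTb.
by apply: minover_ge0 => // k; apply: minover_ge0 => // l; exact: monus_ge0.
Qed.

Lemma gamma_term_le N L K : gamma_term N L K <= N.+1%:R^-1.
Proof.
rewrite /gamma_term ge_min; apply/orP; left.
by rewrite lef_pV2 ?posrE ?ltr0n// ler_nat ltnS.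
Qed.

Lemma has_sup_gamma_term L K : has_sup (range (fun N => gamma_term N L K)).
Proof.
split; first by exists (gamma_term 0 L K); exists 0%N.
exists 1 => _ [N _ <-]; apply: (le_trans (gamma_term_le _ _ _)).
by rewrite invf_le1 ?ltr0n// ler1n.
Qed.

Lemma gamma_ge N L K : gamma_term N L K <= gamma L K.
Proof. by apply: ub_le_sup; [case: (has_sup_gamma_term L K)|exists N]. Qed.

Lemma gamma_gt (z L K : R) : z < gamma L K -> exists N, z < gamma_term N L K.
Proof.
move=> zg; have [_ [N _ <-] h] := sup_adherent (eps := gamma L K - z)
  ltac:(by rewrite subr_gt0) (has_sup_gamma_term L K).
by exists N; move: h; rewrite subKr.
Qed.

Lemma approximable_gamma_term :
  approximable 1 (fun xs => gamma_term (nth 0%N xs 0)).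
Proof.
have natc k c : approximable k (fun _ _ _ => (c%:R : R)).
  by apply: (@approximable_nat R k (fun=> c)); exact: primrec_const.
have succ k i : approximable k (fun xs _ _ => (nth 0%N xs i).+1%:R : R).
  by apply: (@approximable_nat R k (fun xs => (nth 0%N xs i).+1));
    apply: primrec_succ; exact: primrec_proj.
have inv k i : approximable k (fun xs _ _ => (nth 0%N xs i).+1%:R^-1 : R).
  by apply: (@approximable_inv R k (fun xs => nth 0%N xs i)); exact: primrec_proj.
apply: approximable_min.
  exact: (@approximable_inv R 1 (fun xs => G (nth 0%N xs 0))).
apply: approximable_min.
  by apply: approximable_min; apply: approximable_monus => //;
    [exact: approximable_snd|exact: approximable_fst].
apply: approximable_min.
  by apply: approximable_monus; [exact: approximable_fst|exact: inv].
have p0 k : primrec k (fun _ _ xs => nth 0%N xs 0) by exact: primrec_proj.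
apply: (@approximable_minover R 1 (fun k xs x y => minover (nth 0%N xs 0).+1 1
    (fun l => monus (gap x k.+1 l.+1) (nth 0%N xs 0).+1%:R^-1))
  (fun _ _ _ => 1) (fun xs => (nth 0%N xs 0).+1)).
- exact: natc 1%N 1%N.
- apply: (@approximable_minover R 2
    (fun l xs x y => monus (gap x (nth 0%N xs 0).+1 l.+1)
                       (nth 0%N (behead xs) 0).+1%:R^-1)
    (fun _ _ _ => 1) (fun xs => (nth 0%N (behead xs) 0).+1)).
  + exact: natc 2%N 1%N.
  + apply: approximable_monus; last first.
      apply: (@approximable_inv R 3 (fun xs => nth 0%N (behead (behead xs)) 0)).
      exact: (primrec_behead (primrec_behead (p0 1%N))).
    have q3 : approximable 3 (fun xs (x _ : R) => 3 * (x * x)).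
      apply: approximable_mul; first exact: natc 3%N 3%N.
      by apply: approximable_mul; exact: approximable_fst.
    have q4 : approximable 3 (fun xs (_ _ : R) => 4 * (pi * pi)
       * (quadratic_form (nth 0%N (behead xs) 0).+1 (nth 0%N xs 0).+1)%:R).
      apply: approximable_mul.
        apply: approximable_mul; first exact: natc 3%N 4%N.
        by apply: approximable_mul; exact: approximable_pi.
      apply: (@approximable_nat R 3 (fun xs =>
        quadratic_form (nth 0%N (behead xs) 0).+1 (nth 0%N xs 0).+1)).
      have pl : primrec 3 (fun _ _ xs => (nth 0%N xs 0).+1) by exact: primrec_succ.
      have pk : primrec 3 (fun _ _ xs => (nth 0%N (behead xs) 0).+1).
        by apply: primrec_succ; exact: (primrec_behead (p0 2%N)).
      by do ![exact: pl|exact: pk|exact: primrec_const|apply: primrec_add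
             |apply: primrec_mul|apply: primrec_exp].
    by apply: approximable_add; exact: approximable_monus.
  + by apply: primrec_succ; exact: (primrec_behead (p0 1%N)).
- exact: primrec_succ.
Qed.

Lemma gamma_computable D : computable_on D gamma.
Proof.
have [F [pF FP]] : approximable 1 (fun xs x y =>
    maxover (nth 0%N xs 0) 0 (fun N => gamma_term N x y)).
  apply: (@approximable_maxover R 1 (fun N _ => gamma_term N) (fun _ _ _ => 0)
    (fun xs => nth 0%N xs 0)).
  - by apply: (@approximable_nat R 1 (fun=> 0%N)); exact: primrec_const.
  - have [F [pF FP]] := approximable_gamma_term.
    exists (fun a b xs => F a b [:: nth 0%N xs 0; nth 0%N xs 1]); split.
      exact: (primrec_comp2 pF (primrec_proj _ _) (primrec_proj _ _)).
    move=> x y a b ax yb [//|N [//|N' [|//]]] _ /=.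
    exact: (FP x y a b ax yb [:: N] erefl).
  - exact: primrec_proj.
(* With [k = 4 n + 3], keeping the first [k + 1] terms of the supremum and approximating their
   maximum cost [1 / (k + 1)] each. Both errors add up to [1 / (2 (n + 1))], the budget of
   [nearestP]. *)
pose m : functional := fun _ _ xs => (4 * nth 0 xs 0 + 3)%N.
have pm : primrec 1 m.
  apply: primrec_add; last exact: primrec_const.
  by apply: primrec_mul; [exact: primrec_const|exact: primrec_proj].
have [p pE] : primrec 1 (fun a b xs => nearest (nth 0%N xs 0)
    (F a b [:: m a b xs; (m a b xs).+1]) (m a b xs)).
  apply: primrec_nearest; [exact: primrec_proj| |exact: pm].
  exact: (primrec_comp2 pF pm (primrec_succ pm)).
exists p => x y a b _ ax yb.
exists (fun n => nearest n (F a b [:: m a b [:: n]; (m a b [:: n]).+1]) (m a b [:: n])).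
split; first by move=> n; exact: (pE a b [:: n]).
move=> n; apply: nearestP; set k := m a b [:: n].
pose M := maxover k.+1 0 (fun N => gamma_term N x y).
have FM : `|M - (F a b [:: k; k.+1])%:R / k.+1%:R| <= k.+1%:R^-1.
  exact: FP x y a b ax yb [:: k.+1] erefl k.
have Mg : `|gamma x y - M| <= k.+1%:R^-1.
  have Mle : M <= gamma x y.
    apply: maxover_le => [|N _]; last exact: gamma_ge.
    exact: (le_trans (gamma_term_ge0 0 x y) (gamma_ge _ _ _)).
  rewrite ger0_norm ?subr_ge0// lerBlDr.
  apply: ge_sup; first by exists (gamma_term 0 x y); exists 0%N.
  move=> _ [N _ <-]; have M0 : 0 <= M.
    exact: (le_trans (gamma_term_ge0 0 x y) (maxover_ge 0 (fun N => gamma_term N x y) (ltn0Sn k))).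
  have [Nk|kN] := ltnP N k.+1.
    by rewrite (le_trans (maxover_ge 0 (fun N => gamma_term N x y) Nk))// lerDr invr_ge0.
  rewrite (le_trans (gamma_term_le N x y))// (le_trans _ (_ : k.+1%:R^-1 <= _))//.
    by rewrite lef_pV2 ?posrE ?ltr0n// ler_nat ltnW.
  by rewrite lerDl.
have -> : gamma x y - (F a b [:: k; k.+1])%:R / k.+1%:R
  = (gamma x y - M) + (M - (F a b [:: k; k.+1])%:R / k.+1%:R) by ring.
apply: (le_trans (ler_normD _ _)); apply: (le_trans (lerD Mg FM)).
rewrite /k /m /=.
have -> : (4 * n + 3).+1%:R = 4 * n.+1%:R :> R by rewrite -natrM; congr (_%:R); lia.
by rewrite !invfM; have : 0 <= (n.+1%:R : R)^-1 by []; move: (n.+1%:R^-1) => N N0; lra.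
Qed.

(** The number of gap conditions grows with [N], so a lower bound of the gap uniform in [k] and [l]
    is needed. With [L <= N0], the gap is at least 1 as soon as [k] or [l] exceeds [N0 + 1]. The
    minimum [d] over the remaining finite set, capped by 1, is therefore a bound for all pairs, and
    it is positive because [3 L^2 = 4 pi^2 (k^2 + k l + l^2)] would make [L] critical. *)
Lemma gamma_gt0 (L K : R) : 0 < L -> ~ critical_lengths R L -> 0 < gamma L K.
Proof.
move=> L0 ncrit.
suff [N mN] : exists N, 0 < margin N L K.
  apply: (lt_le_trans _ (gamma_ge N L K)).
  by rewrite /gamma_term lt_min mN andbT invr_gt0.
pose gapv k l : R := `|3 * L ^+ 2 - 4 * pi ^+ 2 * (quadratic_form k l)%:R|.
have gap0 k l : (0 < k)%N -> (0 < l)%N -> 0 < gapv k l.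
  move=> k0 l0; rewrite normr_gt0 subr_eq0; apply/eqP => E; apply: ncrit.
  exists k, l; split => //; rewrite -/(quadratic_form k l).
  have p0 := @pi_gt0 R.
  have r0 : 0 <= 2 * pi * Num.sqrt ((quadratic_form k l)%:R / 3) :> R.
    by rewrite mulr_ge0 ?sqrtr_ge0// mulr_ge0// ltW.
  apply/eqP; rewrite -(@eqrXn2 _ 2 _ _ isT (ltW L0) r0).
  rewrite !exprMn sqr_sqrtr ?divr_ge0//; apply/eqP.
  by apply: (@mulfI _ 3) => //; rewrite E; field.
have [N0 N0P] : exists N0 : nat, L <= N0%:R.
  by exists (Num.bound L); exact/ltW/archi_boundP/ltW.
pose d := minover N0.+1 1 (fun k => minover N0.+1 1 (fun l => gapv k.+1 l.+1)).
have d0 : 0 < d.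
  by apply/minover_gt; split => // k _; apply/minover_gt; split => // l _; exact: gap0.
have far k l : (N0.+1 < k)%N || (N0.+1 < l)%N -> 1 <= gapv k l.
  move=> kl; have q_ge : N0.+1%:R ^+ 2 <= (quadratic_form k l)%:R :> R.
    by rewrite -natrX ler_nat /quadratic_form; case/orP: kl => h; nia.
  have p2 : 2 ^+ 2 <= pi ^+ 2 :> R by rewrite lerXn2r ?nnegrE ?pi_ge0// pi_ge2.
  have L2 : L ^+ 2 <= N0%:R ^+ 2 by rewrite lerXn2r ?nnegrE// ltW.
  rewrite /gapv distrC (le_trans _ (ler_norm _))//.
  have N0_ge0 : 0 <= N0%:R :> R by [].
  have pq : 2 ^+ 2 * (N0%:R + 1) ^+ 2 <= pi ^+ 2 * (quadratic_form k l)%:R :> R.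
    by rewrite natr1 ler_pM// ?exprn_ge0.
  by move: N0_ge0 L2 pq; move: (N0%:R : R) => N N0_ge0 L2 pq; nra.
have dP k l : (0 < k)%N -> (0 < l)%N -> d <= gapv k l.
  move=> k0 l0; rewrite leNgt; apply/negP => /minover_gt[gap1 gapd].
  have := gap1; rewrite ltNge; apply/negP; rewrite negbK.
  apply: far; rewrite -[_ || _]negbK negb_or -!leqNgt; apply/negP => /andP[kN lN].
  move: k0 kN l0 lN gap1 gapd; case: k l => [//|k] [//|l] _ kN _ lN _ /(_ k kN).
  by move=> /minover_gt[_ /(_ l lN)]; rewrite ltxx.
(* [N1] exceeds [K] and [L], and the inverses of the positive numbers [L] and [d] that
   [1 / (N1 + 1)] has to stay below. *)
have [N1 N1P] : exists N1 : nat, `|K| + L + L^-1 + d^-1 < N1%:R.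
  exists (Num.bound (`|K| + L + L^-1 + d^-1)); apply: archi_boundP.
  by rewrite !addr_ge0 ?invr_ge0// ltW.
have L'0 : 0 < L^-1 by rewrite invr_gt0.
have d'0 : 0 < d^-1 by rewrite invr_gt0.
have N1S : N1%:R <= N1.+1%:R :> R by rewrite ler_nat.
have K0 : 0 <= `|K| by [].
have KK : K <= `|K| := ler_norm K.
exists N1; apply/margin_gt0; split.
- by apply: (lt_le_trans _ N1S); lra.
- by apply: (lt_le_trans _ N1S); lra.
- by rewrite -[X in _ < X]invrK ltf_pV2 ?posrE ?ltr0n//; lra.
- move=> k l /andP[k0 _] /andP[l0 _]; apply: (lt_le_trans _ (dP k l k0 l0)).
  by rewrite -[X in _ < X]invrK ltf_pV2 ?posrE ?ltr0n//; lra.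
Qed.

End Gamma.

Local Open Scope complex_scope.

(** * The complex exponential and its values close to 1 *)

Section ComplexExponential.
Variable R : realType.
Local Notation C := R[i].
Local Notation normc := (@ComplexField.Normc.normc R).
Local Notation Re := (@complex.Re R).
Local Notation Im := (@complex.Im R).
Implicit Types (x y : R) (z w : C).

Definition cexp z : C :=
  (expR (Re z) * cos (Im z)) +i* (expR (Re z) * sin (Im z)).

Lemma cexpD z w : cexp (z + w) = cexp z * cexp w.
Proof.
case: z w => [a b] [c d]; rewrite /cexp /= expRD cosD sinD.
by apply/eqP; rewrite eq_complex /=; apply/andP; split; apply/eqP; ring.
Qed.

Lemma cexp0 : cexp 0 = 1.
Proof. by rewrite /cexp /= expR0 cos0 sin0 mulr1 mulr0. Qed.

Lemma cexpN z : cexp (- z) * cexp z = 1.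
Proof. by rewrite -cexpD addNr cexp0. Qed.

Lemma normcE z : normc z = Num.sqrt (Re z ^+ 2 + Im z ^+ 2).
Proof. by case: z. Qed.

Lemma normc_ge0 z : 0 <= normc z.
Proof. by rewrite normcE sqrtr_ge0. Qed.

Lemma sqr_normcE z : normc z ^+ 2 = Re z ^+ 2 + Im z ^+ 2.
Proof. by rewrite normcE sqr_sqrtr ?addr_ge0 ?sqr_ge0. Qed.

Lemma normr_Re_le z : `|Re z| <= normc z.
Proof.
by rewrite -(@ler_pXn2r _ 2)// ?nnegrE ?normc_ge0// sqr_normcE real_normK
  ?num_real// lerDl sqr_ge0.
Qed.

Lemma normr_Im_le z : `|Im z| <= normc z.
Proof.
by rewrite -(@ler_pXn2r _ 2)// ?nnegrE ?normc_ge0// sqr_normcE real_normK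
  ?num_real// lerDr sqr_ge0.
Qed.

Lemma normc_le_ReIm z : normc z <= `|Re z| + `|Im z|.
Proof.
rewrite -(@ler_pXn2r _ 2) ?nnegrE ?normc_ge0 ?addr_ge0// sqr_normcE.
rewrite sqrrD !real_normK ?num_real//.
by rewrite -addrA lerD2l lerDr mulrn_wge0// mulr_ge0.
Qed.

Lemma normc_cexp z : normc (cexp z) = expR (Re z).
Proof.
rewrite normcE /= !exprMn -mulrDr cos2Dsin2 mulr1 sqrtr_sqr.
by rewrite ger0_norm// expR_ge0.
Qed.

Lemma cos_int2pi x (k : int) : cos (x - 2 * pi * k%:~R) = cos x.
Proof.
have pos y (n : nat) : cos (y + 2 * pi * n%:R) = cos y.
  elim: n => [|n IH]; first by rewrite mulr0 addr0.
  rewrite -[RHS]IH -[RHS]cosD2pi; congr cos.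
  by rewrite -[n.+1%:R]natr1; ring.
case: k => n; last first.
  have -> : x - 2 * pi * (Negz n)%:~R = x + 2 * pi * n.+1%:R.
    by rewrite NegzE mulrNz -pmulrn; ring.
  exact: pos.
by rewrite -(pos _ n) -pmulrn subrK.
Qed.

Lemma sin_int2pi x (k : int) : sin (x - 2 * pi * k%:~R) = sin x.
Proof.
have pos y (n : nat) : sin (y + 2 * pi * n%:R) = sin y.
  elim: n => [|n IH]; first by rewrite mulr0 addr0.
  rewrite -[RHS]IH -[RHS]sinD2pi; congr sin.
  by rewrite -[n.+1%:R]natr1; ring.
case: k => n; last first.
  have -> : x - 2 * pi * (Negz n)%:~R = x + 2 * pi * n.+1%:R.
    by rewrite NegzE mulrNz -pmulrn; ring.
  exact: pos.
by rewrite -(pos _ n) -pmulrn subrK.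
Qed.

Lemma sin_ge_linear x : 0 <= x -> x <= pi -> 9 / 10 <= cos x ->
  9 / 10 * x <= sin x.
Proof.
move=> x0 xpi cx.
have [c|] := @MVT_segment R sin cos 0 x x0.
  by apply: continuous_subspaceT => z; exact: continuous_sin.
move=> c; rewrite in_itv /= => /andP[c0 cx'].
rewrite sin0 !subr0 => ->; apply: ler_wpM2r => //.
apply: (le_trans cx); have [->//|cneq] := eqVneq c x.
by rewrite ltW// ltr_cos ?in_itv/= ?c0 ?x0 ?xpi ?(le_trans cx')// lt_neqAle cneq.
Qed.

(** A small sine leaves [x] close to 0 or to [pi] up to sign, and the positive cosine excludes the
    latter. As [|sin x| <= 1 / 3], the cosine is at least [9 / 10], so that
    [|x| <= (10 / 9) (4 / 3) s <= 2 s]. The factor [4 / 3] comes from the division by an exponential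
    that is at least [3 / 4]. *)
Lemma sin_small_near0 x (s : R) : `|x| <= pi -> 0 < cos x -> s <= 1 / 4 ->
  `|sin x| <= 4 / 3 * s -> `|x| <= 2 * s.
Proof.
wlog x0 : x / 0 <= x => [H|].
  have [|/ltW x0] := leP 0 x; first exact: H.
  by move=> xpi cx s4 sx; rewrite -normrN; apply: H;
    rewrite ?oppr_ge0 ?normrN ?cosN// sinN normrN.
rewrite ger0_norm// => xpi cx s4 sx.
have s0 : 0 <= s by have := normr_ge0 (sin x); lra.
have c9 : 9 / 10 <= cos x.
  rewrite leNgt; apply/negP => clt.
  have sx2 : sin x ^+ 2 <= (4 / 3 * s) ^+ 2.
    by rewrite -[sin x ^+ 2]real_normK ?num_real// lerXn2r ?nnegrE//; lra.
  by have := cos2Dsin2 x; nra.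
have := sin_ge_linear x0 xpi c9; have := ler_norm (sin x); lra.
Qed.

(** The modulus of [cexp z] is [expR (Re z)], which controls the real part; once this factor is
    known to be close to 1, the imaginary part of [cexp z] controls the sine of [Im z]. *)
Lemma cexp_near1 z (s : R) : normc (cexp z - 1) <= s -> s <= 1 / 4 ->
  exists k : int, `|Re z| <= 2 * s /\ `|Im z - 2 * pi * k%:~R| <= 2 * s.
Proof.
case: z => a b zs s4.
have s0 : 0 <= s := le_trans (normc_ge0 _) zs.
have re : `|expR a * cos b - 1| <= s by exact: (le_trans (normr_Re_le _) zs).
have im : `|expR a * sin b| <= s.
  by apply: le_trans zs; have := normr_Im_le (cexp (a +i* b) - 1); rewrite /= subr0.
have ea : `|expR a - 1| <= s.
  rewrite -(normc_cexp (a +i* b)) ler_norml; apply/andP; split.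
    have := le_normcD (cexp (a +i* b)) (1 - cexp (a +i* b)).
    have -> : cexp (a +i* b) + (1 - cexp (a +i* b)) = 1 by ring.
    rewrite -(opprB (cexp _) 1) normcN ComplexField.Normc.normc1; lra.
  have := le_normcD (cexp (a +i* b) - 1) 1.
  by rewrite subrK ComplexField.Normc.normc1; lra.
move: ea; rewrite ler_norml => /andP[ea1 ea2].
have ea0 := expR_gt0 a.
have aS : `|a| <= 2 * s.
  have h1 := expR_ge1Dx a; have h2 := expR_ge1Dx (- a).
  have h3 : expR a * (1 - a) <= 1.
    by rewrite -[X in _ <= X](expRxMexpNx_1 a) ler_pM2l.
  rewrite ler_norml; apply/andP; split; last by lra.
  by rewrite leNgt; apply/negP => aneg; nra.
(* Rounds [b / (2 pi)] to a nearest integer, so that [b - 2 pi k] lies in [[-pi, pi]]. *)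
set k := Num.floor ((b + pi) / (2 * pi)).
have p0 := @pi_gt0 R.
have p20 : 0 < 2 * pi :> R by rewrite mulr_gt0.
have [k1 k2] : 2 * pi * k%:~R <= b + pi /\ b + pi < 2 * pi * (k%:~R + 1).
  split; rewrite [2 * pi * _]mulrC.
    by rewrite -ler_pdivlMr// ge_floor.
  by rewrite -ltr_pdivrMr// -intrD1 lt_succ_floor.
exists k; split=> //=.
have rpi : `|b - 2 * pi * k%:~R| <= pi by rewrite ler_norml; apply/andP; split; lra.
apply: sin_small_near0 => //.
  rewrite cos_int2pi; move: re; rewrite ler_norml => /andP[re1 _].
  by rewrite -(pmulr_rgt0 _ ea0); lra.
rewrite sin_int2pi; move: im; rewrite normrM gtr0_norm// => im.
have sb0 := normr_ge0 (sin b).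
by nra.
Qed.

End ComplexExponential.

(** * Separation of the exponentials of the roots away from critical lengths *)

Section RootGap.
Variable R : realType.
Local Notation C := R[i].
Local Notation normc := (@ComplexField.Normc.normc R).
Local Notation Re := (@complex.Re R).
Local Notation Im := (@complex.Im R).

(* The primitive of [x |-> cexp (delta x)] that vanishes at 0. *)
Definition divexp (delta : C) (x : R) : C :=
  if delta == 0 then x%:C else (cexp (delta * x%:C) - 1) / delta.

Lemma normc_real (x : R) : normc x%:C = `|x|.
Proof. by rewrite normcE /= expr0n/= addr0 sqrtr_sqr. Qed.

(** Multiplying by [delta], of modulus at most [2 M], shows that [cexp (delta L)] is within
    [1 / (15 M N^2)] of 1. The division by [delta] in the hypothesis is what excludes [k = 0]: for
    [delta] close to 0 the quotient is close to [L], which is larger than [1 / N]. *)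
Lemma divexp_small (delta : C) (L M N : R) : 1 <= M -> 1 <= N -> N^-1 < L ->
  normc delta <= 2 * M -> normc (divexp delta L) < (30 * M ^+ 2 * N ^+ 2)^-1 ->
  exists k : int, [/\ k != 0, `|Re (delta * L%:C)| <= 2 / (15 * M * N ^+ 2) &
    `|Im (delta * L%:C) - 2 * pi * k%:~R| <= 2 / (15 * M * N ^+ 2)].
Proof.
move=> M1 N1 NL dM; set kappa := _^-1 => small.
have M0 : 0 < M by lra.
have N0 : 0 < N by lra.
have N'0 : 0 < N^-1 by rewrite invr_gt0.
have L0 : 0 < L by lra.
have k0 : 0 < kappa by rewrite invr_gt0 !mulr_gt0 ?exprn_gt0.
have kN : 30 * kappa <= N^-1.
  have -> : kappa = 30^-1 * N^-1 * (M ^+ 2 * N)^-1.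
    by rewrite /kappa; field; rewrite !gt_eqF.
  rewrite [X in _ <= X](_ : _ = 30 * (30^-1 * N^-1 * 1)); last by field; rewrite gt_eqF.
  rewrite !ler_pM2l ?mulr_gt0 ?invr_gt0//.
  rewrite invf_le1 ?mulr_gt0 ?exprn_gt0// mulr_ege1// exprn_ege1//.
have d0 : delta != 0.
  apply/eqP => dE; move: small; rewrite /divexp dE eqxx normc_real gtr0_norm//; lra.
have nd0 : 0 < normc delta.
  rewrite lt_neqAle normc_ge0 andbT eq_sym; apply: contra d0.
  by move/eqP/ComplexField.Normc.eq0_normc => ->.
have sE : normc (cexp (delta * L%:C) - 1) <= kappa * normc delta.
  have -> : cexp (delta * L%:C) - 1 = divexp delta L * delta.
    by rewrite /divexp (negbTE d0) divfK.
  by rewrite ComplexField.Normc.normcM ler_pM2r// ltW.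
have sM : kappa * normc delta <= (15 * M * N ^+ 2)^-1.
  have -> : (15 * M * N ^+ 2)^-1 = kappa * (2 * M).
    by rewrite /kappa; field; rewrite !gt_eqF.
  by rewrite ler_pM2l.
have s4 : kappa * normc delta <= 1 / 4.
  suff : (15 * M * N ^+ 2)^-1 <= 1 / 15 by lra.
  rewrite div1r lef_pV2 ?posrE ?mulr_gt0 ?exprn_gt0//.
  by rewrite -mulrA ler_peMr// mulr_ege1// exprn_ege1.
have [k [re im]] := cexp_near1 sE s4.
exists k; split; last 2 first.
- by apply: (le_trans re); rewrite ler_pM2l.
- by apply: (le_trans im); rewrite ler_pM2l.
(* For [k = 0] the two bounds would give [|delta| L <= 4 kappa |delta|], whereas
   [4 kappa < 1 / N < L]. *)
apply/eqP => kE; move: im; rewrite kE mulr0 subr0 => im.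
have := normc_le_ReIm (delta * L%:C).
rewrite ComplexField.Normc.normcM normc_real gtr0_norm// => h.
have : normc delta * L <= normc delta * (4 * kappa) by nra.
by rewrite ler_pM2l//; lra.
Qed.

(** Two of the three integers have the same sign. Up to a global sign they are [k] and [l], the
    third is [- (k + l)], and [k^2 + l^2 + (k + l)^2] is twice the quadratic form. *)
Lemma nonzero_sum0 (k1 k2 k3 : int) : k1 != 0 -> k2 != 0 -> k3 != 0 ->
  k1 + k2 + k3 = 0 -> exists k l : nat, [/\ (0 < k)%N, (0 < l)%N &
    k1 ^+ 2 + k2 ^+ 2 + k3 ^+ 2 = 2 * (quadratic_form k l)%:Z].
Proof.
move=> k10 k20 k30 s0.
have pos (a b c : int) : 0 < a -> 0 < b -> a + b + c = 0 ->
   exists k l : nat, [/\ (0 < k)%N, (0 < l)%N &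
    a ^+ 2 + b ^+ 2 + c ^+ 2 = 2 * (quadratic_form k l)%:Z].
  move=> a0 b0 abc; have -> : c = - (a + b) by lia.
  move: a b a0 b0 {abc} => [k|//] [l|//] k0 l0; exists k, l; split=> //.
  by rewrite /quadratic_form -!mulnn !PoszD !PoszM; ring.
have same (a b c : int) : (0 < a /\ 0 < b) \/ (a < 0 /\ b < 0) -> a + b + c = 0 ->
   exists k l : nat, [/\ (0 < k)%N, (0 < l)%N &
    a ^+ 2 + b ^+ 2 + c ^+ 2 = 2 * (quadratic_form k l)%:Z].
  move=> [[a0 b0]|[a0 b0]] abc; first exact: pos.
  have [|||k [l [k0 l0 E]]] := pos (- a) (- b) (- c); [lia|lia|lia|].
  by exists k, l; split=> //; rewrite -E !sqrrN.
have : ((0 < k1 /\ 0 < k2) \/ (k1 < 0 /\ k2 < 0)) \/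
       ((0 < k2 /\ 0 < k3) \/ (k2 < 0 /\ k3 < 0)) \/
       ((0 < k3 /\ 0 < k1) \/ (k3 < 0 /\ k1 < 0)) by lia.
case=> [h|[h|h]].
- exact: same.
- have [|k [l [k0 l0 E]]] := same _ _ k1 h; first lia.
  by exists k, l; split=> //; rewrite -E; ring.
- have [|k [l [k0 l0 E]]] := same _ _ k2 h; first lia.
  by exists k, l; split=> //; rewrite -E; ring.
Qed.

(** The [a] and [b] stand for the real and imaginary parts of the three differences of roots
    multiplied by [L]; the last hypothesis is the real part of the identity on the sum of their
    squares. Replacing [b] by [2 pi k] in a square costs an error proportional to [|b|], whence
    [Z]. *)
Lemma near_lattice (L eta Z : R) (a1 a2 a3 b1 b2 b3 : R) (k1 k2 k3 : int) :
  0 <= eta -> eta <= 1 / 15 ->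
  `|a1| <= 2 * eta -> `|a2| <= 2 * eta -> `|a3| <= 2 * eta ->
  `|b1 - 2 * pi * k1%:~R| <= 2 * eta -> `|b2 - 2 * pi * k2%:~R| <= 2 * eta ->
  `|b3 - 2 * pi * k3%:~R| <= 2 * eta ->
  `|b1| <= Z -> `|b2| <= Z -> `|b3| <= Z ->
  b1 + b2 + b3 = 0 ->
  (a1 ^+ 2 - b1 ^+ 2) + (a2 ^+ 2 - b2 ^+ 2) + (a3 ^+ 2 - b3 ^+ 2) = - 6 * L ^+ 2 ->
  k1 + k2 + k3 = 0 /\
  `|4 * pi ^+ 2 * (k1 ^+ 2 + k2 ^+ 2 + k3 ^+ 2)%:~R - 6 * L ^+ 2|
    <= 24 * eta ^+ 2 + 12 * Z * eta.
Proof.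
move=> e0 e15 A1 A2 A3 B1 B2 B3 Z1 Z2 Z3 sb sq; split.
  (* The [b] have sum 0, so this number is at most [6 eta <= 2 / 5], less than [2 pi]. *)
  have : `|2 * pi * (k1 + k2 + k3)%:~R| < 2 * pi * 1 :> R.
    have p2 := @pi_ge2 R; rewrite !intrD; move: B1 B2 B3; rewrite !ler_norml ltr_norml.
    by move=> /andP[? ?] /andP[? ?] /andP[? ?]; apply/andP; split; lra.
  have p0 := @pi_gt0 R.
  rewrite normrM gtr0_norm ?mulr_gt0// ltr_pM2l ?mulr_gt0//.
  rewrite -intr_norm -[1]/(1%:~R) ltr_int; move: (k1 + k2 + k3) => k; clear; lia.
have key (a b : R) (k : int) : `|a| <= 2 * eta -> `|b| <= Z ->
   `|b - 2 * pi * k%:~R| <= 2 * eta ->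
   `|(4 * pi ^+ 2 * (k ^+ 2)%:~R + (a ^+ 2 - b ^+ 2))| <= 8 * eta ^+ 2 + 4 * Z * eta.
  move=> ha hb; rewrite rmorphXn/=; move: (k%:~R : R) => K.
  have -> : 4 * pi ^+ 2 * K ^+ 2 = (2 * pi * K) ^+ 2 by ring.
  set r := b - 2 * pi * K => hr.
  have -> : 2 * pi * K = b - r by rewrite /r; ring.
  move: ha hb hr; rewrite !ler_norml => /andP[? ?] /andP[? ?] /andP[? ?].
  have h1 : a ^+ 2 <= 4 * eta ^+ 2 by nra.
  have h2 : r ^+ 2 <= 4 * eta ^+ 2 by nra.
  have h3 : b * r <= Z * (2 * eta) by nra.
  have h4 : - (Z * (2 * eta)) <= b * r by nra.
  by apply/andP; split; nra.
have K1 := key _ _ _ A1 Z1 B1; have K2 := key _ _ _ A2 Z2 B2.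
have K3 := key _ _ _ A3 Z3 B3.
rewrite !intrD; move: K1 K2 K3; rewrite !ler_norml.
move: (k1 ^+ 2)%:~R (k2 ^+ 2)%:~R (k3 ^+ 2)%:~R => q1 q2 q3.
by move=> /andP[? ?] /andP[? ?] /andP[? ?]; apply/andP; split; lra.
Qed.

Lemma root_gap (L M : R) (n : nat) (nu1 nu2 nu3 : C) (N := n.+1%:R : R) :
  1 <= M -> N^-1 < L -> L < N ->
  (forall k l : nat, (0 < k <= n.+1)%N -> (0 < l <= n.+1)%N -> N^-1 <
     `|3 * L ^+ 2 - 4 * pi ^+ 2 * (quadratic_form k l)%:R|) ->
  nu1 + nu2 + nu3 = 0 -> nu1 * nu2 + nu2 * nu3 + nu3 * nu1 = 1 ->
  normc nu1 <= M -> normc nu2 <= M -> normc nu3 <= M ->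
  let kappa := (30 * M ^+ 2 * N ^+ 2)^-1 in
  [\/ kappa <= normc (divexp (nu2 - nu1) L), kappa <= normc (divexp (nu3 - nu2) L)
    | kappa <= normc (divexp (nu1 - nu3) L)].
Proof.
move=> M1 NL LN gap e1 e2 n1 n2 n3 kappa.
have N1 : 1 <= N by rewrite ler1n.
have NE : N = n.+1%:R by [].
clearbody N.
have [?|s1] := leP kappa (normc (divexp (nu2 - nu1) L)); first by constructor 1.
have [?|s2] := leP kappa (normc (divexp (nu3 - nu2) L)); first by constructor 2.
have [?|s3] := leP kappa (normc (divexp (nu1 - nu3) L)); first by constructor 3.
exfalso.
have nB (z w : C) : normc z <= M -> normc w <= M -> normc (z - w) <= 2 * M.
  move=> zM wM; apply: (le_trans (le_normcD _ _)); rewrite normcN; lra.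
have L0 : 0 < L by apply: lt_trans NL; rewrite invr_gt0; lra.
have M0 : 0 < M by lra.
have N0 : 0 < N by lra.
have [k1 [k10 A1 B1]] := divexp_small M1 N1 NL (nB _ _ n2 n1) s1.
have [k2 [k20 A2 B2]] := divexp_small M1 N1 NL (nB _ _ n3 n2) s2.
have [k3 [k30 A3 B3]] := divexp_small M1 N1 NL (nB _ _ n1 n3) s3.
have zZ (d : C) : normc d <= 2 * M -> `|Im (d * L%:C)| <= 2 * M * N.
  move=> dM; apply: (le_trans (normr_Im_le _)).
  rewrite ComplexField.Normc.normcM normc_real gtr0_norm//.
  by rewrite ler_pM ?normc_ge0// ltW.
have Z1 := zZ _ (nB _ _ n2 n1); have Z2 := zZ _ (nB _ _ n3 n2).
have Z3 := zZ _ (nB _ _ n1 n3).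
set eta := (15 * M * N ^+ 2)^-1 in A1 A2 A3 B1 B2 B3.
have e0 : 0 <= eta by rewrite invr_ge0 !mulr_ge0 ?exprn_ge0// ltW.
have e15 : eta <= 1 / 15.
  rewrite div1r lef_pV2 ?posrE ?mulr_gt0 ?exprn_gt0//.
  by rewrite -mulrA ler_peMr// mulr_ege1// exprn_ege1.
set z1 := (nu2 - nu1) * L%:C in A1 B1 Z1.
set z2 := (nu3 - nu2) * L%:C in A2 B2 Z2.
set z3 := (nu1 - nu3) * L%:C in A3 B3 Z3.
have zs : z1 + z2 + z3 = 0 by rewrite /z1 /z2 /z3; ring.
(* In terms of elementary symmetric functions, the squares of the differences of the roots have sum
   [2 e1^2 - 6 e2], with [e1 = 0] and [e2 = 1]. *)
have zq : z1 ^+ 2 + z2 ^+ 2 + z3 ^+ 2 = (- 6 * L ^+ 2)%:C.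
  have -> : z1 ^+ 2 + z2 ^+ 2 + z3 ^+ 2 =
    (2 * (nu1 + nu2 + nu3) ^+ 2 - 6 * (nu1 * nu2 + nu2 * nu3 + nu3 * nu1))
      * L%:C ^+ 2 by rewrite /z1 /z2 /z3; ring.
  rewrite e1 e2 -rmorphXn/= expr0n/= mulr0 sub0r mulr1.
  by apply/eqP; rewrite eq_complex /=; apply/andP; split; apply/eqP; ring.
have [ks kq] : k1 + k2 + k3 = 0 /\
  `|4 * pi ^+ 2 * (k1 ^+ 2 + k2 ^+ 2 + k3 ^+ 2)%:~R - 6 * L ^+ 2|
    <= 24 * eta ^+ 2 + 12 * (2 * M * N) * eta.
  apply: (near_lattice e0 e15 A1 A2 A3 B1 B2 B3 Z1 Z2 Z3).
    by have := congr1 Im zs; move: z1 z2 z3 {A1 A2 A3 B1 B2 B3 Z1 Z2 Z3 zs zq}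
      => [? ?] [? ?] [? ?].
  have := congr1 Re zq; move: z1 z2 z3 {A1 A2 A3 B1 B2 B3 Z1 Z2 Z3 zs zq}.
  by move=> [? ?] [? ?] [? ?] /=; rewrite !expr2.
have [k [l [k0 l0 klE]]] := nonzero_sum0 k10 k20 k30 ks.
(* Half of [24 eta^2 + 24 M N eta], where [eta = 1 / (15 M N^2)], is at most
   [(12 / 225 + 12 / 15) / N < 1 / N]: the constant in [kappa] is taken large enough for this. *)
have dist : `|3 * L ^+ 2 - 4 * pi ^+ 2 * (quadratic_form k l)%:R| <= N^-1.
  move: kq; rewrite klE intrM -[(quadratic_form k l)%:~R]/((quadratic_form k l)%:R).
  have -> : 2%:~R = 2 :> R by [].
  have -> : eta = 15^-1 * M^-1 * (N^-1) ^+ 2 by rewrite /eta; field; rewrite !gt_eqF.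
  move: ((quadratic_form k l)%:R : R) => q.
  have -> : 12 * (2 * M * N) * (15^-1 * M^-1 * N^-1 ^+ 2) = 24 / 15 * N^-1.
    by field; rewrite !gt_eqF.
  have M'1 : M^-1 <= 1 by rewrite invf_le1.
  have N'1 : N^-1 <= 1 by rewrite invf_le1.
  have M'0 : 0 < M^-1 by rewrite invr_gt0.
  have N'0 : 0 < N^-1 by rewrite invr_gt0.
  have : (15^-1 * M^-1 * N^-1 ^+ 2) ^+ 2 <= 225^-1 * N^-1.
    move: (M^-1) (N^-1) M'1 N'1 M'0 N'0 => u v u1 v1 u0 v0.
    have v2 : v ^+ 2 <= v by nra.
    have u2 : u ^+ 2 <= 1 by nra.
    have -> : (15^-1 * u * v ^+ 2) ^+ 2 = 225^-1 * (u ^+ 2 * (v ^+ 2 * v ^+ 2)) by field.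
    have v4 : v ^+ 2 * v ^+ 2 <= v by nra.
    by rewrite ler_pM2l//; nra.
  move: ((15^-1 * M^-1 * N^-1 ^+ 2) ^+ 2) => w; move: (N^-1) N'0 => v v0 w1.
  rewrite !ler_norml => /andP[? ?].
  by apply/andP; split; lra.
have N'1 : N^-1 <= 1 by rewrite invf_le1.
(* A larger [m] would give [4 pi^2 (k^2 + k l + l^2) >= 16 (N + 1)^2], too far from
   [3 L^2 <= 3 N^2]. Hence [k] and [l] are in the range where the hypothesis on the gap applies. *)
have bnd (m : nat) : (m ^ 2 <= quadratic_form k l)%N -> (m <= n.+1)%N.
  move=> mq; rewrite leqNgt; apply/negP => nm.
  have p2 : 2 ^+ 2 <= pi ^+ 2 :> R by rewrite lerXn2r ?nnegrE ?pi_ge0// pi_ge2.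
  have qN : (N + 1) ^+ 2 <= (quadratic_form k l)%:R :> R.
    by rewrite NE natr1 -natrX ler_nat (leq_trans _ mq)// leq_exp2r.
  have L2 : L ^+ 2 <= N ^+ 2 by rewrite lerXn2r ?nnegrE// ltW.
  have pq : 2 ^+ 2 * (N + 1) ^+ 2 <= pi ^+ 2 * (quadratic_form k l)%:R :> R.
    by rewrite ler_pM// ?exprn_ge0// addr_ge0// ltW.
  by move: dist; rewrite ler_norml => /andP[? ?]; nra.
have := gap k l; rewrite k0 l0 !bnd/= ?ltNge ?dist//.
- by move=> /(_ isT isT).
- by rewrite /quadratic_form leq_addl.
- by rewrite /quadratic_form -addnA leq_addr.
Qed.

End RootGap.

(** * Primitives of continuous functions on the whole line *)

Section RealIntegrals.
Variable R : realType.
Local Notation mu := (@lebesgue_measure R).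
Implicit Types (f g h : R -> R).

Definition integrable_on (L : R) f : Prop :=
  mu.-integrable `]0, L[%classic (EFin \o f).

Lemma continuous_integrable_cc (a b : R) f : continuous f ->
  mu.-integrable `[a, b]%classic (EFin \o f).
Proof.
move=> cf; apply: continuous_compact_integrable; first exact: segment_compact.
exact: continuous_subspaceT.
Qed.

Lemma continuous_integrable_on (L : R) f : continuous f -> integrable_on L f.
Proof.
move=> cf; apply: (integrableS _ _ _ (@continuous_integrable_cc 0 L f cf)) => //.
exact: subset_itv_oo_cc.
Qed.

(** As [f] vanishes on the negative half-line, integrating from -1 instead of 0 changes no value at
    [x >= 0] and makes 0 an interior point, so that the primitive is differentiable everywhere. For
    [x <= -1/2] it is locally zero; for larger [x] the fundamental theorem applies on
    [[-1, x + 1]]. *)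
Lemma continuous_primitive f : continuous f -> (forall x, x <= 0 -> f x = 0) ->
  exists F : R -> R, [/\ forall x : R, is_derive x (1 : R) F (f x), forall x, x <= 0 -> F x = 0 &
    forall L x, 0 <= x -> x <= L -> `|F x| <= \int[mu]_(t in `]0, L[) `|f t| ].
Proof.
move=> cf f0; pose F x := \int[mu]_(t in `[-1, x]) f t.
have F0 x : x <= 0 -> F x = 0.
  move=> x0; rewrite /F (@eq_Rintegral _ _ _ _ _ (cst 0)).
    by rewrite Rintegral_cst// mul0r.
  by move=> t; rewrite inE/= in_itv/= => /andP[_ tx]; apply: f0; exact: le_trans x0.
exists F; split=> // [x|L x x0 xL].
  have [xN|Nx] := leP x (- (1 / 2)).
    have x0 : x <= 0 by lra.
    rewrite f0//; apply: (@near_eq_is_derive _ _ _ (cst 0)) => //.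
    have xlt : x < 0 by lra.
    apply: filterS (lt_nbhsl_le xlt) => y xy.
    by rewrite F0//; have [/xy|/ltW/le_trans] := leP x y; last exact.
  have [|dF <-] := @continuous_FTC1_closed R f (-1) x (x + 1)
      ltac:(by rewrite ltrDl) (continuous_integrable_cc _ _ cf) _ (cf x).
    by lra.
  by rewrite derive1E; exact/derivableP.
have absf : continuous (fun t => `|f t|).
  by move=> t; apply: cvg_norm; exact: cf.
apply: (le_trans (le_normr_Rintegral _ (continuous_integrable_cc _ _ cf))) => //.
have -> : \int[mu]_(t in `]0, L[) `|f t| = \int[mu]_(t in `]0, L]) `|f t|.
  by apply: Rintegral_itv_bndo_bndc; exact: (@continuous_integrable_on L (fun t => `|f t|) absf).
rewrite Rintegral_mkcond [leRHS]Rintegral_mkcond; apply: le_Rintegral => //.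
- rewrite -restrict_EFin; apply: (integrable_mkcond _ _).1 => //.
  exact: (continuous_integrable_cc _ _ absf).
- rewrite -restrict_EFin; apply: (integrable_mkcond _ _).1 => //.
  apply: (integrableS _ _ _ (continuous_integrable_cc 0 L absf)) => //.
  by apply: subset_itvr; rewrite bnd_simp.
move=> t _; rewrite /patch; case: ifPn => [|_]; last first.
  by case: ifP => _ /=; rewrite ?normr_ge0 ?lexx.
rewrite inE/= in_itv/= => /andP[_ tx]; case: ifPn => // tL.
have [t0|t0] := leP t 0; first by rewrite f0// normr0.
by move: tL; rewrite notin_setE/= in_itv/= t0 (le_trans tx xL).
Qed.

End RealIntegrals.

(** * Derivatives, primitives and first-order equations for complex-valued functions *)

Section ComplexCalculus.
Variable R : realType.
Local Notation C := R[i].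
Local Notation mu := (@lebesgue_measure R).
Local Notation normc := (@ComplexField.Normc.normc R).
Local Notation Re := (@complex.Re R).
Local Notation Im := (@complex.Im R).
Implicit Types (f g h : R -> C) (nu : C) (L x : R).

Lemma ReD (z w : C) : Re (z + w) = Re z + Re w.
Proof. by case: z w => [a b] [c d]. Qed.

Lemma ImD (z w : C) : Im (z + w) = Im z + Im w.
Proof. by case: z w => [a b] [c d]. Qed.

Lemma ReM (z w : C) : Re (z * w) = Re z * Re w - Im z * Im w.
Proof. by case: z w => [a b] [c d]. Qed.

Lemma ImM (z w : C) : Im (z * w) = Re z * Im w + Im z * Re w.
Proof. by case: z w => [a b] [c d] /=; rewrite addrC. Qed.

Definition cderiv f (f' : R -> C) : Prop := forall x,
  is_derive x (1 : R) (fun t => Re (f t)) (Re (f' x)) /\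
  is_derive x (1 : R) (fun t => Im (f t)) (Im (f' x)).

Definition ccontinuous f : Prop :=
  continuous (fun t => Re (f t)) /\ continuous (fun t => Im (f t)).

Lemma is_derive_continuous (u : R -> R) x (d : R) :
  is_derive x (1 : R) u d -> {for x, continuous u}.
Proof. by move=> [du _]; exact/differentiable_continuous/derivable1_diffP. Qed.

Lemma cderiv_continuous f f' : cderiv f f' -> ccontinuous f.
Proof.
by move=> df; split=> x; have [d1 d2] := df x; exact: is_derive_continuous.
Qed.

Lemma eq_cderiv f f' g' : (forall x, f' x = g' x) -> cderiv f f' -> cderiv f g'.
Proof. by move=> fg df x; rewrite -fg. Qed.

Lemma cderiv_cst c : cderiv (fun=> c) (fun=> 0).
Proof. by move=> x; split; exact: is_derive_cst. Qed.

Lemma cderivD f f' g g' : cderiv f f' -> cderiv g g' ->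
  cderiv (fun x => f x + g x) (fun x => f' x + g' x).
Proof.
move=> df dg x; have [f1 f2] := df x; have [g1 g2] := dg x; split.
- rewrite (_ : (fun t => _) = (fun t => Re (f t)) + (fun t => Re (g t))).
    by rewrite ?ReD ?ImD; exact: is_deriveD.
  by apply/funext => t; rewrite ?ReD ?ImD.
- rewrite (_ : (fun t => _) = (fun t => Im (f t)) + (fun t => Im (g t))).
    by rewrite ?ReD ?ImD; exact: is_deriveD.
  by apply/funext => t; rewrite ?ReD ?ImD.
Qed.

Lemma cderivM f f' g g' : cderiv f f' -> cderiv g g' ->
  cderiv (fun x => f x * g x) (fun x => f' x * g x + f x * g' x).
Proof.
move=> df dg x; have [f1 f2] := df x; have [g1 g2] := dg x; split.
- rewrite (_ : (fun t => _) = (fun t => Re (f t)) * (fun t => Re (g t))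
     - (fun t => Im (f t)) * (fun t => Im (g t))).
    apply: is_derive_eq; rewrite ReD !ReM /GRing.scale /=; ring.
  by apply/funext => t; rewrite ReM.
- rewrite (_ : (fun t => _) = (fun t => Re (f t)) * (fun t => Im (g t))
     + (fun t => Im (f t)) * (fun t => Re (g t))).
    apply: is_derive_eq; rewrite ImD !ImM /GRing.scale /=; ring.
  by apply/funext => t; rewrite ImM.
Qed.

Lemma cderiv_cexp nu :
  cderiv (fun x => cexp (nu * x%:C)) (fun x => nu * cexp (nu * x%:C)).
Proof.
move=> x; have lin (a : R) : is_derive x (1 : R) (fun t => a * t) a.
  rewrite (_ : (fun t => _) = a \*: (id : R -> R)); last by [].
  by apply: is_derive_eq; rewrite /GRing.scale /= mulr1.
have reE t : Re (nu * t%:C) = Re nu * t by rewrite ReM /=; ring.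
have imE t : Im (nu * t%:C) = Im nu * t by rewrite ImM /=; ring.
have dexp : is_derive x (1 : R) (fun t => expR (Re nu * t)) (Re nu * expR (Re nu * x)).
  have := @is_derive1_comp R expR (fun t => Re nu * t) x _ _ _ (lin _).
  by move=> /(_ _ (is_derive_expR _)); rewrite mulrC.
have dcos : is_derive x (1 : R) (fun t => cos (Im nu * t)) (- Im nu * sin (Im nu * x)).
  have := @is_derive1_comp R cos (fun t => Im nu * t) x _ _ _ (lin _).
  by move=> /(_ _ (is_derive_cos _)); rewrite mulrC mulNr mulrN.
have dsin : is_derive x (1 : R) (fun t => sin (Im nu * t)) (Im nu * cos (Im nu * x)).
  have := @is_derive1_comp R sin (fun t => Im nu * t) x _ _ _ (lin _).
  by move=> /(_ _ (is_derive_sin _)); rewrite mulrC.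
split.
- rewrite (_ : (fun t => _) = (fun t => expR (Re nu * t)) * (fun t => cos (Im nu * t))).
    by apply: is_derive_eq; rewrite ReM /cexp /= reE imE /GRing.scale /=; ring.
  by apply/funext => t; rewrite /cexp /= reE imE.
- rewrite (_ : (fun t => _) = (fun t => expR (Re nu * t)) * (fun t => sin (Im nu * t))).
    by apply: is_derive_eq; rewrite ImM /cexp /= reE imE /GRing.scale /=; ring.
  by apply/funext => t; rewrite /cexp /= reE imE.
Qed.

Lemma ccontinuousM f g : ccontinuous f -> ccontinuous g ->
  ccontinuous (fun x => f x * g x).
Proof.
move=> [f1 f2] [g1 g2]; split => x.
- rewrite (_ : (fun t => _) = (fun t => Re (f t) * Re (g t) - Im (f t) * Im (g t))).
    by apply: cvgB; apply: cvgM; [exact: f1|exact: g1|exact: f2|exact: g2].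
  by apply/funext => t; rewrite ReM.
- rewrite (_ : (fun t => _) = (fun t => Re (f t) * Im (g t) + Im (f t) * Re (g t))).
    by apply: cvgD; apply: cvgM; [exact: f1|exact: g2|exact: f2|exact: g1].
  by apply/funext => t; rewrite ImM.
Qed.

Lemma ccontinuousD f g : ccontinuous f -> ccontinuous g ->
  ccontinuous (fun x => f x + g x).
Proof.
move=> [f1 f2] [g1 g2]; split => x.
- rewrite (_ : (fun t => _) = (fun t => Re (f t) + Re (g t))).
    by apply: cvgD; [exact: f1|exact: g1].
  by apply/funext => t; rewrite ?ReD ?ImD.
- rewrite (_ : (fun t => _) = (fun t => Im (f t) + Im (g t))).
    by apply: cvgD; [exact: f2|exact: g2].
  by apply/funext => t; rewrite ?ReD ?ImD.
Qed.

Lemma ccontinuous_cst c : ccontinuous (fun=> c).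
Proof. exact: (cderiv_continuous (cderiv_cst c)). Qed.

Lemma continuous_normc f : ccontinuous f -> continuous (fun t => normc (f t)).
Proof.
move=> [f1 f2] x; rewrite (_ : (fun t => _) =
    (fun t => Num.sqrt (Re (f t) * Re (f t) + Im (f t) * Im (f t)))).
  apply: (@continuous_comp _ _ _ (fun t => Re (f t) * Re (f t) + Im (f t) * Im (f t))
    Num.sqrt); last exact: sqrt_continuous.
  by apply: cvgD; apply: cvgM; [exact: f1|exact: f1|exact: f2|exact: f2].
by apply/funext => t; rewrite normcE !expr2.
Qed.

Lemma Rintegral_normc_le f L (S : R) : ccontinuous f -> 0 <= L ->
  (forall x, 0 <= x -> x <= L -> normc (f x) <= S) ->
  \int[mu]_(t in `]0, L[) normc (f t) <= S * L.
Proof.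
move=> cf L0 fS; have cn := continuous_normc cf.
have -> : S * L = \int[mu]_(t in `]0, L[) S.
  rewrite Rintegral_cst//= lebesgue_measure_itv/= lte_fin.
  have [//|L0'] := ltP 0 L; first by rewrite oppr0 addr0.
  by rewrite (@le_anti _ _ L 0 _) ?mulr0// L0' L0.
apply: le_Rintegral => //.
- exact: (@continuous_integrable_on _ L (fun t => normc (f t)) cn).
- by apply: (@continuous_integrable_on _ L (fun=> S)) => t; exact: cvg_cst.
- by move=> t /=; rewrite in_itv/= => /andP[/ltW t0 /ltW tL]; exact: fS.
Qed.

(** Bounding the modulus by the sum of the moduli of both components costs the factor 2. *)
Lemma cprimitive h : ccontinuous h -> (forall x, x <= 0 -> h x = 0) ->
  exists P, [/\ cderiv P h, forall x, x <= 0 -> P x = 0 &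
    forall L x, 0 <= x -> x <= L ->
      normc (P x) <= 2 * \int[mu]_(t in `]0, L[) normc (h t)].
Proof.
move=> ch h0; have [h1 h2] := ch.
have [P1 [dP1 P10 P1b]] := continuous_primitive h1
  ltac:(by move=> x /h0 ->).
have [P2 [dP2 P20 P2b]] := continuous_primitive h2
  ltac:(by move=> x /h0 ->).
exists (fun x => P1 x +i* P2 x); split.
- by move=> x; split; [exact: dP1|exact: dP2].
- by move=> x x0; rewrite P10// P20.
move=> L x x0 xL; apply: (le_trans (normc_le_ReIm _)) => /=.
rewrite mulr2n mulrDl mul1r; apply: lerD.
- apply: (le_trans (P1b _ _ x0 xL)); apply: le_Rintegral => //.
  + by apply: (@continuous_integrable_on _ L (fun t => `|Re (h t)|)) => t;
      apply: cvg_norm; exact: h1.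
  + exact: (@continuous_integrable_on _ L (fun t => normc (h t)) (continuous_normc ch)).
  + by move=> t _; exact: normr_Re_le.
- apply: (le_trans (P2b _ _ x0 xL)); apply: le_Rintegral => //.
  + by apply: (@continuous_integrable_on _ L (fun t => `|Im (h t)|)) => t;
      apply: cvg_norm; exact: h2.
  + exact: (@continuous_integrable_on _ L (fun t => normc (h t)) (continuous_normc ch)).
  + by move=> t _; exact: normr_Im_le.
Qed.

Lemma normc_cexp_le nu (M L x : R) : normc nu <= M -> 0 <= x -> x <= L ->
  normc (cexp (nu * x%:C)) <= expR (M * L).
Proof.
move=> nuM x0 xL; rewrite normc_cexp ler_expR ReM /= mulr0 subr0.
have reM : Re nu <= M by rewrite (le_trans _ nuM)// (le_trans (ler_norm _))// normr_Re_le.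
have M0 : 0 <= M := le_trans (normc_ge0 _) nuM.
by rewrite (le_trans (ler_wpM2r x0 reM))// ler_wpM2l.
Qed.

(** Variation of constants: [y] is [cexp (nu x)] times the primitive of [cexp (- nu x) h], and each
    exponential contributes a factor [expR (M L)]. The solution again vanishes on the negative
    half-line, so that it can be the right-hand side of another equation of this kind. *)
Lemma first_order_ode nu h : ccontinuous h -> (forall x, x <= 0 -> h x = 0) ->
  exists y, [/\ cderiv y (fun x => nu * y x + h x), forall x, x <= 0 -> y x = 0 &
    forall M L B x, normc nu <= M -> 0 <= x -> x <= L ->
      \int[mu]_(t in `]0, L[) normc (h t) <= B ->
      normc (y x) <= 2 * expR (M * L) ^+ 2 * B].
Proof.
move=> ch h0.
have ck : ccontinuous (fun x => cexp (- nu * x%:C) * h x).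
  by apply: ccontinuousM => //; exact: (cderiv_continuous (cderiv_cexp _)).
have [P [dP P0 Pb]] := cprimitive ck ltac:(by move=> x /h0 ->; rewrite mulr0).
exists (fun x => cexp (nu * x%:C) * P x); split.
- apply: (eq_cderiv _ (cderivM (cderiv_cexp nu) dP)) => x.
  by rewrite -[nu * _ * P x]mulrA [X in _ + X]mulrA -cexpD mulNr subrr cexp0 mul1r.
- by move=> x x0; rewrite P0// mulr0.
move=> M L B x nuM x0 xL hB; have M0 : 0 <= M := le_trans (normc_ge0 _) nuM.
rewrite ComplexField.Normc.normcM.
have E0 := expR_ge0 (M * L).
have int_le : \int[mu]_(t in `]0, L[) normc (cexp (- nu * t%:C) * h t)
    <= expR (M * L) * B.
  rewrite (le_trans _ (ler_wpM2l E0 hB))// -RintegralZl//; last first.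
    exact: (@continuous_integrable_on _ L (fun t => normc (h t)) (continuous_normc ch)).
  apply: le_Rintegral => //.
  - exact: (@continuous_integrable_on _ L _ (continuous_normc ck)).
  - apply: (@continuous_integrable_on _ L (fun t => expR (M * L) * normc (h t))) => t.
    by apply: cvgM; [exact: cvg_cst|exact: continuous_normc].
  - move=> t /=; rewrite in_itv/= => /andP[/ltW t0 /ltW tL].
    rewrite ComplexField.Normc.normcM ler_wpM2r ?normc_ge0//.
    by apply: normc_cexp_le => //; rewrite normcN.
have := Pb L x x0 xL => Px.
have -> : 2 * expR (M * L) ^+ 2 * B = expR (M * L) * (2 * (expR (M * L) * B)) by ring.
apply: ler_pM; rewrite ?normc_ge0//; first exact: normc_cexp_le.
by apply: (le_trans Px); rewrite ler_pM2l.
Qed.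

End ComplexCalculus.

(** * Explicit solution of the adjoint boundary value problem *)

Section AdjointEquation.
Variable R : realType.
Local Notation C := R[i].
Local Notation mu := (@lebesgue_measure R).
Local Notation normc := (@ComplexField.Normc.normc R).
Local Notation Re := (@complex.Re R).
Local Notation Im := (@complex.Im R).
Implicit Types (f g h : R -> C) (nu lambda : C) (L x : R).

Lemma MVT_bound (u u' : R -> R) (S x : R) :
  (forall t, is_derive t (1 : R) u (u' t)) -> 0 <= x ->
  (forall t, 0 <= t -> t <= x -> `|u' t| <= S) -> `|u x - u 0| <= S * x.
Proof.
move=> du x0 u'S; have [|t] := @MVT_segment R u u' 0 x x0 (fun t _ => du t).
  by apply: continuous_subspaceT => t; exact: is_derive_continuous (du t).
rewrite in_itv/= subr0 => /andP[t0 tx] ->.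
by rewrite normrM (ger0_norm x0) ler_wpM2r// u'S.
Qed.

(** The mean value theorem has no exact analogue for complex values; applied to both components, it
    costs the factor 2. *)
Lemma cMVT_bound f f' (S x : R) : cderiv f f' -> f 0 = 0 -> 0 <= x ->
  (forall t, 0 <= t -> t <= x -> normc (f' t) <= S) -> normc (f x) <= 2 * S * x.
Proof.
move=> df f0 x0 f'S; apply: (le_trans (normc_le_ReIm _)).
have -> : 2 * S * x = S * x + S * x by ring.
apply: lerD.
- have /= := @MVT_bound (fun t => Re (f t)) (fun t => Re (f' t)) S x
    (fun t => (df t).1) x0; rewrite f0 subr0; apply => t t0 tx.
  exact: (le_trans (normr_Re_le _) (f'S t t0 tx)).
- have /= := @MVT_bound (fun t => Im (f t)) (fun t => Im (f' t)) S x
    (fun t => (df t).2) x0; rewrite f0 subr0; apply => t t0 tx.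
  exact: (le_trans (normr_Im_le _) (f'S t t0 tx)).
Qed.

Lemma cderivZ (c : C) f f' : cderiv f f' -> cderiv (fun x => c * f x) (fun x => c * f' x).
Proof.
move=> df; apply: (eq_cderiv _ (cderivM (cderiv_cst c) df)) => x.
by rewrite mul0r add0r.
Qed.

Lemma cderiv_divexp (delta : C) :
  cderiv (divexp delta) (fun x => cexp (delta * x%:C)).
Proof.
have [->|d0] := eqVneq delta 0.
  move=> x; rewrite mul0r cexp0 /divexp eqxx /=; split.
    exact: is_derive_id.
  exact: is_derive_cst.
rewrite /divexp (negbTE d0) (_ : (fun x => _) =
    (fun x => delta^-1 * (cexp (delta * x%:C) + -1))); last first.
  by apply/funext => x; rewrite mulrC.
apply: (eq_cderiv _ (cderivZ _ (cderivD (cderiv_cexp _) (cderiv_cst _)))) => x.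
by rewrite addr0 mulKf.
Qed.

Lemma divexp0 (delta : C) : divexp delta 0 = 0.
Proof. by rewrite /divexp mulr0 cexp0 subrr mul0r if_same. Qed.

(** For distinct roots [k] is [(cexp (nu2 x) - cexp (nu1 x)) / (nu2 - nu1)], and for [nu1 = nu2] its
    limit [x cexp (nu1 x)]. Its value at [L] is [divexp (nu2 - nu1) L] up to an exponential
    factor. *)
Lemma homogeneous_solution lambda nu1 nu2 nu3 :
  nu1 + nu2 + nu3 = 0 -> nu1 * nu2 + nu2 * nu3 + nu3 * nu1 = 1 ->
  nu1 * nu2 * nu3 = - lambda ->
  exists k k1 k2 k3 : R -> C,
    [/\ forall x, k x = cexp (nu1 * x%:C) * divexp (nu2 - nu1) x,
        [/\ cderiv k k1, cderiv k1 k2, cderiv k2 k3 & ccontinuous k3],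
        forall x, k3 x + k1 x + lambda * k x = 0, k 0 = 0 & k1 0 = 1].
Proof.
move=> e1 e2 e3.
pose E (x : R) : C := cexp (nu2 * x%:C).
have dE : cderiv E (fun x => nu2 * E x) := cderiv_cexp nu2.
pose k (x : R) : C := cexp (nu1 * x%:C) * divexp (nu2 - nu1) x.
pose k1 (x : R) : C := nu1 * k x + E x.
pose k2 (x : R) : C := nu1 * k1 x + nu2 * E x.
pose k3 (x : R) : C := nu1 * k2 x + nu2 * (nu2 * E x).
have dk : cderiv k k1.
  apply: (eq_cderiv _ (cderivM (cderiv_cexp _) (cderiv_divexp _))) => x.
  rewrite /k1 /k mulrA; congr (_ + _).
  by rewrite -cexpD /E; congr cexp; ring.
have dk1 : cderiv k1 k2 := cderivD (cderivZ _ dk) dE.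
have dk2 : cderiv k2 k3 := cderivD (cderivZ _ dk1) (cderivZ _ dE).
have k00 : k 0 = 0 by rewrite /k divexp0 mulr0.
exists k, k1, k2, k3; split=> //; first split=> //.
- apply: (cderiv_continuous (cderivD (cderivZ _ dk2) (cderivZ _ (cderivZ _ dE)))).
- move=> x; rewrite -[k1 x]mul1r -[lambda]opprK -e2 -e3.
  (* With [D] the derivation, [(D - nu1) (D - nu2) (D - nu3) k = 0] expands to
     [k3 - e1 k2 + e2 k1 - e3 k = 0]. The left-hand side is therefore [e1 k2], and the second factor
     here is [k2]. *)
  rewrite [LHS](_ : _ = (nu1 + nu2 + nu3) * (nu1 ^+ 2 * k x + (nu1 + nu2) * E x)).
    by rewrite e1 mul0r.
  by rewrite /k3 /k2 /k1; ring.
- by rewrite /k1 k00 mulr0 add0r /E mulr0 cexp0.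
Qed.

(** The cubic operator is inverted one root at a time, without dividing by differences of roots.
    Each of the three equations multiplies the bound by [2 expR (M N)^2], and the initial bound and
    the two intermediate integrations contribute a factor [N] each. *)
Lemma particular_solution lambda nu1 nu2 nu3 h (M N : R) :
  nu1 + nu2 + nu3 = 0 -> nu1 * nu2 + nu2 * nu3 + nu3 * nu1 = 1 ->
  nu1 * nu2 * nu3 = - lambda ->
  ccontinuous h -> (forall x, x <= 0 -> h x = 0) ->
  normc nu1 <= M -> normc nu2 <= M -> normc nu3 <= M ->
  exists y y1 y2 y3 : R -> C,
    [/\ [/\ cderiv y y1, cderiv y1 y2, cderiv y2 y3 & ccontinuous y3],
        forall x, y3 x + y1 x + lambda * y x = h x, y 0 = 0, y1 0 = 0 &
        forall L x, 0 <= x -> x <= L -> L <= N ->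
          \int[mu]_(t in `]0, L[) normc (h t) <= N ->
          normc (y x) <= 8 * expR (M * N) ^+ 6 * N ^+ 3].
Proof.
move=> e1 e2 e3 ch h0 n1 n2 n3.
have [p [dp p0 pb]] := first_order_ode nu1 ch h0.
have [q [dq q0 qb]] := first_order_ode nu2 (cderiv_continuous dp) p0.
have [y [dy y0 yb]] := first_order_ode nu3 (cderiv_continuous dq) q0.
pose y1 (x : R) : C := nu3 * y x + q x.
pose q1 (x : R) : C := nu2 * q x + p x.
pose p1 (x : R) : C := nu1 * p x + h x.
pose y2 (x : R) : C := nu3 * y1 x + q1 x.
pose y3 (x : R) : C := nu3 * y2 x + (nu2 * q1 x + p1 x).
have dy1 : cderiv y1 y2 := cderivD (cderivZ _ dy) dq.
have dq1 : cderiv q1 (fun x => nu2 * q1 x + p1 x) := cderivD (cderivZ _ dq) dp.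
have dy2 : cderiv y2 y3 := cderivD (cderivZ _ dy1) dq1.
exists y, y1, y2, y3; split=> //; first split=> //.
- have cc f : ccontinuous f -> forall c, ccontinuous (fun x => c * f x).
    by move=> cf c; apply: ccontinuousM => //; exact: ccontinuous_cst.
  exact: (ccontinuousD (cc _ (cderiv_continuous dy2) _)
    (ccontinuousD (cc _ (cderiv_continuous dq1) _)
      (ccontinuousD (cc _ (cderiv_continuous dp) _) ch))).
- move=> x; rewrite -[y1 x]mul1r -[lambda]opprK -e2 -e3.
  rewrite [LHS](_ : _ = h x + (nu1 + nu2 + nu3) *
      (nu3 ^+ 2 * y x + (nu2 + nu3) * q x + p x)).
    by rewrite e1 mul0r addr0.
  by rewrite /y3 /y2 /y1 /q1 /p1; ring.
- exact: y0.
- by rewrite /y1 y0// q0// mulr0 addr0.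
move=> L x x0 xL LN hN.
have L0 := le_trans x0 xL.
have N0 := le_trans L0 LN.
have M0 : 0 <= M := le_trans (normc_ge0 _) n1.
set E := expR (M * N).
have EL : expR (M * L) <= E by rewrite ler_expR ler_wpM2l.
have E0 : 0 <= expR (M * L) by exact: expR_ge0.
have EL2 : expR (M * L) ^+ 2 <= E ^+ 2 by rewrite lerXn2r ?nnegrE// (le_trans E0).
have pB t : 0 <= t -> t <= L -> normc (p t) <= 2 * E ^+ 2 * N.
  move=> t0 tL; apply: (le_trans (pb M L N t n1 t0 tL hN)).
  by rewrite ler_wpM2r// ler_pM2l.
have Eg0 : 0 <= E by exact: expR_ge0.
have E20 : 0 <= E ^+ 2 by rewrite sqr_ge0.
have pI : \int[mu]_(t in `]0, L[) normc (p t) <= 2 * E ^+ 2 * N ^+ 2.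
  apply: (le_trans (Rintegral_normc_le (cderiv_continuous dp) L0 pB)).
  rewrite [leRHS](_ : _ = 2 * E ^+ 2 * N * N); last by ring.
  by rewrite ler_wpM2l// !mulr_ge0.
have qB t : 0 <= t -> t <= L -> normc (q t) <= 4 * E ^+ 4 * N ^+ 2.
  move=> t0 tL; apply: (le_trans (qb M L _ t n2 t0 tL pI)).
  rewrite [leRHS](_ : _ = 2 * E ^+ 2 * (2 * E ^+ 2 * N ^+ 2)); last by ring.
  by rewrite ler_wpM2r ?ler_pM2l// !mulr_ge0// exprn_ge0.
have E40 : 0 <= E ^+ 4 by rewrite exprn_ge0// (le_trans E0).
have qI : \int[mu]_(t in `]0, L[) normc (q t) <= 4 * E ^+ 4 * N ^+ 3.
  apply: (le_trans (Rintegral_normc_le (cderiv_continuous dq) L0 qB)).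
  rewrite [leRHS](_ : _ = 4 * E ^+ 4 * N ^+ 2 * N); last by ring.
  by rewrite ler_wpM2l// !mulr_ge0 ?exprn_ge0.
apply: (le_trans (yb M L _ x n3 x0 xL qI)).
rewrite [leRHS](_ : _ = 2 * E ^+ 2 * (4 * E ^+ 4 * N ^+ 3)); last by ring.
by rewrite ler_wpM2r ?ler_pM2l// !mulr_ge0// exprn_ge0.
Qed.

(** The particular solution [y] is corrected by [c k], where [c = - y(L) / k(L)], to vanish at [L].
    With [E = expR (M N)], one has [|k(L)| >= kappa / E], hence [|c| <= 8 E^7 N^3 / kappa]; as
    [|k| <= 2 E^3 N], the two terms contribute 8 and 16 to the constant 24. Moreover [g'(0) = c],
    because [y'(0) = 0] and [k'(0) = 1]. *)
Lemma adjoint_solution lambda nu1 nu2 nu3 h (L M N kappa : R) :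
  nu1 + nu2 + nu3 = 0 -> nu1 * nu2 + nu2 * nu3 + nu3 * nu1 = 1 ->
  nu1 * nu2 * nu3 = - lambda ->
  normc nu1 <= M -> normc nu2 <= M -> normc nu3 <= M ->
  0 < L -> L <= N -> 1 <= N -> 0 < kappa -> kappa <= 1 ->
  kappa <= normc (divexp (nu2 - nu1) L) ->
  ccontinuous h -> (forall x, x <= 0 -> h x = 0) ->
  \int[mu]_(t in `]0, L[) normc (h t) <= N ->
  let S := 24 * expR (M * N) ^+ 10 * N ^+ 4 / kappa in
  exists g g1 g2 g3 : R -> C,
    [/\ [/\ cderiv g g1, cderiv g1 g2, cderiv g2 g3 & ccontinuous g3],
        forall x, g3 x + g1 x + lambda * g x = h x, g 0 = 0 /\ g L = 0,
        normc (g1 0) <= S &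
        forall x, 0 <= x -> x <= L -> normc (g x) <= S].
Proof.
move=> e1 e2 e3 n1 n2 n3 L0 LN N1 k0 k1' kL ch h0 hN.
have [y [y1 [y2 [y3 [[dy dy1 dy2 cy3] yE y0 y10 yb]]]]] :=
  particular_solution N e1 e2 e3 ch h0 n1 n2 n3.
have [k [k1 [k2 [k3 [kE [dk dk1 dk2 ck3] kh k00 k10]]]]] :=
  homogeneous_solution e1 e2 e3.
set E := expR (M * N); move=> S.
have M0 : 0 <= M := le_trans (normc_ge0 _) n1.
have N0 : 0 < N by lra.
have E1 : 1 <= E by rewrite -expR0 ler_expR mulr_ge0// ltW.
have E0 : 0 < E by lra.
have cexpE nu x : normc nu <= M -> 0 <= x -> x <= L -> normc (cexp (nu * x%:C)) <= E.
  by move=> nuM x0 xL; apply: normc_cexp_le => //; exact: le_trans LN.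
have kLb : kappa / E <= normc (k L).
  have mE : normc (cexp (- (nu1 * L%:C))) * normc (cexp (nu1 * L%:C)) = 1.
    by rewrite -ComplexField.Normc.normcM cexpN ComplexField.Normc.normc1.
  have nN : normc (cexp (- (nu1 * L%:C))) <= E.
    by rewrite -mulNr; apply: cexpE; rewrite ?normcN// ltW.
  have E'le : E^-1 <= normc (cexp (nu1 * L%:C)).
    rewrite -[E^-1]mul1r ler_pdivrMr// -[leLHS]mE mulrC.
    by rewrite ler_wpM2l ?normc_ge0.
  rewrite kE ComplexField.Normc.normcM [leLHS]mulrC.
  by apply: ler_pM; rewrite ?invr_ge0 ?(ltW k0) ?(ltW E0).
have kLpos : 0 < normc (k L) by apply: lt_le_trans kLb; rewrite divr_gt0.
have kL0 : k L != 0.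
  by apply: contraTneq kLpos => ->; rewrite ComplexField.Normc.normc0 ltxx.
pose c := - (y L / k L).
have cB : normc c <= 8 * E ^+ 7 * N ^+ 3 / kappa.
  rewrite normcN ComplexField.Normc.normcM ComplexField.Normc.normcV.
  have yL := yb L L (ltW L0) (lexx L) LN hN; rewrite -/E in yL.
  have -> : 8 * E ^+ 7 * N ^+ 3 / kappa = 8 * E ^+ 6 * N ^+ 3 * (kappa / E)^-1.
    by field; rewrite !gt_eqF.
  apply: ler_pM; rewrite ?normc_ge0 ?invr_ge0 ?normc_ge0//.
  by rewrite lef_pV2 ?posrE ?divr_gt0.
have kB x : 0 <= x -> x <= L -> normc (k x) <= 2 * E ^+ 3 * N.
  move=> x0 xL; rewrite kE ComplexField.Normc.normcM.
  have -> : 2 * E ^+ 3 * N = E * (2 * E ^+ 2 * N) by ring.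
  apply: ler_pM; rewrite ?normc_ge0//; first exact: cexpE.
  (* The mean value theorem bounds [divexp] without dividing by [nu2 - nu1], which may be small or
     zero. *)
  have := @cMVT_bound _ _ (E ^+ 2) x (cderiv_divexp (nu2 - nu1)) (divexp0 _) x0.
  have ed t : 0 <= t -> t <= x -> normc (cexp ((nu2 - nu1) * t%:C)) <= E ^+ 2.
    move=> t0 tx; have tL := le_trans tx xL.
    rewrite mulrBl cexpD ComplexField.Normc.normcM expr2 -mulNr.
    by apply: ler_pM; rewrite ?normc_ge0// cexpE// normcN.
  move=> /(_ ed) /le_trans; apply.
  by apply: ler_wpM2l; [rewrite mulr_ge0 ?sqr_ge0|exact: le_trans xL LN].
have k'1 : 1 <= kappa^-1 by rewrite invf_ge1.
have expE (i j : nat) : (i <= j)%N -> E ^+ i <= E ^+ j.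
  by move=> ij; apply: ler_weXn2l.
have expN (i j : nat) : (i <= j)%N -> N ^+ i <= N ^+ j.
  by move=> ij; apply: ler_weXn2l.
have E10 : 0 <= E ^+ 10 by rewrite exprn_ge0// ltW.
have N4 : 0 <= N ^+ 4 by rewrite exprn_ge0// ltW.
have SE : S = 24 * (E ^+ 10 * N ^+ 4) * kappa^-1 by rewrite /S; ring.
have EN7 : E ^+ 7 * N ^+ 3 <= E ^+ 10 * N ^+ 4.
  by rewrite ler_pM ?exprn_ge0 ?expE ?expN// ltW.
have EN6 : E ^+ 6 * N ^+ 3 <= E ^+ 10 * N ^+ 4.
  by rewrite ler_pM ?exprn_ge0 ?expE ?expN// ltW.
have P0 : 0 <= E ^+ 10 * N ^+ 4 by rewrite mulr_ge0.
exists (fun x => y x + c * k x), (fun x => y1 x + c * k1 x),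
  (fun x => y2 x + c * k2 x), (fun x => y3 x + c * k3 x); split.
- split; [exact: (cderivD dy (cderivZ _ dk))|exact: (cderivD dy1 (cderivZ _ dk1))
         |exact: (cderivD dy2 (cderivZ _ dk2))|].
  by apply: ccontinuousD => //; apply: ccontinuousM => //; exact: ccontinuous_cst.
- move=> x; rewrite -[RHS]addr0 -[X in _ = _ + X](mulr0 c) -(kh x) -yE; ring.
- by rewrite y0 k00 mulr0 addr0 /c mulNr divfK// subrr.
- rewrite y10 k10 mulr1 add0r (le_trans cB)// SE ler_wpM2r ?invr_ge0 ?(ltW k0)//.
  by rewrite -mulrA; lra.
- move=> x x0 xL; apply: (le_trans (le_normcD _ _)).
  rewrite ComplexField.Normc.normcM.
  have yx := yb L x x0 xL LN hN; rewrite -/E in yx.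
  have ck : normc c * normc (k x) <= 16 * (E ^+ 10 * N ^+ 4) * kappa^-1.
    have -> : 16 * (E ^+ 10 * N ^+ 4) * kappa^-1
      = (8 * E ^+ 7 * N ^+ 3 / kappa) * (2 * E ^+ 3 * N) by ring.
    by apply: ler_pM; rewrite ?normc_ge0 ?kB.
  have y8 : normc (y x) <= 8 * (E ^+ 10 * N ^+ 4) * kappa^-1.
    have PP : E ^+ 10 * N ^+ 4 <= E ^+ 10 * N ^+ 4 * kappa^-1 by rewrite ler_peMr.
    apply: (le_trans yx); move: EN6 PP.
    move: (E ^+ 10 * N ^+ 4) (kappa^-1) (E ^+ 6) (N ^+ 3) => a b d e; lra.
  rewrite SE; lra.
Qed.

Lemma exists_roots lambda : exists nu1 nu2 nu3 : C,
  [/\ nu1 + nu2 + nu3 = 0, nu1 * nu2 + nu2 * nu3 + nu3 * nu1 = 1 &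
      nu1 * nu2 * nu3 = - lambda].
Proof.
have [nu1 nu1E] := @solve_monicpoly C 3
  (fun i => if i == 0%N then - lambda else if i == 1%N then -1 else 0) isT.
(* The quotient of [X^3 + X + lambda] by [X - nu1] is [X^2 + nu1 X + nu1^2 + 1]. *)
have [nu2 nu2E] := @solve_monicpoly C 2
  (fun i => if i == 0%N then - (nu1 ^+ 2 + 1) else - nu1) isT.
exists nu1, nu2, (- nu1 - nu2).
move: nu1E nu2E; rewrite !big_ord_recr !big_ord0 /= => E1 E2.
have {}E1 : nu1 ^+ 3 = - lambda - nu1 by rewrite E1; ring.
have {}E2 : nu2 ^+ 2 = - (nu1 ^+ 2 + 1) - nu1 * nu2 by rewrite E2; ring.
split; first by ring.
- have -> : nu1 * nu2 + nu2 * (- nu1 - nu2) + (- nu1 - nu2) * nu1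
    = - nu1 ^+ 2 - nu1 * nu2 - nu2 ^+ 2 by ring.
  by rewrite E2; ring.
- have -> : nu1 * nu2 * (- nu1 - nu2) = - nu1 * (nu1 * nu2 + nu2 ^+ 2) by ring.
  rewrite E2; have -> : - nu1 * (nu1 * nu2 + (- (nu1 ^+ 2 + 1) - nu1 * nu2))
    = nu1 ^+ 3 + nu1 by ring.
  by rewrite E1; ring.
Qed.

(** From [nu^3 = - (lambda + nu)]: a modulus [a > 1 + |lambda|] would satisfy
    [a^3 >= a (1 + |lambda|)^2 > a + |lambda|]. The hypotheses are invariant under cyclic
    permutation, so the bound holds for each root. *)
Lemma root_bound lambda nu1 nu2 nu3 : nu1 + nu2 + nu3 = 0 ->
  nu1 * nu2 + nu2 * nu3 + nu3 * nu1 = 1 -> nu1 * nu2 * nu3 = - lambda ->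
  normc nu1 <= 1 + normc lambda.
Proof.
move=> e1 e2 e3.
have E : nu1 * (nu1 * nu1) = - (lambda + nu1).
  rewrite -[lambda]opprK -e3 -[X in - (_ + X)]mul1r -e2.
  rewrite [LHS](_ : _ = nu1 ^+ 2 * (nu1 + nu2 + nu3)
    - (- (nu1 * nu2 * nu3) + (nu1 * nu2 + nu2 * nu3 + nu3 * nu1) * nu1)).
    by rewrite e1 mulr0 add0r.
  by ring.
have := le_normcD lambda nu1; move: E => /(congr1 normc).
rewrite normcN !ComplexField.Normc.normcM => <- h.
have a0 := normc_ge0 nu1; have b0 := normc_ge0 lambda.
rewrite leNgt; apply/negP => lt.
move: (normc nu1) (normc lambda) h a0 b0 lt => a b h a0 b0 lt.
have : (1 + b) * (1 + b) <= a * a by nra.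
nra.
Qed.

End AdjointEquation.

(** * Cutoff functions of class C^1 *)

Section Cutoff.
Variable R : realType.
Implicit Types (t x n L : R).

Definition ppart t : R := Num.max 0 t.

Lemma continuous_ppart : continuous ppart.
Proof.
move=> t; rewrite /ppart; apply: (@continuous_max _ _ (fun=> 0) id).
  exact: cvg_cst.
exact: cvg_id.
Qed.

Lemma ppart_le0 t : t <= 0 -> ppart t = 0.
Proof. by move=> t0; rewrite /ppart max_l. Qed.

Lemma ppart_ge0 t : 0 <= t -> ppart t = t.
Proof. by move=> t0; rewrite /ppart max_r. Qed.

(** Meant for the square of the positive part, where the quadratic remainder is a matter of signs,
    including at the knot. *)
Lemma is_derive_quadratic (u : R -> R) x (d C : R) :
  (forall h, `|u (x + h) - u x - h * d| <= C * h ^+ 2) ->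
  is_derive x (1 : R) u d.
Proof.
move=> uC; have C0 : 0 <= C.
  by have := uC 1; rewrite expr1n mulr1; exact/le_trans/normr_ge0.
have lim : (fun h => h^-1 *: ((u \o shift x) (h *: (1 : R)) - u x)) @ 0^' --> d.
  apply/cvgrPdist_le => e e0; near=> h.
  have h0 : h != 0 by near: h; exact: nbhs_dnbhs_neq.
  rewrite /= /GRing.scale /= mulr1 [h + x]addrC.
  have -> : d - h^-1 * (u (x + h) - u x) = - (h^-1 * (u (x + h) - u x - h * d)).
    by field.
  rewrite normrN normrM normfV mulrC ler_pdivrMr ?normr_gt0//.
  apply: (le_trans (uC h)).
  rewrite -[h ^+ 2]real_normK ?num_real// expr2 mulrA ler_wpM2r//.
  have hC : `|h| <= e / (C + 1) by near: h; apply: dnbhs0_le; rewrite divr_gt0// ltr_wpDl.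
  rewrite ler_pdivlMr ?ltr_wpDl// in hC; apply: le_trans hC.
  by rewrite mulrC ler_wpM2l// lerDl.
apply: DeriveDef; first by apply/cvg_ex; exists d.
by apply/cvg_lim; [exact: Rhausdorff|exact: lim].
Unshelve. all: by end_near. Qed.

Lemma is_derive_sqr_ppart t :
  is_derive t (1 : R) (fun s => ppart s ^+ 2) (2 * ppart t).
Proof.
apply: (@is_derive_quadratic _ _ _ 1) => h; rewrite mul1r /ppart.
have [th|th] := leP 0 (t + h); have [t0|t0] := leP 0 t; rewrite ler_norml; nra.
Qed.

(* Quadratic spline with knots 0, 1/2 and 1, hence C^1. *)
Definition smoothstep t : R :=
  2 * (ppart t ^+ 2 - 2 * ppart (t - 1 / 2) ^+ 2 + ppart (t - 1) ^+ 2).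

Definition dsmoothstep t : R :=
  4 * (ppart t - 2 * ppart (t - 1 / 2) + ppart (t - 1)).

Lemma is_derive_smoothstep t : is_derive t (1 : R) smoothstep (dsmoothstep t).
Proof.
have sh (c : R) : is_derive t (1 : R) (fun s => ppart (s - c) ^+ 2) (2 * ppart (t - c)).
  have := @is_derive1_comp R (fun s => ppart s ^+ 2) (fun s => s - c) t _ 1
    (is_derive_sqr_ppart _).
  rewrite mulr1; apply.
  rewrite -[X in is_derive _ _ _ X]subr0.
  exact: is_deriveB.
have h0 := is_derive_sqr_ppart t; have h1 := sh (1 / 2); have h2 := sh 1.
rewrite /smoothstep (_ : (fun _ => _) = 2 \*: ((fun s => ppart s ^+ 2)
   - 2 \*: (fun s => ppart (s - 1 / 2) ^+ 2) + (fun s => ppart (s - 1) ^+ 2))) //.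
by apply: is_derive_eq; rewrite /dsmoothstep /GRing.scale /=; ring.
Qed.

Lemma continuous_dsmoothstep : continuous dsmoothstep.
Proof.
have sh (c : R) : continuous (fun s => ppart (s - c)).
  move=> t; apply: (@continuous_comp _ _ _ (fun s => s - c) ppart).
    by apply: cvgB; [exact: cvg_id|exact: cvg_cst].
  exact: continuous_ppart.
move=> t; apply: cvgM; first exact: cvg_cst.
apply: cvgD; last exact: sh.
apply: cvgB; first exact: continuous_ppart.
by apply: cvgM; [exact: cvg_cst|exact: sh].
Qed.

Lemma smoothstep_le0 t : t <= 0 -> smoothstep t = 0.
Proof. by move=> t0; rewrite /smoothstep !ppart_le0; [ring|lra..]. Qed.

Lemma smoothstep_ge1 t : 1 <= t -> smoothstep t = 1.
Proof. by move=> t0; rewrite /smoothstep !ppart_ge0; [field|lra..]. Qed.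

Lemma smoothstep_itv t : 0 <= smoothstep t <= 1.
Proof.
rewrite /smoothstep /ppart.
have [a|a] := leP 0 t; have [b|b] := leP 0 (t - 1 / 2); have [c|c] := leP 0 (t - 1);
  apply/andP; split; nra.
Qed.

Lemma dsmoothstep_itv t : 0 <= dsmoothstep t <= 2.
Proof.
rewrite /dsmoothstep /ppart.
have [a|a] := leP 0 t; have [b|b] := leP 0 (t - 1 / 2); have [c|c] := leP 0 (t - 1);
  apply/andP; split; lra.
Qed.

Lemma dsmoothstep_support t : dsmoothstep t != 0 -> 0 < t < 1.
Proof.
apply: contraNT; rewrite negb_and -!leNgt => /orP[t0|t1]; apply/eqP.
  by rewrite /dsmoothstep !ppart_le0; [ring|lra..].
by rewrite /dsmoothstep !ppart_ge0; [field|lra..].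
Qed.

(** As soon as [3 / n <= L], this is a plateau: 0 outside [[1/n, L - 1/n]] and 1 on
    [[2/n, L - 2/n]]. *)
Definition cutoff L n x : R :=
  smoothstep (n * x - 1) + smoothstep (n * (L - x) - 1) - 1.

(** A difference of two bumps of height at most [2 n], within [2 / n] of 0 and of [L]; in the limit
    they select boundary values. *)
Definition dcutoff L n x : R :=
  n * dsmoothstep (n * x - 1) - n * dsmoothstep (n * (L - x) - 1).

Lemma is_derive_affine_comp (u : R -> R) (a b x d : R) :
  is_derive (a * x + b) (1 : R) u d ->
  is_derive x (1 : R) (fun t => u (a * t + b)) (a * d).
Proof.
move=> du; have := @is_derive1_comp R u (fun t => a * t + b) x d a du.
rewrite mulrC; apply.
rewrite (_ : (fun t => _) = a \*: (id : R -> R) + cst b) //.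
by apply: is_derive_eq; rewrite /GRing.scale /= mulr1 addr0.
Qed.

Lemma is_derive_smoothstepl n x :
  is_derive x (1 : R) (fun t => smoothstep (n * t - 1)) (n * dsmoothstep (n * x - 1)).
Proof. by apply: is_derive_affine_comp; exact: is_derive_smoothstep. Qed.

Lemma is_derive_smoothstepr L n x : is_derive x (1 : R)
  (fun t => smoothstep (n * (L - t) - 1)) (- (n * dsmoothstep (n * (L - x) - 1))).
Proof.
have E t : n * (L - t) - 1 = (- n) * t + (n * L - 1) by ring.
rewrite (_ : (fun t => _) = (fun t => smoothstep ((- n) * t + (n * L - 1)))).
  by rewrite E -mulNr; apply: is_derive_affine_comp; exact: is_derive_smoothstep.
by apply/funext => t; rewrite E.
Qed.

Lemma is_derive_cutoff L n x : is_derive x (1 : R) (cutoff L n) (dcutoff L n x).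
Proof.
have d1 := is_derive_smoothstepl n x; have d2 := is_derive_smoothstepr L n x.
rewrite /cutoff (_ : (fun t => _) = (fun t => smoothstep (n * t - 1)) +
   (fun t => smoothstep (n * (L - t) - 1)) - cst 1) //.
by apply: is_derive_eq; rewrite /dcutoff subr0.
Qed.

Lemma continuous_kernell n : continuous (fun x => n * dsmoothstep (n * x - 1)).
Proof.
move=> x; apply: cvgM; first exact: cvg_cst.
apply: (@continuous_comp _ _ _ (fun t => n * t - 1) dsmoothstep).
  by apply: cvgB; [apply: cvgM; [exact: cvg_cst|exact: cvg_id]|exact: cvg_cst].
exact: continuous_dsmoothstep.
Qed.

Lemma continuous_kernelr L n : continuous (fun x => n * dsmoothstep (n * (L - x) - 1)).
Proof.
move=> x; apply: cvgM; first exact: cvg_cst.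
apply: (@continuous_comp _ _ _ (fun t => n * (L - t) - 1) dsmoothstep).
  apply: cvgB; last exact: cvg_cst.
  by apply: cvgM; [exact: cvg_cst|apply: cvgB; [exact: cvg_cst|exact: cvg_id]].
exact: continuous_dsmoothstep.
Qed.

Lemma continuous_dcutoff L n : continuous (dcutoff L n).
Proof. by move=> x; apply: cvgB; [exact: continuous_kernell|exact: continuous_kernelr]. Qed.

Lemma cutoff_norm_le1 L n x : `|cutoff L n x| <= 1.
Proof.
rewrite /cutoff; have /andP[a b] := smoothstep_itv (n * x - 1).
have /andP[c d] := smoothstep_itv (n * (L - x) - 1).
by rewrite ler_norml; apply/andP; split; lra.
Qed.

Lemma kernell_support n x : 0 < n -> n * dsmoothstep (n * x - 1) != 0 -> 0 < x < 2 / n.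
Proof.
move=> n0; rewrite mulf_eq0 negb_or => /andP[_ /dsmoothstep_support /andP[h1 h2]].
rewrite ltr_pdivlMr// -(pmulr_rgt0 _ n0) [x * n]mulrC; apply/andP; split; lra.
Qed.

Lemma kernelr_support L n x : 0 < n ->
  n * dsmoothstep (n * (L - x) - 1) != 0 -> 0 < L - x < 2 / n.
Proof. exact: kernell_support. Qed.

Lemma kernel_le n x : 0 < n -> 0 <= n * dsmoothstep x <= 2 * n.
Proof.
move=> n0; have /andP[h1 h2] := dsmoothstep_itv x.
by rewrite mulr_ge0 ?(ltW n0)//= mulrC ler_wpM2r ?(ltW n0).
Qed.

Lemma cutoff_inside L n x : 0 < n -> 2 / n <= x -> 2 / n <= L - x ->
  cutoff L n x = 1 /\ dcutoff L n x = 0.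
Proof.
move=> n0 hx hL; have n0' := hx; have n0'' := hL.
rewrite ler_pdivrMr// mulrC in n0'; rewrite ler_pdivrMr// mulrC in n0''.
split; first by rewrite /cutoff !smoothstep_ge1; [ring|lra..].
have -> : dcutoff L n x = n * dsmoothstep (n * x - 1) - n * dsmoothstep (n * (L - x) - 1) by [].
have -> : n * dsmoothstep (n * x - 1) = 0.
  apply/eqP; apply: contraT => /(kernell_support n0)/andP[_]; rewrite ltNge hx//.
have -> : n * dsmoothstep (n * (L - x) - 1) = 0.
  apply/eqP; apply: contraT => /(kernelr_support n0)/andP[_]; rewrite ltNge hL//.
by rewrite subr0.
Qed.

Lemma is_test_cutoff L n (phi phi' : R -> R) : 0 < n -> 3 / n <= L ->
  (forall x, is_derive x (1 : R) phi (phi' x)) -> continuous phi' ->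
  is_test L (fun x => phi x * cutoff L n x) /\
  forall x, derive1 (fun x => phi x * cutoff L n x) x
            = phi' x * cutoff L n x + phi x * dcutoff L n x.
Proof.
move=> n0 nL dphi cphi'.
have d x : is_derive x (1 : R) (fun x => phi x * cutoff L n x)
    (phi' x * cutoff L n x + phi x * dcutoff L n x).
  have h1 := dphi x; have h2 := is_derive_cutoff L n x.
  rewrite (_ : (fun x => _) = phi * cutoff L n) //.
  by apply: is_derive_eq; rewrite /GRing.scale /=; ring.
have d1 x : derive1 (fun x => phi x * cutoff L n x) x
            = phi' x * cutoff L n x + phi x * dcutoff L n x.
  by rewrite derive1E; have [_ ->] := d x.
have cphi : continuous phi.
  by move=> x; have [/derivable1_diffP/differentiable_continuous] := dphi x.
have ccut : continuous (cutoff L n).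
  move=> x.
  by have [/derivable1_diffP/differentiable_continuous] := is_derive_cutoff L n x.
split=> //; split.
- by move=> x; have [] := d x.
- rewrite (_ : derive1 _ = fun x => phi' x * cutoff L n x + phi x * dcutoff L n x).
    move=> x; apply: cvgD; apply: cvgM;
      [exact: cphi'|exact: ccut|exact: cphi|exact: continuous_dcutoff].
  exact/funext.
have nL' := nL; rewrite ler_pdivrMr// mulrC in nL'.
have n'0 : 0 < n^-1 by rewrite invr_gt0.
have nn : n * n^-1 = 1 by rewrite divff// gt_eqF.
exists n^-1, (L - n^-1); split=> //; first by lra.
move=> x; rewrite in_itv/= negb_and -!ltNge => /orP[xl|xr].
  have nx : n * x < 1 by rewrite -nn ltr_pM2l.
  by rewrite /cutoff smoothstep_le0 ?smoothstep_ge1; [ring|lra..].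
have nx : n * (L - x) < 1 by rewrite -nn ltr_pM2l//; lra.
rewrite /cutoff [X in _ + X - 1]smoothstep_le0 ?smoothstep_ge1; [ring|lra..].
Qed.

End Cutoff.

(** * Integration by parts of weak derivatives against functions without compact support *)

Section WeakIntegrationByParts.
Variable R : realType.
Local Notation mu := (@lebesgue_measure R).
Variable L : R.
Hypothesis L0 : 0 < L.
Local Notation I := (`]0, L[%classic : set R).
Implicit Types (f g h phi w : R -> R) (x : R).

Lemma continuous_bounded_cc h : continuous h ->
  exists S, forall x, 0 <= x -> x <= L -> `|h x| <= S.
Proof.
move=> ch; have cn : {within `[0, L], continuous (fun x => `|h x|)}.
  by apply: continuous_subspaceT => x; apply: cvg_norm; exact: ch.
have [c _ cmax] := EVT_max (ltW L0) cn.
by exists `|h c| => x x0 xL; apply: cmax; rewrite in_itv/= x0 xL.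
Qed.

Lemma integrable_measurable f : integrable_on L f -> measurable_fun I f.
Proof. by move=> /integrableP[/measurable_EFinP]. Qed.

Lemma continuous_measurable_on h : continuous h -> measurable_fun I h.
Proof. by move=> /(@continuous_integrable_on _ L)/integrable_measurable. Qed.

Lemma integrable_onM f h : integrable_on L f -> continuous h ->
  integrable_on L (fun x => f x * h x).
Proof.
move=> intf ch; have [S hS] := continuous_bounded_cc ch.
have := @integrableMl _ _ R mu I _ _ h intf.
apply => //; first exact: continuous_measurable_on.
exists S; split; first exact: num_real.
move=> M SM x /=; rewrite in_itv/= => /andP[/ltW x0 /ltW xL].
exact: le_trans (hS x x0 xL) (ltW SM).
Qed.

Lemma integrable_onD f g : integrable_on L f -> integrable_on L g ->
  integrable_on L (fun x => f x + g x).
Proof. by move=> intf intg; exact: (integrableD _ intf intg). Qed.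

Lemma Rintegral_cvg (F : nat -> R -> R) f g :
  (forall n, measurable_fun I (F n)) -> integrable_on L f -> integrable_on L g ->
  (forall n x, I x -> `|F n x| <= g x) ->
  (forall x, I x -> \forall n \near \oo, F n x = f x) ->
  (\int[mu]_(x in I) F n x) @[n --> \oo] --> \int[mu]_(x in I) f x.
Proof.
move=> mF intf intg Fg Ff.
have mI : measurable I by [].
have intF n : integrable_on L (F n).
  apply: le_integrable intg => //.
  apply/measurable_EFinP; exact: mF.
  move=> x Ix /=; rewrite lee_fin; apply: (le_trans (Fg n x Ix)).
  exact: ler_norm.
have [_ _ cv] := @dominated_convergence _ _ R mu I mI (fun n x => (F n x)%:E)
  (EFin \o f) (EFin \o g)
  (fun n => iffRL (measurable_EFinP _ _) (mF n))
  (iffRL (measurable_EFinP _ _) (integrable_measurable intf))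
  ltac:(by apply: aeW => x Ix; apply: cvg_near_cst; apply: filterS (Ff x Ix) => n /= ->)
  intg ltac:(by apply: aeW => x n Ix; rewrite /= lee_fin; exact: Fg).
apply: fine_cvg; rewrite fineK; last exact: integrable_fin_num.
exact: cv.
Qed.

Lemma near_inv_le (e : R) (c : R) : 0 < e -> 0 <= c ->
  \forall n \near \oo, c / n.+1%:R <= e.
Proof.
move=> e0 c0; exists (Num.bound (c / e)) => // n /= bn.
rewrite ler_pdivrMr ?ltr0n// mulrC -ler_pdivrMr//.
apply: (le_trans (ltW (archi_boundP (divr_ge0 c0 (ltW e0))))).
by rewrite ler_nat (leq_trans bn).
Qed.

Lemma cutoff_near x : I x ->
  \forall n \near \oo, cutoff L n.+1%:R x = 1 /\ dcutoff L n.+1%:R x = 0.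
Proof.
rewrite /= in_itv/= => /andP[x0 xL]; have x1 : 0 < L - x by rewrite subr_gt0.
have h1 := near_inv_le x0 (ler0n R 2); have h2 := near_inv_le x1 (ler0n R 2).
near=> n; apply: cutoff_inside; first by rewrite ltr0n.
  by near: n; exact: h1.
by near: n; exact: h2.
Unshelve. all: by end_near. Qed.

Lemma continuous_cutoff n : continuous (cutoff L n).
Proof. by move=> x; exact: is_derive_continuous (is_derive_cutoff L n x). Qed.

Lemma cvg_cutoff f phi : integrable_on L f -> continuous phi ->
  (\int[mu]_(x in I) (f x * (phi x * cutoff L n.+1%:R x))) @[n --> \oo]
   --> \int[mu]_(x in I) (f x * phi x).
Proof.
move=> intf cphi; have intfp := integrable_onM intf cphi.
apply: (@Rintegral_cvg _ _ (fun x => `|f x * phi x|)) => //.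
- move=> n; apply: integrable_measurable; apply: integrable_onM => // x.
  by apply: cvgM; [exact: cphi|exact: continuous_cutoff].
- exact: (integrable_norm intfp).
- move=> n x Ix; rewrite mulrA normrM ler_piMr//; exact: cutoff_norm_le1.
- move=> x Ix; apply: filterS (cutoff_near Ix) => n [-> _]; by rewrite mulr1.
Qed.

(** The product of [phi] and the cutoff is a test function. Dominated convergence settles the terms
    that carry the cutoff itself, so the remaining one, with its derivative, has a limit: this is
    the boundary term, up to sign. *)
Lemma cvg_dcutoff f g phi phi' : integrable_on L f -> integrable_on L g ->
  weak_derivative_real L f g ->
  (forall x, is_derive x (1 : R) phi (phi' x)) -> continuous phi' ->
  (\int[mu]_(x in I) (f x * (phi x * dcutoff L n.+1%:R x))) @[n --> \oo]
   --> - (\int[mu]_(x in I) (g x * phi x)) - \int[mu]_(x in I) (f x * phi' x).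
Proof.
move=> intf intg wfg dphi cphi'.
have cphi : continuous phi by move=> x; exact: is_derive_continuous (dphi x).
have c1 := cvg_cutoff intg cphi; have c2 := cvg_cutoff intf cphi'.
pose a n := \int[mu]_(x in I) (g x * (phi x * cutoff L n.+1%:R x)).
pose b n := \int[mu]_(x in I) (f x * (phi' x * cutoff L n.+1%:R x)).
have c3 : (- a n - b n) @[n --> \oo]
   --> - (\int[mu]_(x in I) (g x * phi x)) - \int[mu]_(x in I) (f x * phi' x).

  apply: (@cvgB _ _ _ \oo _ (fun n => - a n) b _ _ _ c2).
  exact: (@cvgN _ _ _ \oo _ a _ c1).
apply: (cvg_trans _ c3); apply: near_eq_cvg.
have hL := near_inv_le L0 (ler0n R 3); near=> n.
have n0 : (0 : R) < n.+1%:R by rewrite ltr0n.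
have nL : 3 / n.+1%:R <= L by near: n; exact: hL.
have [tst dE] := is_test_cutoff n0 nL dphi cphi'.
have := wfg _ tst => E.
rewrite -E -RintegralB//.
- apply: eq_Rintegral => x _; rewrite dE; ring.
- have -> : derive1 (fun x => phi x * cutoff L n.+1%:R x) = (fun x =>
      phi' x * cutoff L n.+1%:R x + phi x * dcutoff L n.+1%:R x) by exact/funext.
  apply: integrable_onM => // x; apply: cvgD; apply: cvgM;
    [exact: cphi'|exact: continuous_cutoff|exact: cphi|exact: continuous_dcutoff].
- apply: integrable_onM => // x; apply: cvgM;
    [exact: cphi'|exact: continuous_cutoff].
Unshelve. all: by end_near. Qed.

(** Near each end [phi] is of the order of the distance to it, which compensates the height [2 n] of
    the bumps: the boundary term is dominated by [8 S |f|] and tends to 0. This form serves for u'',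
    of which no trace is given. *)
Lemma weak_ibp0 f g phi phi' : integrable_on L f -> integrable_on L g ->
  weak_derivative_real L f g ->
  (forall x, is_derive x (1 : R) phi (phi' x)) -> continuous phi' ->
  phi 0 = 0 -> phi L = 0 ->
  \int[mu]_(x in I) (f x * phi' x) = - \int[mu]_(x in I) (g x * phi x).
Proof.
move=> intf intg wfg dphi cphi' phi0 phiL.
have cphi : continuous phi by move=> x; exact: is_derive_continuous (dphi x).
have lim := cvg_dcutoff intf intg wfg dphi cphi'.
have [S phiS] := continuous_bounded_cc cphi'.
have S0 : 0 <= S := le_trans (normr_ge0 _) (phiS 0 (lexx 0) (ltW L0)).
have b0 x : 0 <= x -> x <= L -> `|phi x| <= S * x.
  move=> x0 xL; have := @MVT_bound R phi phi' S x dphi x0.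
  by rewrite phi0 subr0; apply => t t0 tx; apply: phiS => //; exact: le_trans xL.
have bL x : 0 <= x -> x <= L -> `|phi x| <= S * (L - x).
  move=> x0 xL.
  have [|t] := @MVT_segment R phi phi' x L xL (fun t _ => dphi t).
    exact: continuous_subspaceT.
  rewrite in_itv/= phiL sub0r => /andP[t0 tx] E.
  rewrite -normrN E normrM [`|L - x|]ger0_norm ?subr_ge0//.
  by rewrite ler_wpM2r ?subr_ge0// phiS// (le_trans x0).
have lim0 : (\int[mu]_(x in I) (f x * (phi x * dcutoff L n.+1%:R x))) @[n --> \oo]
    --> \int[mu]_(x in I) (cst 0 x : R).
  apply: (@Rintegral_cvg _ _ (fun x => `|f x| * (8 * S))).
  - move=> n; apply: integrable_measurable; apply: integrable_onM => // x.
    by apply: cvgM; [exact: cphi|exact: continuous_dcutoff].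
  - by apply: (@continuous_integrable_on _ L (cst 0)) => x; exact: cvg_cst.
  - apply: (@integrable_onM (fun x => `|f x|) (fun=> 8 * S)).
      exact: (integrable_norm intf).
    by move=> x; exact: cvg_cst.
  - move=> n x; rewrite /= in_itv/= => /andP[/ltW x0 /ltW xL].
    rewrite normrM ler_wpM2l// /dcutoff mulrBr.
    have n0 : (0 : R) < n.+1%:R by rewrite ltr0n.
    (* [y] is the distance to an end; on the support of the bump [y < 2 / n], so [S y] times the
       height [2 n] is at most [4 S]. *)
    have key (y s : R) : 0 <= y -> `|phi x| <= S * y ->
        `|phi x * (n.+1%:R * dsmoothstep (n.+1%:R * y - 1))| <= 4 * S.
      move=> y0 px; rewrite normrM.
      have [->|nz] := eqVneq (n.+1%:R * dsmoothstep (n.+1%:R * y - 1)) 0.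
        by rewrite normr0 mulr0 mulr_ge0.
      have /andP[_ y2] := kernell_support n0 nz.
      have /andP[k0 k2] := @kernel_le R n.+1%:R (n.+1%:R * y - 1) n0.
      rewrite (ger0_norm k0) (le_trans (ler_pM (normr_ge0 _) k0 px k2))//.
      rewrite ltr_pdivlMr// in y2.
      rewrite [leLHS](_ : _ = 2 * S * (y * n.+1%:R)); last by ring.
      rewrite [leRHS](_ : _ = 2 * S * 2); last by ring.
      by rewrite ler_wpM2l ?mulr_ge0// ltW.
    apply: (le_trans (ler_normB _ _)); rewrite (_ : 8 * S = 4 * S + 4 * S); last by ring.
    by apply: lerD; apply: key; rewrite ?subr_ge0// ?b0 ?bL.
  - move=> x Ix; apply: filterS (cutoff_near Ix) => n [_ ->].
    by rewrite !mulr0.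
have E : - (\int[mu]_(x in I) (g x * phi x)) - \int[mu]_(x in I) (f x * phi' x)
    = \int[mu]_(x in I) (cst 0 x : R).
  exact: (cvg_unique (@Rhausdorff R) lim lim0).
by move: E; rewrite Rintegral_cst// mul0r => /eqP; rewrite subr_eq0 => /eqP.
Qed.

(** The point [c] may be an end of the interval, as in both uses: the kernels have their whole mass
    inside, but only from some [n] on, when they fit in the interval. *)
Lemma approximate_identity (K : nat -> R -> R) h (c : R) :
  0 <= c -> c <= L ->
  (forall n, continuous (K n)) -> (forall n x, 0 <= K n x) ->
  (forall n x, K n x != 0 -> `|x - c| < 2 / n.+1%:R) ->
  (\forall n \near \oo, \int[mu]_(x in I) K n x = 1) ->
  continuous h ->
  (\int[mu]_(x in I) (h x * K n x)) @[n --> \oo] --> h c.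
Proof.
move=> c0 cL cK K0 Ksupp K1 ch; apply/cvgrPdist_le => e e0.
have /cvgrPdist_le /(_ e e0) := ch c.
rewrite near_simpl => /nbhs_ballP[d /= d0 dh].
have hd := near_inv_le (divr_gt0 d0 (ltr0n R 2)) (ler0n R 2).
near=> n; have n1 : \int[mu]_(x in I) K n x = 1 by near: n.
have iK : integrable_on L (K n) by exact: continuous_integrable_on.
have ihK : integrable_on L (fun x => h x * K n x).
  apply: (@continuous_integrable_on _ L (fun x => h x * K n x)) => x.
  by apply: cvgM; [exact: ch|exact: cK].
have icK : integrable_on L (fun x => h c * K n x).
  apply: (@continuous_integrable_on _ L (fun x => h c * K n x)) => x.
  by apply: cvgM; [exact: cvg_cst|exact: cK].
have ieK : integrable_on L (fun x => e * K n x).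
  apply: (@continuous_integrable_on _ L (fun x => e * K n x)) => x.
  by apply: cvgM; [exact: cvg_cst|exact: cK].
have -> : h c - \int[mu]_(x in I) (h x * K n x)
   = \int[mu]_(x in I) (h c * K n x - h x * K n x).
  by rewrite RintegralB// RintegralZl// n1 mulr1.
have idK : integrable_on L (fun x => h c * K n x - h x * K n x).
  exact: (integrableB _ icK ihK).
apply: (le_trans (le_normr_Rintegral _ idK)) => //.
have -> : e = \int[mu]_(x in I) (e * K n x) by rewrite RintegralZl// n1 mulr1.
apply: le_Rintegral => //; first exact: (integrable_norm idK).
move=> x Ix; rewrite -mulrBl normrM (ger0_norm (K0 n x)).
have [->|nz] := eqVneq (K n x) 0; first by rewrite !mulr0.
rewrite ler_wpM2r//; apply: dh; rewrite /ball/= distrC.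
apply: (lt_le_trans (Ksupp n x nz)).
apply: (@le_trans _ _ (d / 2)); first by near: n; exact: hd.
by rewrite ler_pdivrMr// ler_pMr// ler1n.
Unshelve. all: by end_near. Qed.

Lemma Rintegral_derivative (u u' : R -> R) :
  (forall x, is_derive x (1 : R) u (u' x)) -> continuous u' ->
  \int[mu]_(x in I) u' x = u L - u 0.
Proof.
move=> du cu'; have cu : continuous u by move=> x; exact: is_derive_continuous (du x).
have iu := @continuous_integrable_on _ L u' cu'.
rewrite (@Rintegral_itv_bndo_bndc _ (BRight 0) L u' iu).
rewrite Rintegral_itv_obnd_cbnd; last first.
  apply: (integrableS _ _ _ (@continuous_integrable_cc _ 0 L u' cu')) => //.
  exact: subset_itv_oc_cc.
rewrite /Rintegral (@continuous_FTC2 _ _ u) //.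
- exact: continuous_subspaceT.
- split=> [x _||].
  + by have [] := du x.
  + by apply: cvg_at_right_filter; exact: cu.
  + by apply: cvg_at_left_filter; exact: cu.
- by move=> x _; rewrite derive1E; have [_ ->] := du x.
Qed.

(** Under the integral [f] may be replaced by its continuous representative [w], and the two bumps
    of the derivative of the cutoff are approximate identities at 0 and at [L]. *)
Lemma weak_ibp_trace f g w phi phi' : integrable_on L f -> integrable_on L g ->
  weak_derivative_real L f g -> continuous w -> {ae mu, forall x, I x -> w x = f x} ->
  (forall x, is_derive x (1 : R) phi (phi' x)) -> continuous phi' ->
  \int[mu]_(x in I) (f x * phi' x)
    = w L * phi L - w 0 * phi 0 - \int[mu]_(x in I) (g x * phi x).
Proof.
move=> intf intg wfg cw wf dphi cphi'.
have cphi : continuous phi by move=> x; exact: is_derive_continuous (dphi x).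
have lim := cvg_dcutoff intf intg wfg dphi cphi'.
have cwp : continuous (fun x => w x * phi x).
  by move=> x; apply: cvgM; [exact: cw|exact: cphi].
have h3 := near_inv_le L0 (ler0n R 3).
have n0 n : (0 : R) < n.+1%:R by rewrite ltr0n.
have big n : 3 / n.+1%:R <= L -> 2 <= n.+1%:R * L - 1.
  by rewrite ler_pdivrMr// mulrC; lra.
have lim1 : (\int[mu]_(x in I) (w x * phi x * (n.+1%:R * dsmoothstep (n.+1%:R * x - 1))))
    @[n --> \oo] --> w 0 * phi 0.
  apply: (@approximate_identity
    (fun n x => n.+1%:R * dsmoothstep (n.+1%:R * x - 1)) _ 0) => //.
  - exact: ltW.
  - by move=> n; exact: continuous_kernell.
  - by move=> n x; have /andP[] := @kernel_le R n.+1%:R (n.+1%:R * x - 1) (n0 n).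
  - move=> n x /(kernell_support (n0 n)) /andP[x0 x2].
    by rewrite subr0 gtr0_norm.
  - near=> n; rewrite (Rintegral_derivative (is_derive_smoothstepl n.+1%:R)).
      have nL : 3 / n.+1%:R <= L by near: n; exact: h3.
      have -> : smoothstep (n.+1%:R * L - 1) = 1.
        by apply: smoothstep_ge1; apply: le_trans (big n nL); rewrite ler1n.
      have -> : smoothstep (n.+1%:R * 0 - 1) = 0 :> R.
        by apply: smoothstep_le0; rewrite mulr0 sub0r lerN10.
      by rewrite subr0.
    exact: continuous_kernell.
have lim2 : (\int[mu]_(x in I) (w x * phi x * (n.+1%:R * dsmoothstep (n.+1%:R * (L - x) - 1))))
    @[n --> \oo] --> w L * phi L.
  apply: (@approximate_identity
    (fun n x => n.+1%:R * dsmoothstep (n.+1%:R * (L - x) - 1)) _ L) => //.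
  - exact: ltW.
  - by move=> n; exact: continuous_kernelr.
  - by move=> n x; have /andP[] := @kernel_le R n.+1%:R (n.+1%:R * (L - x) - 1) (n0 n).
  - move=> n x /(kernelr_support (n0 n)) /andP[x0 x2].
    by rewrite distrC gtr0_norm.
  - near=> n.
    have -> : \int[mu]_(x in I) (n.+1%:R * dsmoothstep (n.+1%:R * (L - x) - 1))
       = - \int[mu]_(x in I) (- (n.+1%:R * dsmoothstep (n.+1%:R * (L - x) - 1))).
      have ik : integrable_on L (fun x => n.+1%:R * dsmoothstep (n.+1%:R * (L - x) - 1)).
        by apply: continuous_integrable_on; exact: continuous_kernelr.
      have := @RintegralZl _ _ R mu I _ (-1) _ ik.
      under eq_Rintegral do rewrite mulN1r.
      by move=> ->//; rewrite mulN1r opprK.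
    rewrite (Rintegral_derivative (is_derive_smoothstepr L n.+1%:R)).
      have nL : 3 / n.+1%:R <= L by near: n; exact: h3.
      have -> : smoothstep (n.+1%:R * (L - 0) - 1) = 1.
        by rewrite subr0; apply: smoothstep_ge1; apply: le_trans (big n nL); rewrite ler1n.
      have -> : smoothstep (n.+1%:R * (L - L) - 1) = 0.
        by apply: smoothstep_le0; rewrite subrr mulr0 sub0r lerN10.
      by rewrite sub0r opprK.
    by move=> x; apply: cvgN; exact: continuous_kernelr.
have lim3 : (\int[mu]_(x in I) (w x * phi x * (n.+1%:R * dsmoothstep (n.+1%:R * x - 1)))
    - \int[mu]_(x in I) (w x * phi x * (n.+1%:R * dsmoothstep (n.+1%:R * (L - x) - 1))))
    @[n --> \oo] --> w 0 * phi 0 - w L * phi L.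
  exact: (cvgB lim1 lim2).
have lim4 : (\int[mu]_(x in I) (f x * (phi x * dcutoff L n.+1%:R x))) @[n --> \oo]
   --> w 0 * phi 0 - w L * phi L.
  apply: (cvg_trans _ lim3); apply: near_eq_cvg; apply: nearW => n.
  rewrite -RintegralB//; last 2 first.
  - apply: (@continuous_integrable_on _ L
      (fun x => w x * phi x * (n.+1%:R * dsmoothstep (n.+1%:R * x - 1)))) => x.
    by apply: cvgM; [exact: cwp|exact: continuous_kernell].
  - apply: (@continuous_integrable_on _ L
      (fun x => w x * phi x * (n.+1%:R * dsmoothstep (n.+1%:R * (L - x) - 1)))) => x.
    by apply: cvgM; [exact: cwp|exact: continuous_kernelr].
  (* The only place where the representative replaces [f], almost everywhere. *)
  rewrite /Rintegral; congr fine; apply: ae_eq_integral => //.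
  - apply/measurable_EFinP; apply: continuous_measurable_on => x.
    by apply: cvgB; apply: cvgM;
      [exact: cwp|exact: continuous_kernell|exact: cwp|exact: continuous_kernelr].
  - apply/measurable_EFinP; apply: integrable_measurable; apply: integrable_onM => // x.
    by apply: cvgM; [exact: cphi|exact: continuous_dcutoff].
  - move: wf; apply: filterS; first exact: (ae_filter_ringOfSetsType mu).
    move=> x wfx Ix; congr EFin; rewrite -(wfx Ix) /dcutoff; ring.
have E : - (\int[mu]_(x in I) (g x * phi x)) - \int[mu]_(x in I) (f x * phi' x)
    = w 0 * phi 0 - w L * phi L.
  exact: (cvg_unique (@Rhausdorff R) lim lim4).
have -> : \int[mu]_(x in I) (f x * phi' x) = - (\int[mu]_(x in I) (g x * phi x))
  - (- (\int[mu]_(x in I) (g x * phi x)) - \int[mu]_(x in I) (f x * phi' x)) by ring.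
by rewrite E; ring.
Unshelve. all: by end_near. Qed.

End WeakIntegrationByParts.

(** * Boundary values given by continuous representatives *)

Section Traces.
Variable R : realType.
Local Notation mu := (@lebesgue_measure R).
Variable L : R.
Hypothesis L0 : 0 < L.
Local Notation I := (`]0, L[%classic : set R).
Implicit Types (f g w phi : R -> R).

(** Extends [w] by the constants [w 0] and [w L], turning continuity on the segment into continuity
    on the line, which the approximate identities are stated with. *)
Lemma continuous_clamp w : {within `[0, L], continuous w} ->
  continuous (fun x => w (Num.max 0 (Num.min x L))).
Proof.
move=> /subspace_continuousP cw x; pose c (t : R) := Num.max 0 (Num.min t L).
have cA t : `[0, L]%classic (c t).
  by rewrite /= in_itv/= le_max lexx/= ge_max (ltW L0)/= ge_min lexx orbT.
have cc : {for x, continuous c}.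
  apply: (@continuous_max _ _ (fun=> 0) (fun t => Num.min t L)).
    exact: cvg_cst.
  by apply: (@continuous_min _ _ id (fun=> L)); [exact: cvg_id|exact: cvg_cst].
move=> P /= /(cw (c x) (cA x)); rewrite /within/= => /cc.
move=> h; have {}h : nbhs x (fun t => c t \in `[0, L] -> P (w (c t))) := h.
suff : nbhs x (fun t => P (w (c t))) by [].
by apply: (filterS _ h) => t; apply; exact: cA.
Qed.

Lemma clampE x : 0 <= x -> x <= L -> Num.max 0 (Num.min x L) = x.
Proof. by move=> x0 xL; rewrite min_l// max_r. Qed.

Definition real_trace f x z : Prop := exists w,
  [/\ continuous w, {ae mu, forall t, I t -> w t = f t} & w x = z].

Lemma real_trace_within f w x : {within `[0, L], continuous w} ->
  {ae mu, forall t, I t -> w t = f t} -> 0 <= x -> x <= L -> real_trace f x (w x).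
Proof.
move=> cw wf x0 xL; exists (fun x => w (Num.max 0 (Num.min x L))); split.
- exact: continuous_clamp.
- move: wf; apply: filterS => [|t wft It].
    exact: (ae_filter_ringOfSetsType mu).
  move: (It); rewrite /= in_itv/= => /andP[/ltW t0 /ltW tL].
  by rewrite clampE// wft.
- by rewrite clampE.
Qed.

(** Each trace comes with its own representative. Instead of identifying the two, [phi] is split
    into [phi x / L] and [phi (1 - x / L)], which vanish at 0 and at [L] respectively, so that each
    part sees a single trace. *)
Lemma weak_ibp_traces f g phi phi' (z0 zL : R) :
  integrable_on L f -> integrable_on L g -> weak_derivative_real L f g ->
  real_trace f 0 z0 -> real_trace f L zL ->
  (forall x, is_derive x (1 : R) phi (phi' x)) -> continuous phi' ->
  \int[mu]_(x in I) (f x * phi' x)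
    = zL * phi L - z0 * phi 0 - \int[mu]_(x in I) (g x * phi x).
Proof.
move=> intf intg wfg [v [cv vf <-]] [w [cw wf <-]] dphi cphi'.
have cphi : continuous phi by move=> x; exact: is_derive_continuous (dphi x).
pose a (x : R) := x / L; pose b (x : R) := 1 - x / L.
have da x : is_derive x (1 : R) a L^-1.
  rewrite -[L^-1]mulr1 (_ : a = L^-1 \*: id).
    exact: is_deriveZ.
  by apply/funext => t; rewrite /a/= mulrC.
have db x : is_derive x (1 : R) b (- L^-1).
  rewrite (_ : b = cst 1 - a); last by apply/funext.
  by apply: is_derive_eq; rewrite sub0r.
have ca : continuous a by move=> x; exact: is_derive_continuous (da x).
have cb : continuous b by move=> x; exact: is_derive_continuous (db x).
have dpa x : is_derive x (1 : R) (fun t => phi t * a t) (phi x * L^-1 + a x * phi' x).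
  exact: is_deriveM.
have dpb x : is_derive x (1 : R) (fun t => phi t * b t) (phi x * - L^-1 + b x * phi' x).
  exact: is_deriveM.
have cpa : continuous (fun x => phi x * L^-1 + a x * phi' x).
  move=> x; apply: cvgD; apply: cvgM;
    [exact: cphi|exact: cvg_cst|exact: ca|exact: cphi'].
have cpb : continuous (fun x => phi x * - L^-1 + b x * phi' x).
  move=> x; apply: cvgD; apply: cvgM;
    [exact: cphi|exact: cvg_cst|exact: cb|exact: cphi'].
have Ea := weak_ibp_trace L0 intf intg wfg cw wf dpa cpa.
have Eb := weak_ibp_trace L0 intf intg wfg cv vf dpb cpb.
have LL : L / L = 1 by rewrite divff// gt_eqF.
move: Ea Eb; rewrite /a /b mul0r subr0 LL subrr !mulr0 !mulr1 !subr0 !sub0r => Ea Eb.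
have ia : integrable_on L (fun x => f x * (phi x * L^-1 + a x * phi' x)).
  exact: integrable_onM.
have ib : integrable_on L (fun x => f x * (phi x * - L^-1 + b x * phi' x)).
  exact: integrable_onM.
have iga : integrable_on L (fun x => g x * (phi x * a x)).
  by apply: integrable_onM => // x; apply: cvgM; [exact: cphi|exact: ca].
have igb : integrable_on L (fun x => g x * (phi x * b x)).
  by apply: integrable_onM => // x; apply: cvgM; [exact: cphi|exact: cb].
rewrite [LHS](_ : _ = \int[mu]_(x in I) (f x * (phi x * L^-1 + a x * phi' x)
   + f x * (phi x * - L^-1 + b x * phi' x))); last first.
  by apply: eq_Rintegral => x _; rewrite /a /b; ring.
rewrite [X in _ - X](_ : _ = \int[mu]_(x in I) (g x * (phi x * a x)
   + g x * (phi x * b x))); last first.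
  by apply: eq_Rintegral => x _; rewrite /a /b; ring.
by rewrite !RintegralD// Ea Eb /a /b; ring.
Qed.

End Traces.

(** * Integrals and integration by parts for complex-valued functions *)

Section ComplexIntegration.
Variable R : realType.
Local Notation C := R[i].
Local Notation mu := (@lebesgue_measure R).
Local Notation normc := (@ComplexField.Normc.normc R).
Local Notation Re := (@complex.Re R).
Local Notation Im := (@complex.Im R).
Variable L : R.
Hypothesis L0 : 0 < L.
Local Notation I := (`]0, L[%classic : set R).
Implicit Types (f g h : R -> C) (c z : C) (x : R).

Definition cintegrable f : Prop :=
  integrable_on L (fun x => Re (f x)) /\ integrable_on L (fun x => Im (f x)).

Definition cintegral f : C :=
  (\int[mu]_(x in I) Re (f x)) +i* (\int[mu]_(x in I) Im (f x)).

Lemma ReN z : Re (- z) = - Re z. Proof. by case: z. Qed.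

Lemma ImN z : Im (- z) = - Im z. Proof. by case: z. Qed.

Lemma integrable_onB (f g : R -> R) : integrable_on L f -> integrable_on L g ->
  integrable_on L (fun x => f x - g x).
Proof. by move=> intf intg; exact: (integrableB _ intf intg). Qed.

Lemma eq_cintegral f g : (forall x, f x = g x) -> cintegral f = cintegral g.
Proof. by move=> fg; congr cintegral; exact/funext. Qed.

Lemma cintegrableD f g : cintegrable f -> cintegrable g ->
  cintegrable (fun x => f x + g x).
Proof.
move=> [f1 f2] [g1 g2]; split.
- by under eq_fun do rewrite ReD; exact: integrable_onD.
- by under eq_fun do rewrite ImD; exact: integrable_onD.
Qed.

Lemma cintegrableN f : cintegrable f -> cintegrable (fun x => - f x).
Proof.
move=> [f1 f2]; split.
- by under eq_fun do rewrite ReN; exact: (integrableN f1).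
- by under eq_fun do rewrite ImN; exact: (integrableN f2).
Qed.

Lemma cintegrableM f h : cintegrable f -> ccontinuous h ->
  cintegrable (fun x => f x * h x).
Proof.
move=> [f1 f2] [h1 h2]; split.
- by under eq_fun do rewrite ReM; apply: integrable_onB; exact: integrable_onM.
- by under eq_fun do rewrite ImM; apply: integrable_onD; exact: integrable_onM.
Qed.

Lemma cintegralD f g : cintegrable f -> cintegrable g ->
  cintegral (fun x => f x + g x) = cintegral f + cintegral g.
Proof.
move=> [f1 f2] [g1 g2]; apply/eqP; rewrite eq_complex ReD ImD /cintegral /= -!RintegralD//.
by apply/andP; split; apply/eqP; apply: eq_Rintegral => x _; rewrite ?ReD ?ImD.
Qed.

Lemma cintegralN f : cintegrable f ->
  cintegral (fun x => - f x) = - cintegral f.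
Proof.
move=> fi; have := cintegralD fi (cintegrableN fi).
under eq_cintegral do rewrite subrr.
rewrite {1}/cintegral /= Rintegral_cst// mul0r => /esym/eqP.
by rewrite addrC addr_eq0 => /eqP.
Qed.

Lemma normc_cintegral_le f (b : R -> R) : cintegrable f -> integrable_on L b ->
  (forall x, I x -> normc (f x) <= b x) ->
  normc (cintegral f) <= 2 * \int[mu]_(x in I) b x.
Proof.
move=> [f1 f2] ib fb; apply: (le_trans (normc_le_ReIm _)) => /=.
have key (u : R -> R) : integrable_on L u -> (forall x, I x -> `|u x| <= b x) ->
    `|\int[mu]_(x in I) u x| <= \int[mu]_(x in I) b x.
  move=> iu ub; apply: (le_trans (le_normr_Rintegral _ iu)) => //.
  by apply: le_Rintegral => //; exact: (integrable_norm iu).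
rewrite mulr2n mulrDl mul1r; apply: lerD; apply: key => // x Ix.
- exact: le_trans (normr_Re_le _) (fb x Ix).
- exact: le_trans (normr_Im_le _) (fb x Ix).
Qed.

Lemma ae_eq_cintegral f g : cintegrable f -> cintegrable g ->
  {ae mu, forall x, I x -> f x = g x} -> cintegral f = cintegral g.
Proof.
move=> [f1 f2] [g1 g2] fg; rewrite /cintegral /Rintegral.
congr (fine _ +i* fine _); apply: ae_eq_integral => //.
- by apply/measurable_EFinP; exact: integrable_measurable f1.
- by apply/measurable_EFinP; exact: integrable_measurable g1.
- by move: fg; apply: filterS => [|x fgx Ix];
    [exact: (ae_filter_ringOfSetsType mu)|rewrite fgx].
- by apply/measurable_EFinP; exact: integrable_measurable f2.
- by apply/measurable_EFinP; exact: integrable_measurable g2.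
- by move: fg; apply: filterS => [|x fgx Ix];
    [exact: (ae_filter_ringOfSetsType mu)|rewrite fgx].
Qed.

Lemma cintegral_ReE f g : cintegral (fun x => f x * g x) =
  (\int[mu]_(x in I) (Re (f x) * Re (g x) - Im (f x) * Im (g x))) +i*
  (\int[mu]_(x in I) (Re (f x) * Im (g x) + Im (f x) * Re (g x))).
Proof.
by rewrite /cintegral; congr (_ +i* _); apply: eq_Rintegral => x _; rewrite ?ReM ?ImM.
Qed.

Lemma cweak_ibp0 u v f f' : cintegrable u -> cintegrable v ->
  weak_derivative L u v -> cderiv f f' -> ccontinuous f' -> f 0 = 0 -> f L = 0 ->
  cintegral (fun x => u x * f' x) = - cintegral (fun x => v x * f x).
Proof.
move=> [u1 u2] [v1 v2] [w1 w2] df [c1 c2] f0 fL.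
have [cf1 cf2] := cderiv_continuous df.
have d1 x := (df x).1; have d2 x := (df x).2.
rewrite !cintegral_ReE !RintegralB ?RintegralD//; try exact: integrable_onM.
rewrite !(weak_ibp0 L0 _ _ w1 d1 c1)// ?f0 ?fL// !(weak_ibp0 L0 _ _ w1 d2 c2)// ?f0 ?fL//.
rewrite !(weak_ibp0 L0 _ _ w2 d1 c1)// ?f0 ?fL// !(weak_ibp0 L0 _ _ w2 d2 c2)// ?f0 ?fL//.
by apply/eqP; rewrite eq_complex /=; apply/andP; split; apply/eqP; ring.
Qed.

Lemma has_trace_real u x z : 0 <= x -> x <= L -> has_trace L u x z ->
  real_trace L (fun t => Re (u t)) x (Re z) /\
  real_trace L (fun t => Im (u t)) x (Im z).
Proof.
move=> x0 xL [w [w1 w2 wu <-]].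
split; apply: (@real_trace_within R L L0 _ (fun t => _ (w t))) => //;
  by move: wu; apply: filterS => [|t wut It];
    [exact: (ae_filter_ringOfSetsType mu)|rewrite wut].
Qed.

Lemma cweak_ibp_traces u v f f' z0 zL : cintegrable u -> cintegrable v ->
  weak_derivative L u v -> has_trace L u 0 z0 -> has_trace L u L zL ->
  cderiv f f' -> ccontinuous f' ->
  cintegral (fun x => u x * f' x)
    = zL * f L - z0 * f 0 - cintegral (fun x => v x * f x).
Proof.
move=> [u1 u2] [v1 v2] [w1 w2] t0 tL df [c1 c2].
have [t01 t02] := has_trace_real (lexx 0) (ltW L0) t0.
have [tL1 tL2] := has_trace_real (ltW L0) (lexx L) tL.
have [cf1 cf2] := cderiv_continuous df.
have d1 x := (df x).1; have d2 x := (df x).2.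
rewrite !cintegral_ReE !RintegralB ?RintegralD//; try exact: integrable_onM.
rewrite !(weak_ibp_traces L0 _ _ w1 t01 tL1 d1 c1)//.
rewrite !(weak_ibp_traces L0 _ _ w1 t01 tL1 d2 c2)//.
rewrite !(weak_ibp_traces L0 _ _ w2 t02 tL2 d1 c1)//.
rewrite !(weak_ibp_traces L0 _ _ w2 t02 tL2 d2 c2)//.
apply/eqP; rewrite eq_complex /= !ReD !ImD !ReN !ImN /= !ReM !ImM.
by apply/andP; split; apply/eqP; rewrite ?ReD ?ImD ?ReN ?ImN ?ReM ?ImM; ring.
Qed.

End ComplexIntegration.

(** * Estimates for square integrable functions *)

Section SquareIntegrable.
Variable R : realType.
Local Notation C := R[i].
Local Notation mu := (@lebesgue_measure R).
Local Notation normc := (@ComplexField.Normc.normc R).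
Local Notation Re := (@complex.Re R).
Local Notation Im := (@complex.Im R).
Variable L : R.
Hypothesis L0 : 0 < L.
Local Notation I := (`]0, L[%classic : set R).
Implicit Types (f g h u : R -> C) (c z : C) (x s : R).

Lemma integrable_on_cst s : integrable_on L (fun=> s).
Proof. by apply: continuous_integrable_on => x; exact: cvg_cst. Qed.

Lemma integrable_onZ s (f : R -> R) : integrable_on L f ->
  integrable_on L (fun x => s * f x).
Proof. by move=> fi; exact: (integrableZl _ s fi). Qed.

Lemma Rintegral_cst_on s : \int[mu]_(x in I) s = s * L.
Proof. by rewrite Rintegral_cst//= lebesgue_measure_itv/= lte_fin L0 oppr0 addr0. Qed.

Lemma le_integrable_on (a b : R -> R) : measurable_fun I a -> integrable_on L b ->
  (forall x, I x -> `|a x| <= b x) -> integrable_on L a.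
Proof.
move=> ma ib ab; apply: le_integrable ib => //; first exact/measurable_EFinP.
move=> x Ix; rewrite lee_fin; exact: le_trans (ab x Ix) (ler_norm _).
Qed.

Lemma measurable_sqr_normc f : measurable_fun I (fun x => Re (f x)) ->
  measurable_fun I (fun x => Im (f x)) ->
  measurable_fun I (fun x => normc (f x) ^+ 2).
Proof.
move=> mR mI; rewrite (_ : (fun x => _) =
    (fun x => Re (f x) ^+ 2 + Im (f x) ^+ 2)); last first.
  by apply/funext => x; exact: sqr_normcE.
by apply: measurable_funD; apply: measurable_funX.
Qed.

Lemma measurable_normc f : measurable_fun I (fun x => Re (f x)) ->
  measurable_fun I (fun x => Im (f x)) -> measurable_fun I (fun x => normc (f x)).
Proof.
move=> mR mI; rewrite (_ : (fun x => _) = Num.sqrt \o (fun x => normc (f x) ^+ 2)).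
  apply: measurableT_comp; last exact: measurable_sqr_normc.
  by apply: continuous_measurable_fun; exact: sqrt_continuous.
by apply/funext => x /=; rewrite sqrtr_sqr ger0_norm// normc_ge0.
Qed.

Lemma is_L2_sqr f : is_L2 L f -> integrable_on L (fun x => normc (f x) ^+ 2).
Proof.
move=> [mR mI fin]; apply/integrableP; split.
  by apply/measurable_EFinP; exact: measurable_sqr_normc.
by under eq_integral do rewrite /= ger0_norm ?sqr_ge0//.
Qed.

Lemma sqr_is_L2 f : measurable_fun I (fun x => Re (f x)) ->
  measurable_fun I (fun x => Im (f x)) ->
  integrable_on L (fun x => normc (f x) ^+ 2) -> is_L2 L f.
Proof.
move=> mR mI /integrableP[_ fin]; split => //.
by move: fin; under eq_integral do rewrite /= ger0_norm ?sqr_ge0//.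
Qed.

Lemma ler_half_sqr (a s : R) : 0 < s -> 0 <= a -> a <= 2^-1 * s^-1 * a ^+ 2 + 2^-1 * s.
Proof.
move=> s0 a0; have := sqr_ge0 (a - s); have := divff (lt0r_neq0 s0).
have : 0 < s^-1 by rewrite invr_gt0.
move: (s^-1) => t t0 st q; have : 0 <= t * (a - s) ^+ 2 by rewrite mulr_ge0// ltW.
have -> : t * (a - s) ^+ 2 = t * a ^+ 2 - 2 * (s * t) * a + (s * t) * s by ring.
by rewrite st; lra.
Qed.

Lemma integrable_sqr_bound f s : is_L2 L f ->
  integrable_on L (fun x => 2^-1 * s^-1 * normc (f x) ^+ 2 + 2^-1 * s).
Proof.
move=> /is_L2_sqr sf; apply: integrable_onD; last exact: integrable_on_cst.
exact: (integrable_onZ (2^-1 * s^-1) sf).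
Qed.

Lemma is_L2_integrable f : is_L2 L f -> integrable_on L (fun x => normc (f x)).
Proof.
move=> f2; have [mR mI _] := f2.
apply: le_integrable_on (measurable_normc mR mI) (integrable_sqr_bound 1 f2) _.
by move=> x _; rewrite ger0_norm ?normc_ge0// ler_half_sqr ?normc_ge0.
Qed.

Lemma is_L2_cintegrable f : is_L2 L f -> cintegrable L f.
Proof.
move=> f2; have [mR mI _] := f2; have fi := is_L2_integrable f2.
by split; apply: le_integrable_on fi _ => // x _; [exact: normr_Re_le|exact: normr_Im_le].
Qed.

(** The inequality [a <= a^2 / (2 s) + s / 2] plays the role of Cauchy-Schwarz; choosing the bound
    [s] itself as weight keeps the result linear in [s]. *)
Lemma L1_le_L2 f s : is_L2 L f -> 0 < s ->
  \int[mu]_(x in I) (normc (f x) ^+ 2) <= s ^+ 2 ->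
  \int[mu]_(x in I) normc (f x) <= 2^-1 * s * (L + 1).
Proof.
move=> f2 s0 fs; apply: (@le_trans _ _ (\int[mu]_(x in I)
    (2^-1 * s^-1 * normc (f x) ^+ 2 + 2^-1 * s))).
  apply: le_Rintegral => //.
  - exact: is_L2_integrable.
  - exact: integrable_sqr_bound.
  - by move=> x _; rewrite ler_half_sqr ?normc_ge0.
rewrite RintegralD//; last 2 first.
- exact: (integrable_onZ (2^-1 * s^-1) (is_L2_sqr f2)).
- exact: integrable_on_cst.
rewrite RintegralZl//; last exact: is_L2_sqr.
rewrite Rintegral_cst_on.
have -> : 2^-1 * s * (L + 1) = 2^-1 * s^-1 * s ^+ 2 + 2^-1 * s * L.
  by field; rewrite gt_eqF.
by rewrite lerD2r ler_wpM2l// mulr_ge0// invr_ge0 ltW.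
Qed.

Lemma normc_mul_le (a b : C) : normc (a * b) <= 2^-1 * (normc a ^+ 2 + normc b ^+ 2).
Proof.
by rewrite ComplexField.Normc.normcM; have := sqr_ge0 (normc a - normc b); nra.
Qed.

Lemma normc_cintegralM_le f h (A B : R) : is_L2 L f -> ccontinuous h ->
  \int[mu]_(x in I) (normc (f x) ^+ 2) <= A ->
  \int[mu]_(x in I) (normc (h x) ^+ 2) <= B ->
  normc (cintegral L (fun x => f x * h x)) <= A + B.
Proof.
move=> f2 ch fA hB; have sf := is_L2_sqr f2.
have sh : integrable_on L (fun x => normc (h x) ^+ 2).
  apply: (@continuous_integrable_on R L (fun x => normc (h x) ^+ 2)) => x.
  by apply: cvgM; exact: continuous_normc.
have fh : cintegrable L (fun x => f x * h x).
  by apply: cintegrableM => //; exact: is_L2_cintegrable.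
have := @normc_cintegral_le R L _ (fun x => 2^-1 * (normc (f x) ^+ 2 + normc (h x) ^+ 2)) fh.
have isum := integrable_onD sf sh.
have -> : A + B = 2 * (2^-1 * (A + B)) by rewrite mulrA divff// mul1r.
move=> /(_ _ _)/le_trans; apply.
- exact: (integrable_onZ 2^-1 isum).
- by move=> x _; exact: normc_mul_le.
by rewrite RintegralZl// RintegralD// ler_wpM2l// ler_wpM2l// lerD.
Qed.

Lemma normc_cintegralM_bound f g (B S : R) : is_L2 L f -> ccontinuous g -> 0 <= S ->
  \int[mu]_(x in I) normc (f x) <= B ->
  (forall x, 0 <= x -> x <= L -> normc (g x) <= S) ->
  normc (cintegral L (fun x => f x * g x)) <= 2 * (B * S).
Proof.
move=> f2 cg S0 fB gS; have fi := is_L2_integrable f2.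
have fg : cintegrable L (fun x => f x * g x).
  by apply: cintegrableM => //; exact: is_L2_cintegrable.
have iS : integrable_on L (fun x => S * normc (f x)) := integrable_onZ S fi.
have fgS x : I x -> normc (f x * g x) <= S * normc (f x).
  rewrite /= in_itv/= => /andP[/ltW x0 /ltW xL].
  by rewrite ComplexField.Normc.normcM mulrC ler_wpM2r ?normc_ge0// gS.
apply: (le_trans (normc_cintegral_le fg iS fgS)).
by rewrite RintegralZl// [B * S]mulrC ler_wpM2l// ler_wpM2l.
Qed.

Lemma is_L2D f g : is_L2 L f -> is_L2 L g -> is_L2 L (fun x => f x + g x).
Proof.
move=> f2 g2; have [fR fI _] := f2; have [gR gI _] := g2.
have mR : measurable_fun I (fun x => Re (f x + g x)).
  rewrite (_ : (fun x => _) = (fun x => Re (f x) + Re (g x))); last first.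
    by apply/funext => x; rewrite ReD.
  by exact: measurable_funD.
have mI : measurable_fun I (fun x => Im (f x + g x)).
  rewrite (_ : (fun x => _) = (fun x => Im (f x) + Im (g x))); last first.
    by apply/funext => x; rewrite ImD.
  by exact: measurable_funD.
apply: sqr_is_L2 => //.
have isum := integrable_onD (is_L2_sqr f2) (is_L2_sqr g2).
apply: le_integrable_on (measurable_sqr_normc mR mI) (integrable_onZ 2 isum) _ => //.
move=> x _ /=; rewrite ger0_norm ?sqr_ge0//.
have := le_normcD (f x) (g x); have := normc_ge0 (f x + g x).
move: (normc _) (normc (f x)) (normc (g x)) => a b c a0 abc.
have : a ^+ 2 <= (b + c) ^+ 2 by rewrite lerXn2r ?nnegrE// (le_trans a0).
by have := sqr_ge0 (b - c); nra.
Qed.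

Lemma is_L2Z c f : is_L2 L f -> is_L2 L (fun x => c * f x).
Proof.
move=> f2; have [fR fI _] := f2.
have mR : measurable_fun I (fun x => Re (c * f x)).
  rewrite (_ : (fun x => _) = (fun x => Re c * Re (f x) - Im c * Im (f x))); last first.
    by apply/funext => x; rewrite ReM.
  by apply: measurable_funB; apply: measurable_funM.
have mI : measurable_fun I (fun x => Im (c * f x)).
  rewrite (_ : (fun x => _) = (fun x => Re c * Im (f x) + Im c * Re (f x))); last first.
    by apply/funext => x; rewrite ImM.
  by apply: measurable_funD; apply: measurable_funM.
apply: sqr_is_L2 => //.
under eq_fun do rewrite ComplexField.Normc.normcM exprMn.
exact: (integrable_onZ (normc c ^+ 2) (is_L2_sqr f2)).
Qed.

End SquareIntegrable.

(** * Green identity and bound on lambda *)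

Section AprioriBounds.
Variable R : realType.
Local Notation C := R[i].
Local Notation mu := (@lebesgue_measure R).
Local Notation normc := (@ComplexField.Normc.normc R).
Local Notation Re := (@complex.Re R).
Local Notation Im := (@complex.Im R).
Variable L : R.
Hypothesis L0 : 0 < L.
Local Notation I := (`]0, L[%classic : set R).
Variables (u u1 u2 u3 : R -> C) (z lambda : C).
Hypotheses (uH3 : is_H3 L u u1 u2 u3).
Hypotheses (tu0 : has_trace L u 0 0) (tuL : has_trace L u L 0).
Hypotheses (tu10 : has_trace L u1 0 z) (tu1L : has_trace L u1 L 0).
Let f x := lambda * u x - u1 x - u3 x.

Lemma ccontinuous_L2 (h : R -> C) : ccontinuous h -> is_L2 L h.
Proof.
move=> ch; have [cR cI] := ch; apply: sqr_is_L2.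
- exact: (@continuous_measurable_on R L (fun x => Re (h x))).
- exact: (@continuous_measurable_on R L (fun x => Im (h x))).
apply: (@continuous_integrable_on R L (fun x => normc (h x) ^+ 2)) => x.
by apply: cvgM; exact: continuous_normc.
Qed.

Lemma cintegral_real (c : C) (r : R -> R) : integrable_on L r ->
  cintegral L (fun x => c * (r x)%:C) = c * (\int[mu]_(x in I) r x)%:C.
Proof.
move=> ir; apply/eqP; rewrite eq_complex ReM ImM /= !mulr0 subr0 add0r.
rewrite -!RintegralZl//; apply/andP; split; apply/eqP; apply: eq_Rintegral => x _.
- by rewrite ReM /= mulr0 subr0.
- by rewrite ImM /= mulr0 add0r.
Qed.

(** With [h] a conjugate of u, [integral_u3] then rewrites the integral of u' [h] in terms of u'''
    and u'(0), which are the controlled quantities. The solution is a double primitive corrected by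
    a linear function. *)
Lemma dirichlet_solution (h : R -> C) (N : R) : ccontinuous h ->
  (forall x, x <= 0 -> h x = 0) -> L <= N -> 1 <= N ->
  \int[mu]_(x in I) normc (h x) <= N ->
  exists k k1 : R -> C, [/\ cderiv k k1, cderiv k1 h, k 0 = 0 /\ k L = 0,
    normc (k1 0) <= 4 * N &
    forall x, 0 <= x -> x <= L -> normc (k x) <= 8 * N ^+ 2].
Proof.
move=> ch h0 LN N1 hN; have [p [dp p0 pb]] := cprimitive ch h0.
have [q [dq q0 _]] := cprimitive (cderiv_continuous dp) p0.
have pN x : 0 <= x -> x <= L -> normc (p x) <= 2 * N.
  by move=> x0 xL; apply: le_trans (pb L x x0 xL) _; rewrite ler_wpM2l.
have qN x : 0 <= x -> x <= L -> normc (q x) <= 2 * (2 * N) * x.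
  move=> x0 xL; apply: (cMVT_bound dq) => //; first exact: q0.
  by move=> t t0 tx; apply: pN => //; exact: le_trans xL.
pose c := - (q L / L%:C).
have LC : L%:C != 0 by apply/eqP => /(congr1 Re)/= L0'; move: L0; rewrite L0' ltxx.
have cN : normc c <= 4 * N.
  rewrite normcN ComplexField.Normc.normcM ComplexField.Normc.normcV normc_real.
  rewrite gtr0_norm// ler_pdivrMr//; have := qN L (ltW L0) (lexx L); lra.
have dx : cderiv (fun x => x%:C) (fun=> 1 : C).
  by move=> x; split; [exact: is_derive_id|exact: is_derive_cst].
exists (fun x => q x + c * x%:C), (fun x => p x + c * 1); split.
- exact: (cderivD dq (cderivZ _ dx)).
- apply: (eq_cderiv _ (cderivD dp (cderiv_cst _))) => x; exact: addr0.
- by rewrite q0// mulr0 addr0 /c mulNr divfK// subrr.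
- by rewrite p0// mulr1 add0r.
move=> x x0 xL; apply: (le_trans (le_normcD _ _)).
rewrite ComplexField.Normc.normcM normc_real ger0_norm//.
have qx := qN x x0 xL; have xN := le_trans xL LN.
have cx : normc c * x <= 4 * N * N by apply: ler_pM; rewrite ?normc_ge0.
have Nx : N * x <= N * N by rewrite ler_wpM2l//; lra.
rewrite expr2; lra.
Qed.

Lemma residual_L2 : is_L2 L f.
Proof.
have [[i i1 i2 i3] _] := uH3.
have N (v : R -> C) : is_L2 L v -> is_L2 L (fun x => - v x).
  move=> /(is_L2Z (-1)); congr is_L2; apply/funext => x; exact: mulN1r.
by apply: is_L2D; [apply: is_L2D; [exact: is_L2Z|exact: N]|exact: N].
Qed.

(** Of the boundary terms, those with u'' vanish with [g], and of those with u' only the one at 0 is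
    left, because u'(L) = 0. *)
Lemma integral_u3 (g g1 g2 : R -> C) :
  cderiv g g1 -> cderiv g1 g2 -> ccontinuous g2 -> g 0 = 0 -> g L = 0 ->
  cintegral L (fun x => u3 x * g x)
    = z * g1 0 + cintegral L (fun x => u1 x * g2 x).
Proof.
have [[i i1 i2 i3] [w w1 w2]] := uH3; move: i i1 i2 i3.
move=> /is_L2_cintegrable i /is_L2_cintegrable i1 /is_L2_cintegrable i2.
move=> /is_L2_cintegrable i3 dg dg1 cg2 g0 gL.
have cg1 := cderiv_continuous dg1.
have := cweak_ibp0 L0 i2 i3 w2 dg cg1 g0 gL => /eqP.
rewrite -eqr_oppLR => /eqP <-.
by rewrite (cweak_ibp_traces L0 i1 i2 w1 tu10 tu1L dg1 cg2); ring.
Qed.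

(** The conditions u(0) = u(L) = u'(L) = 0 and [g 0 = g L = 0] cancel every boundary term but u'(0)
    g'(0). *)
Lemma green_identity (g g1 g2 g3 h : R -> C) :
  cderiv g g1 -> cderiv g1 g2 -> cderiv g2 g3 -> ccontinuous g3 ->
  (forall x, g3 x + g1 x + lambda * g x = h x) -> g 0 = 0 -> g L = 0 ->
  cintegral L (fun x => u x * h x)
    = cintegral L (fun x => f x * g x) + z * g1 0.
Proof.
move=> dg dg1 dg2 cg3 gE g0 gL; have E3 := integral_u3 dg dg1 (cderiv_continuous dg2) g0 gL.
have [[i i1 i2 i3] [w w1 w2]] := uH3; move: i i1 i2 i3.
move=> /is_L2_cintegrable i /is_L2_cintegrable i1 /is_L2_cintegrable i2.
move=> /is_L2_cintegrable i3.
have cg := cderiv_continuous dg; have cg1 := cderiv_continuous dg1.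
have cg2 := cderiv_continuous dg2.
have E1 := cweak_ibp0 L0 i i1 w dg cg1 g0 gL.
have E2 := cweak_ibp_traces L0 i i1 w tu0 tuL dg2 cg3.
have clg : ccontinuous (fun x => lambda * g x).
  by apply: ccontinuousM => //; exact: ccontinuous_cst.
rewrite [LHS](_ : _ = cintegral L (fun x => u x * g3 x + u x * g1 x + u x * (lambda * g x))); last first.
  by apply: eq_cintegral => x; rewrite -gE; ring.
rewrite [X in _ = X + _](_ : _ = cintegral L (fun x => u x * (lambda * g x)
   + - (u1 x * g x) + - (u3 x * g x))); last first.
  by apply: eq_cintegral => x; rewrite /f; ring.
have a1 := cintegrableM L0 i cg3; have a2 := cintegrableM L0 i cg1.
have a3 := cintegrableM L0 i clg; have a4 := cintegrableM L0 i1 cg.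
have a5 := cintegrableM L0 i3 cg.
have a4' := cintegrableN a4; have a5' := cintegrableN a5.
have a12 := cintegrableD a1 a2; have a34 := cintegrableD a3 a4'.
rewrite !cintegralD// !cintegralN//.
by rewrite E3 E1 E2; ring.
Qed.

Lemma eigenvalue_bound (h : R -> C) (K N : R) :
  ccontinuous h -> (forall x, x <= 0 -> h x = 0) ->
  {ae mu, forall x, I x -> u x * h x = (normc (h x) ^+ 2)%:C} ->
  \int[mu]_(x in I) (normc (h x) ^+ 2) = 1 ->
  \int[mu]_(x in I) (normc (u3 x) ^+ 2) <= K ^+ 2 ->
  \int[mu]_(x in I) (normc (f x) ^+ 2) <= 1 ->
  normc z <= 1 -> 0 < K -> K <= N -> L <= N -> 1 <= N ->
  normc lambda <= 24 * N ^+ 6.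
Proof.
move=> ch h0 uh h1 u3K f1 z1 K0 KN LN N1.
have h2 := ccontinuous_L2 ch; have sh := is_L2_sqr h2.
have i3 := uH3.1; have {i3} [i2 i12 _ i32] := i3.
have hN : \int[mu]_(x in I) normc (h x) <= N.
  have := @L1_le_L2 R L L0 h 1 h2 ltr01; rewrite h1 expr1n => /(_ (lexx _)).
  move/le_trans; apply; lra.
have [k [k1 [dk dk1 [k00 kL0] k10 kN]]] := dirichlet_solution ch h0 LN N1 hN.
have E3 := integral_u3 dk dk1 ch k00 kL0.
have u3N : \int[mu]_(x in I) normc (u3 x) <= N * N.
  have := @L1_le_L2 R L L0 u3 K i32 K0 u3K => /le_trans; apply.
  rewrite [2^-1 * K]mulrC -mulrA; have L0' := L0; apply: ler_pM; lra.
have clh : ccontinuous (fun x => lambda * h x).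
  by apply: ccontinuousM => //; exact: ccontinuous_cst.
have f2 := residual_L2.
have a0 := cintegrableM L0 (is_L2_cintegrable f2) ch.
have a1 := cintegrableM L0 (is_L2_cintegrable i12) ch.
have a3 := cintegrableM L0 (is_L2_cintegrable i32) ch.
have lE : lambda = cintegral L (fun x => f x * h x) + cintegral L (fun x => u1 x * h x)
    + cintegral L (fun x => u3 x * h x).
  rewrite -!cintegralD//; last exact: cintegrableD.
  rewrite [RHS](_ : _ = cintegral L (fun x => u x * (lambda * h x))); last first.
    by apply: eq_cintegral => x; rewrite /f; ring.
  have sE := cintegral_real lambda sh; rewrite h1 mulr1 in sE.
  rewrite -[LHS]sE; apply: ae_eq_cintegral => //.
  - split.
      under eq_fun do rewrite ReM /= mulr0 subr0; exact: integrable_onZ.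
    under eq_fun do rewrite ImM /= mulr0 add0r; exact: integrable_onZ.
  - by apply: cintegrableM => //; exact: is_L2_cintegrable.
  - move: uh; apply: filterS => [|x uhx Ix].
      exact: (ae_filter_ringOfSetsType mu).
    by rewrite mulrCA uhx.
have h1' : \int[mu]_(x in I) (normc (h x) ^+ 2) <= 1 by rewrite h1.
have b0 := normc_cintegralM_le L0 f2 ch f1 h1'.
have b3 := normc_cintegralM_le L0 i32 ch u3K h1'.
have N2 : 0 <= 8 * N ^+ 2 by rewrite mulr_ge0 ?sqr_ge0.
have bk := normc_cintegralM_bound L0 i32 (cderiv_continuous dk) N2 u3N kN.
have E1 : cintegral L (fun x => u1 x * h x) = cintegral L (fun x => u3 x * k x) - z * k1 0.
  by rewrite E3; ring.
have zk : normc (z * k1 0) <= 1 * (4 * N).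
  by rewrite ComplexField.Normc.normcM; apply: ler_pM; rewrite ?normc_ge0.
have n1 : normc lambda <= normc (cintegral L (fun x => f x * h x))
   + (normc (cintegral L (fun x => u3 x * k x)) + normc (z * k1 0))
   + normc (cintegral L (fun x => u3 x * h x)).
  rewrite {1}lE; apply: (le_trans (le_normcD _ _)); rewrite lerD2r.
  apply: (le_trans (le_normcD _ _)); rewrite lerD2l E1.
  by apply: (le_trans (le_normcD _ _)); rewrite normcN.
(* The bounds add up to [2 + (16 N^4 + 4 N) + (N^2 + 1)], at most [24 N^6] since [N >= 1]. *)
apply: (le_trans n1).
have K2 : K ^+ 2 <= N ^+ 2 by rewrite lerXn2r ?nnegrE ?(ltW K0)//; lra.
have p (i : nat) : N ^+ i <= N ^+ i.+1 by apply: ler_weXn2l.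
have p0 : 1 <= N ^+ 2 by rewrite exprn_ege1.
have := p 1%N; have := p 2%N; have := p 3%N; have := p 4%N; have := p 5%N.
have NN4 : N * N * (8 * N ^+ 2) = 8 * N ^+ 4 by ring.
rewrite NN4 in bk; rewrite expr1.
move: (N ^+ 2) (N ^+ 3) (N ^+ 4) (N ^+ 5) (N ^+ 6) b0 b3 bk zk K2 p0 => n2 n3 n4 n5 n6.
lra.
Qed.

End AprioriBounds.

(** * Lower bound on the boundary value and the residual *)

Section Emptiness.
Variable R : realType.
Local Notation C := R[i].
Local Notation mu := (@lebesgue_measure R).
Local Notation normc := (@ComplexField.Normc.normc R).
Local Notation Re := (@complex.Re R).
Local Notation Im := (@complex.Im R).
Variable L : R.
Hypothesis L0 : 0 < L.
Local Notation I := (`]0, L[%classic : set R).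

(** The trace u(0) = 0 makes the constant extension to the left vanish, as required of the
    right-hand side of the adjoint problem; conjugation gives the product with u the modulus
    squared. *)
Lemma conjugate_representative (u : R -> C) : is_L2 L u -> has_trace L u 0 0 ->
  exists h : R -> C, [/\ ccontinuous h, forall x, x <= 0 -> h x = 0,
    {ae mu, forall x, I x -> u x * h x = (normc (h x) ^+ 2)%:C} &
    \int[mu]_(x in I) (normc (h x) ^+ 2) = \int[mu]_(x in I) (normc (u x) ^+ 2)].
Proof.
move=> u2 [w [cR cI wu w0]].
pose c (x : R) := Num.max 0 (Num.min x L).
exists (fun x => Re (w (c x)) -i* Im (w (c x))).
have ch : ccontinuous (fun x => Re (w (c x)) -i* Im (w (c x))).
  split => x /=.
    exact: (continuous_clamp L0 cR).
  by apply: cvgN; exact: (continuous_clamp L0 cI).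
have cE x : I x -> c x = x.
  by rewrite /= in_itv/= => /andP[/ltW x0 /ltW xL]; exact: clampE.
split => //.
- move=> x x0; have -> : c x = 0.
    by rewrite /c max_l// ge_min x0.
  by rewrite w0 /= oppr0.
- move: wu; apply: filterS => [|x wux Ix].
    exact: (ae_filter_ringOfSetsType mu).
  rewrite cE// -wux// sqr_normcE /=; case: (w x) => a b /=.
  by apply/eqP; rewrite eq_complex /=; apply/andP; split; apply/eqP; ring.
rewrite /Rintegral; congr fine; apply: ae_eq_integral => //.
- apply/measurable_EFinP; apply: continuous_measurable_on => x.
  by apply: cvgM; exact: continuous_normc.
- by apply/measurable_EFinP; apply: integrable_measurable; exact: is_L2_sqr.
move: wu; apply: filterS => [|x wux Ix].
  exact: (ae_filter_ringOfSetsType mu).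
by rewrite cE// -wux// !sqr_normcE /= sqrrN.
Qed.

Lemma norm_H3_le (u u3 : R -> C) (K : R) : is_L2 L u -> is_L2 L u3 -> 0 <= K ->
  norm_H3 L u u3 <= K -> \int[mu]_(x in I) (normc (u3 x) ^+ 2) <= K ^+ 2.
Proof.
move=> /is_L2_sqr su /is_L2_sqr su3 K0 uK.
have s0 : 0 <= \int[mu]_(x in I) (normc (u x) ^+ 2).
  by apply: Rintegral_ge0 => x _; exact: sqr_ge0.
have s30 : 0 <= \int[mu]_(x in I) (normc (u3 x) ^+ 2).
  by apply: Rintegral_ge0 => x _; exact: sqr_ge0.
have : norm_H3 L u u3 ^+ 2 <= K ^+ 2.
  by rewrite lerXn2r ?nnegrE// sqrtr_ge0.
rewrite /norm_H3 RintegralD// sqr_sqrtr ?addr_ge0//; lra.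
Qed.

Lemma norm_L2_le (f : R -> C) (s : R) : 0 <= s -> norm_L2 L f <= s ->
  \int[mu]_(x in I) (normc (f x) ^+ 2) <= s ^+ 2.
Proof.
move=> s0 fs; have : norm_L2 L f ^+ 2 <= s ^+ 2.
  by rewrite lerXn2r ?nnegrE// sqrtr_ge0.
rewrite sqr_sqrtr//; by apply: Rintegral_ge0 => x _; exact: sqr_ge0.
Qed.

Lemma eigenvalue_gap (u u1 u2 u3 : R -> C) (z lambda : C) (K d : R) (n : nat)
    (N := n.+1%:R : R) :
  is_H3 L u u1 u2 u3 -> norm_L2 L u = 1 -> norm_H3 L u u3 <= K ->
  has_trace L u 0 0 -> has_trace L u L 0 ->
  has_trace L u1 0 z -> has_trace L u1 L 0 ->
  1 <= K -> K < N -> L < N -> N^-1 < L ->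
  (forall k l : nat, (0 < k <= n.+1)%N -> (0 < l <= n.+1)%N -> N^-1 <
     `|3 * L ^+ 2 - 4 * pi ^+ 2 * (quadratic_form k l)%:R|) ->
  0 < d -> d <= 1 -> normc z <= d ->
  norm_L2 L (fun x => lambda * u x - u1 x - u3 x) <= d ->
  1 <= d * (24 * 30 * 25 ^+ 2 * 3 * N ^+ 19 * expR (25 * N ^+ 7) ^+ 10).
Proof.
move=> uH3 u_1 u3K tu0 tuL tu10 tu1L K1 KN LN NL gap d0 d1 zd fd.
have N1 : 1 <= N by rewrite ler1n.
have N0 : 0 < N by lra.
have [[i i1 i2 i3] _] := uH3.
have [h [ch h0 uh hE]] := conjugate_representative i tu0.
have h1 : \int[mu]_(x in I) (normc (h x) ^+ 2) = 1.
  rewrite hE -[LHS]sqr_sqrtr; last by apply: Rintegral_ge0 => x _; exact: sqr_ge0.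
  by move: u_1; rewrite /norm_L2 => ->; rewrite expr1n.
have K0 : 0 < K by lra.
have u3K2 := norm_H3_le i i3 (ltW K0) u3K.
have fd2 := norm_L2_le (ltW d0) fd.
have f1 : \int[mu]_(x in I) (normc (lambda * u x - u1 x - u3 x) ^+ 2) <= 1.
  by apply: (le_trans fd2); rewrite expr_le1// ltW.
have lamN := eigenvalue_bound L0 uH3 tu10 tu1L ch h0 uh h1 u3K2 f1
  (le_trans zd d1) K0 (ltW KN) (ltW LN) N1.
(* [root_bound] gives [1 + |lambda| <= 1 + 24 N^6]. *)
pose M := 25 * N ^+ 6.
have N6 : 1 <= N ^+ 6 by rewrite exprn_ege1.
have M1 : 1 <= M by rewrite /M; lra.
have [nu1 [nu2 [nu3 [e1 e2 e3]]]] := exists_roots lambda.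
have lM : 1 + normc lambda <= M by rewrite /M; lra.
have b1 : normc nu1 <= M by apply: le_trans lM; exact: root_bound e1 e2 e3.
have b2 : normc nu2 <= M.
  apply: le_trans lM; apply: (@root_bound R lambda nu2 nu3 nu1).
  - by rewrite -e1; ring.
  - by rewrite -e2; ring.
  - by rewrite -e3; ring.
have b3 : normc nu3 <= M.
  apply: le_trans lM; apply: (@root_bound R lambda nu3 nu1 nu2).
  - by rewrite -e1; ring.
  - by rewrite -e2; ring.
  - by rewrite -e3; ring.
pose kappa := (30 * M ^+ 2 * N ^+ 2)^-1.
have D1 : 1 <= 30 * M ^+ 2 * N ^+ 2.
  by rewrite -mulrA mulr_ege1 ?mulr_ege1 ?exprn_ege1// ler1n.
have k0 : 0 < kappa by rewrite invr_gt0; lra.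
have k1 : kappa <= 1 by rewrite invf_le1//; lra.
have h2 : is_L2 L h by exact: ccontinuous_L2.
have hN : \int[mu]_(x in I) normc (h x) <= N.
  have := @L1_le_L2 R L L0 h 1 h2 ltr01; rewrite h1 expr1n => /(_ (lexx _)).
  move/le_trans; apply; lra.
pose S := 24 * expR (M * N) ^+ 10 * N ^+ 4 / kappa.
have [g [g1 [g2 [g3 [[dg dg1 dg2 cg3] gE [g0 gL] g1S gS]]]]] :
  exists g g1 g2 g3 : R -> C,
    [/\ [/\ cderiv g g1, cderiv g1 g2, cderiv g2 g3 & ccontinuous g3],
        forall x, g3 x + g1 x + lambda * g x = h x, g 0 = 0 /\ g L = 0,
        normc (g1 0) <= S &
        forall x, 0 <= x -> x <= L -> normc (g x) <= S].
  (* The relations between the roots are cyclic, so whichever pair is separated can take the place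
     of the first two. *)
  case: (root_gap M1 NL LN gap e1 e2 b1 b2 b3) => kd.
  - exact: (adjoint_solution e1 e2 e3 b1 b2 b3 L0 (ltW LN) N1 k0 k1 kd ch h0 hN).
  - apply: (@adjoint_solution R lambda nu2 nu3 nu1 h L M N kappa) => //; try exact: ltW.
    + by rewrite -e1; ring.
    + by rewrite -e2; ring.
    + by rewrite -e3; ring.
  - apply: (@adjoint_solution R lambda nu3 nu1 nu2 h L M N kappa) => //; try exact: ltW.
    + by rewrite -e1; ring.
    + by rewrite -e2; ring.
    + by rewrite -e3; ring.
have S0 : 0 <= S by apply: le_trans g1S; exact: normc_ge0.
have green := green_identity L0 uH3 tu0 tuL tu10 tu1L dg dg1 dg2 cg3 gE g0 gL.
have uhE : cintegral L (fun x => u x * h x) = 1.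
  have sh := is_L2_sqr h2.
  rewrite (_ : 1 = cintegral L (fun x => 1 * (normc (h x) ^+ 2)%:C)); last first.
    by rewrite cintegral_real// h1 mulr1.
  apply: ae_eq_cintegral.
  - by apply: cintegrableM => //; exact: is_L2_cintegrable.
  - split.
      by under eq_fun do rewrite mul1r /=.
    under eq_fun do rewrite mul1r /=; exact: integrable_on_cst.
  - move: uh; apply: filterS => [|x uhx Ix].
      exact: (ae_filter_ringOfSetsType mu).
    by rewrite mul1r uhx.
have f2 : is_L2 L (fun x => lambda * u x - u1 x - u3 x) by exact: residual_L2 uH3.
have fB := L1_le_L2 L0 f2 d0 fd2.
have fg := normc_cintegralM_bound L0 f2 (cderiv_continuous dg) S0 fB gS.
have zg : normc (z * g1 0) <= d * S.
  by rewrite ComplexField.Normc.normcM ler_pM ?normc_ge0.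
(* The residual contributes [d (L + 1) S], through its L^1 norm, and the boundary term [d S]. *)
have one : 1 <= d * S * (L + 2).
  rewrite -[X in X <= _](@ComplexField.Normc.normc1 R) -uhE green.
  apply: (le_trans (le_normcD _ _)); apply: (le_trans (lerD fg zg)).
  by have := mulr_ge0 (ltW d0) S0; lra.
apply: (le_trans one).
(* From [1 / kappa = 30 M^2 N^2] with [M = 25 N^6], and [L + 2 <= 3 N]: the powers of [N] are 4 in
   [S], 14 in [1 / kappa] and 1. *)
have -> : 24 * 30 * 25 ^+ 2 * 3 * N ^+ 19 * expR (25 * N ^+ 7) ^+ 10
   = S * (3 * N).
  rewrite /S /kappa invrK /M.
  have -> : 25 * N ^+ 6 * N = 25 * N ^+ 7 by ring.
  by ring.
rewrite -mulrA ler_pM2l// ler_wpM2l//; lra.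
Qed.

End Emptiness.

(* Bounds the inverse of the smallness required in [eigenvalue_gap], through
   [24 * 30 * 25 ^ 2 * 3 <= 4 ^ 11] and [exp 1 <= 4]. *)
Definition growth (n : nat) : nat := (n.+1 ^ 19 * 4 ^ (11 + 250 * n.+1 ^ 7))%N.

Lemma growth_ge n : (n <= growth n)%N.
Proof.
rewrite /growth (leq_trans (leqnSn n))// -[X in (X <= _)%N]muln1.
by rewrite leq_mul ?expn_gt0// -[X in (X <= _)%N]expn1 leq_pexp2l.
Qed.

Lemma primrec_growth : primrec 1 (fun _ _ xs => growth (nth 0%N xs 0)).
Proof.
have pS : primrec 1 (fun _ _ xs => (nth 0%N xs 0).+1).
  by apply: primrec_succ; exact: primrec_proj.
apply: primrec_mul; first by apply: primrec_exp; [|exact: primrec_const].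
apply: primrec_exp; first exact: primrec_const.
apply: primrec_add; first exact: primrec_const.
apply: primrec_mul; first exact: primrec_const.
by apply: primrec_exp; [|exact: primrec_const].
Qed.

(** From [exp (-1/2) >= 1/2] one gets [exp (1/2) <= 2], hence [exp 1 <= 4]. *)
Lemma expR_le_4X (R : realType) (n : nat) : expR n%:R <= 4 ^+ n :> R.
Proof.
rewrite -[n%:R]mulr1 expRM_natl lerXn2r ?nnegrE ?expR_ge0//.
have h := expR_ge1Dx (- 2^-1 : R); have e := expRxMexpNx_1 (2^-1 : R).
have p := expR_gt0 (2^-1 : R).
have e2 : expR (2^-1) <= 2 :> R by nra.
rewrite [X in expR X](_ : 1 = 2^-1 + 2^-1); last by field.
by rewrite expRD; nra.
Qed.

Lemma growth_bound (R : realType) (n : nat) (N := n.+1%:R : R) :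
  24 * 30 * 25 ^+ 2 * 3 * N ^+ 19 * expR (25 * N ^+ 7) ^+ 10 <= (growth n)%:R.
Proof.
have N0 : 0 <= N by [].
have -> : (growth n)%:R = 4 ^+ 11 * N ^+ 19 * 4 ^+ (250 * n.+1 ^ 7) :> R.
  by rewrite /growth natrM !natrX exprD; ring.
have c : 24 * 30 * 25 ^+ 2 * 3 <= 4 ^+ 11 :> R.
  have -> : 4 ^+ 11 = 32 * 32 * 32 ^+ 2 * 4 :> R by ring.
  have h : 25 ^+ 2 <= 32 ^+ 2 :> R by rewrite lerXn2r ?nnegrE//; lra.
  by rewrite !ler_pM// ?mulr_ge0//; lra.
apply: ler_pM; rewrite ?exprn_ge0 ?expR_ge0//.
- by rewrite !mulr_ge0// exprn_ge0.
- by rewrite ler_wpM2r ?exprn_ge0.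
(* The tenth power turns the exponent [25 N^7] into the [250 N^7] of [growth]. *)
rewrite -expRM_natl (le_trans _ (expR_le_4X _ _))// ler_expR natrM natrX.
by rewrite mulrA ler_wpM2r ?exprn_ge0//; lra.
Qed.

Theorem proposition1p2 (R : realType) :
  exists gamma : R -> R -> R,
    computable_on
      [set p : R * R | 0 < p.1 /\ ~ critical_lengths R p.1 /\ 1 <= p.2] gamma /\
    forall L K1 : R, 1 <= K1 -> 0 < L -> ~ critical_lengths R L ->
      0 < gamma L K1 /\ Bset L K1 (gamma L K1) = set0.
Proof.
exists (@gamma R growth); split.
  by apply: gamma_computable; [exact: growth_ge|exact: primrec_growth].
move=> L K K1 L0 ncrit; split; first by apply: gamma_gt0 => //; exact: growth_ge.
apply/eqP/negPn/negP => /set0P[u [u1 [u2 [u3 [[uH3 u_1 u3K]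
  [[tu0 tuL tu1L] [[z [tu10 zg]]]]]]]]].
(* The infimum need not be attained, but being strictly below gamma it provides some [lambda]; the
   value at 0 shows that the set is nonempty. *)
move=> /inf_lt[|_ [lambda _ <-] fg]; first by exists (norm_L2 L (fun x => 0 * u x - u1 x - u3 x)), 0.
set f := fun x => _ in fg.
(* Taking the maximum makes one index [n] serve for both inequalities. *)
have : Num.max (ComplexField.Normc.normc z) (norm_L2 L f) < gamma growth L K.
  by rewrite gt_max zg fg.
move=> /(gamma_gt growth_ge)[n]; rewrite /gamma_term gt_max.
rewrite !(lt_min _ _ (margin n L K)) => /andP[/andP[zn mn] /andP[fn _]].
have /margin_gt0[KN LN NL gap] := le_lt_trans (normc_ge0 z) mn.
have G0 : 0 < (growth n).+1%:R :> R by rewrite ltr0n.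
have d1 : (growth n).+1%:R^-1 <= 1 :> R by rewrite invf_le1// ler1n.
have := eigenvalue_gap L0 uH3 u_1 u3K tu0 tuL tu10 tu1L K1 KN LN NL gap.
move=> /(_ _ _ _ d1 (ltW zn) (ltW fn)).
(* With [d = 1 / (growth n + 1)], the lower bound says that [growth n + 1] is at most a constant
   that [growth_bound] places below [growth n]. *)
rewrite invr_gt0 => /(_ G0); rewrite mulrC ler_pdivlMr// mul1r leNgt => /negP; apply.
by apply: (le_lt_trans (growth_bound R n)); rewrite ltr_nat.
Qed.
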